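(* Let $n\in\mathbb{N}$ and $p=p_F:=1+\frac{2}{n}$. Let $\beta\in[-1,1)\setminus\{0\}$ and let $b$ be a positive function satisfying conditions (B1)--(B4) (listed in the context) with this $\beta$. Put $b^*:=\int_0^\infty e^{-\int_0^\tau b(s)\,ds}\,d\tau$. Let $(u_0,u_1)\in (H^1(\mathbb{R}^n)\cap L^1(\mathbb{R}^n))\times(L^2(\mathbb{R}^n)\cap L^1(\mathbb{R}^n))$ be real-valued and satisfy $$\int_{\mathbb{R}^n}\bigl(u_0(x)+b^*u_1(x)\bigr)\,dx>0.$$ For $\varepsilon>0$ let $T(\varepsilon)$ be the lifespan of the energy solution of $$\partial_t^2u-\Delta u+b(t)\partial_tu=|u|^p,\qquad u(0,x)=\varepsilon u_0(x),\quad u_t(0,x)=\varepsilon u_1(x).$$ Then there exist constants $C>0$ (independent of $\varepsilon$) and $\varepsilon_0>0$ such that for every $\varepsilon\in(0,\varepsilon_0)$, $$T(\varepsilon)\le\begin{cases}\exp\bigl(\exp(C\varepsilon^{-(p-1)})\bigr)&\text{if }\beta=-1,\\ \exp\bigl(C\varepsilon^{-(p-1)}\bigr)&\text{if }\beta\in(-1,1)\setminus\{0\}.\end{cases}$$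
   Context: Conditions on $b$ (with the given $\beta$): (B1) $b\in C^2((0,\infty))$; (B2) $b(t)\approx(t+1)^{-\beta}$ for $t\ge0$; (B3) $|b'(t)|\approx(t+1)^{-\beta-1}$ for $t\ge0$; (B4) $|b''(t)|\lesssim(t+1)^{-\beta-2}$ for $t\ge0$. Here $A\lesssim B$ means $A\le cB$ with some positive constant $c$ independent of $t$, and $A\approx B$ means $A\lesssim B$ and $B\lesssim A$. Energy solution: for $T>0$ and $(u_0,u_1)\in H^1(\mathbb{R}^n)\times L^2(\mathbb{R}^n)$, a real-valued $u$ is an energy solution on $[0,T)$ if $u\in C^2([0,T);H^{-1}(\mathbb{R}^n))\cap C^1([0,T);L^2(\mathbb{R}^n))\cap C([0,T);H^1(\mathbb{R}^n))$, $u(0)=\varepsilon u_0$, $u_t(0)=\varepsilon u_1$, and $\partial_t^2u-\Delta u+b(t)\partial_tu=|u|^p$ holds in the sense of $C([0,T);H^{-1}(\mathbb{R}^n))$. Lifespan: $T(\varepsilon):=\sup\{T\in(0,\infty]: u\text{ is a unique energy solution on }[0,T)\}$. *)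

(* Defs.v *)
From HB Require Import structures.
From mathcomp Require Import all_boot all_order all_algebra.
From mathcomp Require Import all_classical all_reals all_analysis.
Set Implicit Arguments.
Unset Strict Implicit.
Unset Printing Implicit Defensive.
Import Order.TTheory GRing.Theory Num.Theory.
Import numFieldNormedType.Exports.
Local Open Scope classical_set_scope.
Local Open Scope ring_scope.

(* The space R^n is 'rV[R]_n. Its sigma-algebra is the one generated by the
   coordinates, as for n.-tuple in the library. *)
Section measurable_rV.
Context {R : realType}.
Variable n : nat.

Let coord (i : 'I_n) (x : 'rV[R]_n) : R := x ord0 i.

Let rV_set0 : g_sigma_preimage coord set0.
Proof. exact: sigma_algebra0. Qed.

Let rV_setC A : g_sigma_preimage coord A -> g_sigma_preimage coord (~` A).
Proof. exact: sigma_algebraC. Qed.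

Let rV_bigcup (F : (set 'rV[R]_n)^nat) : (forall i, g_sigma_preimage coord (F i)) ->
  g_sigma_preimage coord (\bigcup_i (F i)).
Proof. exact: sigma_algebra_bigcup. Qed.

HB.instance Definition _ :=
  @isMeasurable.Build (measure_tuple_display default_measure_display) 'rV[R]_n
  (g_sigma_preimage coord) rV_set0 rV_setC rV_bigcup.

End measurable_rV.

Section measurable_rV_fun.
Context {R : realType} d (T : measurableType d) (n : nat).

Lemma measurable_fun_rVP (f : T -> 'rV[R]_n) :
  (forall i, measurable_fun [set: T] (fun t => f t ord0 i)) ->
  measurable_fun [set: T] f.
Proof.
move=> mf _ A mA; rewrite setTI.
pose S : set_system 'rV[R]_n := [set B | measurable (f @^-1` B)].
have sS : sigma_algebra setT S.
  split.
  - by rewrite /S/= preimage_set0.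
  - by move=> B SB; rewrite /S/= setTD preimage_setC; exact: measurableC.
  - by move=> F SF; rewrite /S/= preimage_bigcup; apply: bigcupT_measurable => k; exact: SF.
apply: (smallest_sub sS _ mA) => B; rewrite -bigcup_seq => -[i _ [C mC <-]].
by rewrite /S/= setTI; have := mf i measurableT _ mC; rewrite setTI.
Qed.

End measurable_rV_fun.

Section lebesgue_rV.
Context {R : realType}.

Definition cons_rV n (z : R * 'rV[R]_n) : 'rV[R]_n.+1 :=
  \row_(i < n.+1) oapp (fun j => z.2 ord0 j) z.1 (unlift ord0 i).

Lemma measurable_coord_rV n (i : 'I_n) :
  measurable_fun [set: 'rV[R]_n] (fun x => x ord0 i).
Proof.
move=> _ Y mY; rewrite setTI; apply: sub_sigma_algebra => /=.
rewrite -bigcup_seq/=; exists i => /=; first by rewrite mem_index_enum.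
by exists Y => //; rewrite setTI.
Qed.

Lemma measurable_cons_rV n : measurable_fun [set: R * 'rV[R]_n] (@cons_rV n).
Proof.
apply: measurable_fun_rVP => i; rewrite /cons_rV.
case: (unliftP ord0 i) => [j|] ->.
- under eq_fun do rewrite mxE liftK/=.
  exact: (measurableT_comp (measurable_coord_rV j) measurable_snd).
- under eq_fun do rewrite mxE unlift_none/=.
  exact: measurable_fst.
Qed.

(* The product measure of lebesgue_measure and m, seen on 'rV[R]_n.+1. *)
Section cons_measure.
Variable n : nat.
Variable m : {sigma_finite_measure set 'rV[R]_n -> \bar R}.

Definition cons_measure : set 'rV[R]_n.+1 -> \bar R :=
  pushforward (@lebesgue_measure R \x m)%E (@cons_rV n).

Let cons_measure0 : cons_measure set0 = 0%E.
Proof. by rewrite /cons_measure /pushforward preimage_set0 measure0. Qed.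

Let cons_measure_ge0 A : (0 <= cons_measure A)%E.
Proof. by apply: integral_ge0 => x _; exact: measure_ge0. Qed.

Let measurable_preimage_cons A : measurable A -> measurable (@cons_rV n @^-1` A).
Proof.
by move=> mA; rewrite -[X in measurable X]setTI; exact: measurable_cons_rV.
Qed.

Let cons_measure_sigma_additive : semi_sigma_additive cons_measure.
Proof.
move=> F mF tF mUF; rewrite /cons_measure /pushforward preimage_bigcup.
apply: measure_semi_sigma_additive.
- by move=> k; exact: measurable_preimage_cons.
- apply/trivIsetP => /= i j _ _ ij; rewrite -preimage_setI.
  by move/trivIsetP : tF => /(_ _ _ _ _ ij) ->//; rewrite preimage_set0.
- by rewrite -preimage_bigcup; exact: measurable_preimage_cons.
Qed.

HB.instance Definition _ := isMeasure.Build _ _ _ cons_measure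
  cons_measure0 cons_measure_ge0 cons_measure_sigma_additive.

Let cons_measure_sigma_finite : sigma_finite setT cons_measure.
Proof.
have /sigma_finiteP[F [TF ndF Foo]] := sigma_finiteT (@lebesgue_measure R).
have /sigma_finiteP[G [TG ndG Goo]] := sigma_finiteT m.
pose u (x : 'rV[R]_n.+1) : measurableTypeR R * 'rV[R]_n :=
  (x ord0 ord0, \row_j x ord0 (lift ord0 j)).
have mu : measurable_fun setT u.
  apply/measurable_fun_pairP; split; first exact: measurable_coord_rV.
  apply: measurable_fun_rVP => i /=; under eq_fun do rewrite mxE.
  exact: measurable_coord_rV.
have consK : cancel (@cons_rV n) u.
  move=> [x y]; rewrite /u /cons_rV mxE unlift_none/=; congr pair.
  by apply/rowP => j; rewrite !mxE liftK.
exists (fun k => u @^-1` (F k `*` G k)).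
  rewrite -preimage_bigcup; apply/esym/seteqP; split => // x _ /=.
  have [k _ Fk] : (\bigcup_k F k) (u x).1 by rewrite -TF.
  have [l _ Gl] : (\bigcup_k G k) (u x).2 by rewrite -TG.
  exists (maxn k l) => //; split.
    by move: Fk; exact/subsetPset/ndF/leq_maxl.
  by move: Gl; exact/subsetPset/ndG/leq_maxr.
move=> k; have [mF Fk] := Foo k; have [mG Gk] := Goo k; split.
  by rewrite -[X in measurable X]setTI; apply: mu => //; exact: measurableX.
rewrite /cons_measure /pushforward -comp_preimage.
rewrite (_ : u \o _ = id); last by apply/funext => z /=; exact: consK.
by rewrite preimage_id product_measure1E// lte_mul_pinfty// ge0_fin_numE.
Qed.

HB.instance Definition _ := Measure_isSigmaFinite.Build _ _ _ cons_measure
  cons_measure_sigma_finite.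

End cons_measure.

(* 'rV[R]_0 is a singleton, so its Lebesgue measure is the Dirac mass. *)
Fixpoint lebesgue_rV n : {sigma_finite_measure set 'rV[R]_n -> \bar R} :=
  match n with
  | 0 => \d_(0 : 'rV[R]_0)
  | n'.+1 => cons_measure (lebesgue_rV n')
  end.

Lemma measurable_box n (A : 'I_n -> set R) : (forall i, measurable (A i)) ->
  measurable [set x : 'rV[R]_n | forall i, A i (x ord0 i)].
Proof.
move=> mA.
rewrite (_ : [set x | _] = \big[setI/setT]_(i < n) ((fun x : 'rV[R]_n => x ord0 i) @^-1` A i)).
  apply: bigsetI_measurable => i _; rewrite -[X in measurable X]setTI.
  exact: measurable_coord_rV.
rewrite -bigcap_seq; apply/seteqP; split=> x /= Ax i; first by move=> _; exact: Ax.
by apply: Ax => /=; rewrite mem_index_enum.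
Qed.

Lemma lebesgue_rV_box n (A : 'I_n -> set R) : (forall i, measurable (A i)) ->
  lebesgue_rV n [set x | forall i, A i (x ord0 i)] =
  (\prod_(i < n) lebesgue_measure (A i))%E.
Proof.
elim: n A => [|n IHn] A mA.
  by rewrite big_ord0 /= diracE mem_set// => -[].
rewrite big_ord_recl -(IHn (fun i => A (lift ord0 i)))// -product_measure1E//=.
  rewrite /cons_measure /pushforward; congr product_measure1.
  apply/seteqP; split=> -[x y] /=.
    move=> Axy; split=> [|i]; first by have := Axy ord0; rewrite mxE unlift_none.
    by have := Axy (lift ord0 i); rewrite mxE liftK.
  move=> [Ax Ay] i; rewrite mxE.
  by case: (unliftP ord0 i) => [j|] -> /=.
  exact: mA.
by apply: (@measurable_box _ (fun i => A (lift ord0 i))) => i; exact: mA.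
Qed.

End lebesgue_rV.
Arguments lebesgue_rV : clear implicits.

Section sobolev.
Context {R : realType} {n : nat}.
Local Notation mu := (lebesgue_rV R n).
Implicit Types (f g phi : 'rV[R]_n -> R) (L : ('rV[R]_n -> R) -> R).

Definition partial (i : 'I_n) f : 'rV[R]_n -> R := 'D_(delta_mx ord0 i) f.

Definition smooth f := forall s : seq 'I_n,
  continuous (foldr partial f s) /\
  forall i x, derivable (foldr partial f s) x (delta_mx ord0 i).

Definition test_function phi :=
  smooth phi /\ compact (closure [set x | phi x != 0]).

Definition weak_partial (i : 'I_n) f g := forall phi, test_function phi ->
  \int[mu]_x (f x * partial i phi x) = - \int[mu]_x (g x * phi x).

(* The weak derivative in L^2, which is unique up to equality a.e. *)
Definition wpartial (i : 'I_n) f : 'rV[R]_n -> R :=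
  xget 0 [set g | g \in Lfun mu 2 /\ weak_partial i f g].

Definition L2norm f : \bar R := ('N[mu]_2[EFin \o f])%E.

Definition L2 : set ('rV[R]_n -> R) := [set f | f \in Lfun mu 2].

Definition H1 : set ('rV[R]_n -> R) := [set f | L2 f /\
  forall i, exists2 g, L2 g & weak_partial i f g].

Definition H1norm f : \bar R :=
  ((L2norm f ^+ 2 + \sum_(i < n) L2norm (wpartial i f) ^+ 2) `^ 2^-1)%E.

(* H^-1 is the dual of H^1: only the values on H1 of a functional matter. *)
Definition Hm1 : set (('rV[R]_n -> R) -> R) := [set L |
  (forall a f g, H1 f -> H1 g -> L (a *: f + g) = a * L f + L g) /\
  exists C : R, forall f, H1 f -> (`|L f|%:E <= C%:E * H1norm f)%E].

Definition Hm1norm L : \bar R :=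
  ereal_sup [set `|L f|%:E | f in [set f | H1 f /\ (H1norm f <= 1)%E]].

(* The functional induced by a function, i.e. the embedding of L^2 in H^-1. *)
Definition to_dual f : ('rV[R]_n -> R) -> R :=
  fun phi => \int[mu]_x (f x * phi x).

(* The Laplacian as an operator from H^1 to H^-1. *)
Definition laplacian f : ('rV[R]_n -> R) -> R :=
  fun phi => - \sum_(i < n) \int[mu]_x (wpartial i f x * wpartial i phi x).

End sobolev.
Arguments L2 : clear implicits.
Arguments H1 : clear implicits.
Arguments Hm1 : clear implicits.

Definition time_interval {R : realType} (T : \bar R) : set R :=
  [set t | 0 <= t /\ (t%:E < T)%E].

(* C^k([0, T); E) for a subspace E of X with norm N; the successive derivatives
   are explicit arguments, and are one-sided at 0. *)
Section Ck_curves.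
Context {R : realType} {X : lmodType R}.
Variables (T : \bar R) (E : set X) (N : X -> \bar R).
Implicit Types u v w : R -> X.
Local Notation I := (time_interval T).

Definition C0_curve u := forall t, I t ->
  E (u t) /\ N (u s - u t) @[s --> within I (nbhs t)] --> 0%E.

Definition derivative_curve u v := forall t, I t ->
  N ((s - t)^-1 *: (u s - u t) - v t) @[s --> within I t^'] --> 0%E.

Definition C1_curve u v := [/\ C0_curve u, derivative_curve u v & C0_curve v].

Definition C2_curve u v w := C1_curve u v /\ C1_curve v w.

End Ck_curves.

Section damped_wave.
Context {R : realType} {n : nat}.
Local Notation mu := (lebesgue_rV R n).
Variables (b : R -> R) (p : R) (u0 u1 : 'rV[R]_n -> R).

(* The equation is an equality in H^-1. The integrability condition makes |u|^p
   a genuine functional on H^1: without it, \int[mu]_x would return a default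
   value. *)
Definition energy_solution (eps : R) (T : \bar R) (u : R -> 'rV[R]_n -> R) :=
  exists (v : R -> 'rV[R]_n -> R) (w : R -> ('rV[R]_n -> R) -> R),
  [/\ C0_curve T (H1 R n) H1norm u,
      C1_curve T (L2 R n) L2norm u v,
      C2_curve T (Hm1 R n) Hm1norm (to_dual \o u) (to_dual \o v) w,
      u 0 = eps *: u0 %[ae mu] /\ v 0 = eps *: u1 %[ae mu] &
      forall t, time_interval T t -> forall phi, H1 R n phi ->
        mu.-integrable setT (fun x => (`|u t x| `^ p * phi x)%:E) /\
        w t phi - laplacian (u t) phi + b t * to_dual (v t) phi =
        to_dual (fun x => `|u t x| `^ p) phi].

Definition unique_energy_solution eps T u :=
  energy_solution eps T u /\
  forall u', energy_solution eps T u' ->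
  forall t, time_interval T t -> u' t = u t %[ae mu].

Definition lifespan (eps : R) : \bar R := ereal_sup [set T |
  (0 < T)%E /\ exists u, unique_energy_solution eps T u].

End damped_wave.

Section damping.
Context {R : realType}.
Implicit Types (A B b : R -> R) (I : set R).

Definition lesssim I A B := exists2 c : R, 0 < c & forall t, I t -> A t <= c * B t.

Definition asymp I A B := lesssim I A B /\ lesssim I B A.

(* Under damping_B1 the derivatives exist at t > 0 only. *)
Definition damping_B1 b := forall t, 0 < t ->
  [/\ derivable b t 1, derivable (derive1 b) t 1 & {for t, continuous (derive1 (derive1 b))}].

Definition damping_B2 beta b :=
  asymp [set t | 0 <= t] b (fun t => (t + 1) `^ (- beta)).

Definition damping_B3 beta b :=
  asymp [set t | 0 < t] (fun t => `|derive1 b t|) (fun t => (t + 1) `^ (- beta - 1)).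

Definition damping_B4 beta b :=
  lesssim [set t | 0 < t] (fun t => `|derive1 (derive1 b) t|)
    (fun t => (t + 1) `^ (- beta - 2)).

Definition bstar b : R :=
  \int[lebesgue_measure]_(tau in `[0, +oo[)
    expR (- \int[lebesgue_measure]_(s in `[0, tau]) b s).

End damping.

Definition fujita {R : realType} (n : nat) : R := 1 + 2 / n%:R.

(* Main.v *)
Require Import Defs.
From mathcomp Require Import all_boot all_order all_algebra.
From mathcomp Require Import all_classical all_reals all_analysis.
From mathcomp Require Import measurable_realfun ring lra.
Import Order.TTheory GRing.Theory Num.Theory.
Import numFieldNormedType.Exports.
Local Open Scope classical_set_scope.
Local Open Scope ring_scope.

(** The proof is a test-function argument, organised as a recursion over dyadic
    space-time scales.

    The damping is absorbed by a weight [g], the solution of [g' = b g - 1] that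
    stays comparable to [(1 + t)^beta] ([weight], [weight_upper],
    [weight_lower]). It starts from [g(0) = bstar b], and it puts the equation in
    the divergence form [(g u_t + u)_t = g (Laplacian u + |u|^p)], in which the
    data enter through the mean of [u0 + bstar b * u1] alone. In the time variable
    [Phi] with [Phi' = (1 + t)^beta] ([clock]) what remains scales like the
    semilinear heat equation, for which [1 + 2 / n] is the critical exponent.

    Let [psi_k] be a cutoff at the scale [2^k] in space and [4^k] in the variable
    [Phi], and let [A_k] be the integral of [g |u|^p psi_k] up to a time [M] at
    which the cutoffs have closed. Testing with [psi_(k+1)] bounds [delta + A_(k+1)],
    where [delta] is of the order of [eps], by integrals of [u] against derivatives
    of [psi_(k+1)]. These derivatives live where [psi_k] vanishes, so that the Young
    inequality with a parameter [l] gives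
    [delta + A_(k+1) <= C (l^p (A_(k+1) - A_k) + l^(-p'))],
    with a constant independent of the scale exactly because the exponent is
    critical ([space_pairing_bound], [volume_balance], [energy_step]). Optimising
    in [l], the sequence [S_k = delta + A_k] satisfies
    [S_(k+1)^p <= C (S_(k+1) - S_k)], a discrete form of [S^p <= C S'], and can
    live for at most a multiple of [delta^(-(p-1))] steps
    ([implicit_scheme_lifespan]). As [k] steps fit below the time [M] whenever
    [Phi M] exceeds [2 * 4^k], this bounds [Phi] at the lifespan by an exponential
    of [eps^(-(p-1))]. Inverting [Phi], a logarithm for [beta = -1] and a power
    otherwise, gives the two cases ([clock_lower], [lifespan_bound]).

    An energy solution satisfies the equation in [H^-1] only. The cutoffs are
    tensor products of functions of one variable; tested against them, the equation
    becomes an ordinary differential equation for the mean of the solution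
    ([energy_solution_ode]). That the weak derivatives entering the Laplacian
    are the classical ones on tensors rests on the fundamental lemma
    [ae_eq0_tensor] and on integration by parts [integral_partial0]. *)

Set Implicit Arguments.
Unset Strict Implicit.

(** * Smooth functions and bumps on the line *)

Section smooth1.
Context {R : realType}.
Implicit Types f g : R -> R.

Fixpoint diffn (k : nat) f : Prop :=
  if k is k'.+1 then (forall x, derivable f x 1) /\ diffn k' (derive1 f) else True.

Definition smooth1 f := forall k, diffn k f.

Lemma diffnS k f : diffn k.+1 f -> diffn k f.
Proof. by elim: k f => [//|k IH] f [df /IH]. Qed.

Lemma smooth1_derivable f x : smooth1 f -> derivable f x 1.
Proof. by move=> /(_ 1%N)[]. Qed.

Lemma smooth1_derive f : smooth1 f -> smooth1 (derive1 f).
Proof. by move=> sf k; have [] := sf k.+1. Qed.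

Lemma smooth1_continuous f : smooth1 f -> continuous f.
Proof.
by move=> sf x; apply/differentiable_continuous/derivable1_diffP/smooth1_derivable.
Qed.

Lemma diffn_cst k (c : R) : diffn k (cst c).
Proof.
elim: k c => [//|k IH] c; split; first by move=> x; exact: derivable_cst.
rewrite (_ : derive1 (cst c) = cst 0); first exact: IH.
by apply/funext => x; rewrite derive1_cst.
Qed.

Lemma diffnD k f g : diffn k f -> diffn k g -> diffn k (f \+ g).
Proof.
elim: k f g => [//|k IH] f g [df nf] [dg ng].
split; first by move=> x; exact: derivableD.
rewrite (_ : derive1 _ = (derive1 f) \+ (derive1 g)); first exact: IH.
by apply/funext => x; rewrite /= !derive1E; exact: (deriveD (df x) (dg x)).
Qed.

Lemma diffnM k f g : diffn k f -> diffn k g -> diffn k (f \* g).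
Proof.
elim: k f g => [//|k IH] f g nf ng; have [df nf'] := nf; have [dg ng'] := ng.
split; first by move=> x; exact: derivableM.
rewrite (_ : derive1 _ = (f \* (derive1 g)) \+ (g \* (derive1 f))).
  by apply: diffnD; apply: IH => //; exact: diffnS.
by apply/funext => x; rewrite /= !derive1E; exact: (deriveM (df x) (dg x)).
Qed.

(** The derivative of the inverse is a product of inverses and of [derive1 f], so the induction hypothesis on the inverse itself applies. *)
Lemma diffnV k f : (forall x, f x != 0) -> diffn k f -> diffn k (fun x => (f x)^-1).
Proof.
move=> f0; elim: k => [//|k IH] nf; have [df nf'] := nf.
split; first by move=> x; exact: derivableV.
rewrite (_ : derive1 _ = cst (-1) \* (((fun x => (f x)^-1) \* (fun x => (f x)^-1)) \* (derive1 f))).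
  by apply: diffnM; [exact: diffn_cst|do 2 (apply: diffnM => //); apply: IH; exact: diffnS].
apply/funext => x; rewrite /= !derive1E (deriveV (f0 x) (df x)) scaleNr mulN1r -expr2 exprVn.
reflexivity.
Qed.

Lemma diffn_comp k f g : diffn k f -> diffn k g -> diffn k (f \o g).
Proof.
elim: k f g => [//|k IH] f g nf ng; have [df nf'] := nf; have [dg ng'] := ng.
have dfg x : derivable (f \o g) x 1.
  by apply/derivable1_diffP/differentiable_comp; exact/derivable1_diffP.
split => //.
rewrite (_ : derive1 _ = ((derive1 f) \o g) \* (derive1 g)).
  by apply: diffnM => //; apply: IH => //; exact: diffnS.
by apply/funext => x /=; rewrite derive1_comp.
Qed.

Lemma smooth1_cst (c : R) : smooth1 (cst c).
Proof. by move=> k; exact: diffn_cst. Qed.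

Lemma smooth1M f g : smooth1 f -> smooth1 g -> smooth1 (f \* g).
Proof. by move=> sf sg k; exact: diffnM. Qed.

Lemma smooth1_comp f g : smooth1 f -> smooth1 g -> smooth1 (f \o g).
Proof. by move=> sf sg k; exact: diffn_comp. Qed.

Lemma smooth1_affine (a c : R) : smooth1 (fun x => a * x + c).
Proof.
case=> [//|k]; split.
  by move=> x; apply: derivableD => //; exact: derivableM.
rewrite (_ : derive1 _ = cst a); first exact: diffn_cst.
apply/funext => x; rewrite derive1E.
have [_ ->] : is_derive x 1 (fun x : R => a * x + c) (a *: 1 + 0).
  exact: (is_deriveD (is_deriveZ a (is_derive_id x 1)) (is_derive_cst c x 1)).
by rewrite addr0 /GRing.scale/= mulr1.
Qed.

Lemma smooth1_scale f (c : R) : smooth1 f -> smooth1 (fun t => f (c * t)).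
Proof.
move=> sf; apply: (@smooth1_comp f (fun t => c * t)) => //.
rewrite (_ : (fun _ => _) = (fun t : R => c * t + 0)); first exact: smooth1_affine.
by apply/funext => t; rewrite addr0.
Qed.

Lemma smooth1X f m : smooth1 f -> smooth1 (fun x => f x ^+ m).
Proof.
move=> sf; elim: m => [|m IH]; first by have := smooth1_cst 1.
by rewrite (_ : (fun _ => _) = f \* (fun x => f x ^+ m)); [exact: smooth1M|apply/funext => x /=; rewrite exprS].
Qed.

(** The span of these functions contains [exp(-1/x)] and is closed under
    differentiation, which turns smoothness into one computation. *)
Definition flat (m : nat) (x : R) : R :=
  if 0 < x then x^-1 ^+ m * expR (- x^-1) else 0.

Lemma flat_ge0 m x : 0 <= flat m x.
Proof.
by rewrite /flat; case: ltP => // x0; rewrite mulr_ge0 ?expR_ge0// exprn_ge0// invr_ge0 ltW.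
Qed.

(** From [1 + y <= exp y] at [y = 1 / (x (m + 1))], raised to the power [m + 1]. *)
Lemma flat_le m x : 0 < x -> flat m x <= m.+1%:R ^+ m.+1 * x.
Proof.
move=> x0; rewrite /flat x0.
have y0 : 0 < x^-1 by rewrite invr_gt0.
have /(lerXn2r m.+1) h : x^-1 / m.+1%:R <= expR (x^-1 / m.+1%:R).
  by rewrite (le_trans _ (expR_ge1Dx _))// lerDr.
have {h} : (x^-1 / m.+1%:R) ^+ m.+1 <= expR (x^-1).
  apply: le_trans (h _ _) _; rewrite ?nnegrE ?expR_ge0// ?divr_ge0 ?(ltW y0)//.
  by rewrite -expRM_natl mulrC divfK ?pnatr_eq0.
rewrite expr_div_n ler_pdivrMr ?exprn_gt0// => h.
rewrite expRN -(ler_pM2r (expR_gt0 (x^-1))) divfK ?gt_eqF ?expR_gt0//.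
rewrite -(ler_pM2r y0) -exprSr (le_trans h)// mulrC -!mulrA ler_wpM2l// ?exprn_ge0//.
by rewrite mulrCA divff ?mulr1 ?gt_eqF// lexx.
Qed.

(** Differentiability at the origin is the point: the difference quotient of
    [flat m] there is [flat m.+1], which is [O(x)] by [flat_le]. *)
Lemma is_derive_flat m (x : R) :
  is_derive x 1 (flat m) (flat m.+2 x - m%:R * flat m.+1 x).
Proof.
have [x0|x0|->] := ltgtP x 0.
- have -> : flat m.+2 x - m%:R * flat m.+1 x = 0.
    by rewrite /flat (lt_gtF x0) mulr0 subrr.
  apply: (near_eq_is_derive (f := cst 0)).
    near=> y; rewrite /flat ifF//; apply/negP/negP; rewrite -leNgt ltW//.
    near: y; exact: lt_nbhsl.
- pose F := (fun y : R => y^-1 ^+ m * expR (- y^-1)).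
  apply: (near_eq_is_derive (f := F)).
    near=> y; rewrite /flat ifT//; near: y; exact: lt_nbhsr.
  have xn0 : x != 0 by rewrite gt_eqF.
  have dV : is_derive x 1 (fun y : R => y^-1) (- x ^- 2).
    apply: is_derive_eq; first exact: (is_deriveV xn0 (is_derive_id x 1)).
    by rewrite /GRing.scale/= mulr1.
  have := is_deriveX m dV; rewrite exprfctE => dX.
  have dE : is_derive x 1 (fun y : R => expR (- y^-1)) (x ^- 2 * expR (- x^-1)).
    have := @is_derive1_comp _ expR (fun y : R => - y^-1) x _ _ (is_derive_expR _) (is_deriveN dV).
    by rewrite opprK mulrC.
  rewrite /flat x0.
  refine (is_derive_eq (is_deriveM dX dE) _).
  rewrite /GRing.scale/=.
  set E := expR _; case: m dX {F} => [|m] _.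
    by rewrite /= !mul0r !mulr0 addr0 subr0 !expr0 !mul1r -exprVn expr2.
  by rewrite -exprVn -[m.+1.-1]/m !exprS; ring.
- have -> : flat m.+2 0 - m%:R * flat m.+1 0 = 0.
    by rewrite /flat ltxx mulr0 subrr.
  suff h : (fun h : R => h^-1 *: (flat m (h *: 1 + 0) - flat m 0)) @ 0^' --> (0 : R).
    by apply: DeriveDef; [apply/cvg_ex; exists 0; exact: h|exact/cvg_lim/h].
  have f0 : flat m 0 = 0 by rewrite /flat ltxx.
  apply/cvgr0Pnorm_le => e e0.
  have M0 : 0 < m.+2%:R ^+ m.+2 :> R by rewrite exprn_gt0.
  near=> h; rewrite f0 subr0 addr0 [h *: 1]mulr1.
  have [h0|h0] := leP h 0.
    by rewrite /flat ltNge h0/= scaler0 normr0 ltW.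
  rewrite (_ : h^-1 *: _ = flat m.+1 h); last first.
    by rewrite /flat h0 /GRing.scale/= mulrA -exprS.
  rewrite ger0_norm ?flat_ge0// (le_trans (flat_le _ h0))// -ler_pdivlMl//.
  rewrite (le_trans (ler_norm _))//.
  near: h; apply: dnbhs0_le.
  by rewrite mulr_gt0// invr_gt0.
Unshelve. all: by end_near. Qed.

Lemma smooth1_flat m : smooth1 (flat m).
Proof.
move=> k; elim: k m => [//|k IH] m; split.
  by move=> x; have [] := is_derive_flat m x.
rewrite (_ : derive1 _ = flat m.+2 \+ (cst (- m%:R) \* flat m.+1)).
  by apply: diffnD => //; apply: diffnM => //; exact: diffn_cst.
apply/funext => x; rewrite derive1E; have [_ ->] := is_derive_flat m x.
by rewrite /= mulNr.
Qed.

Definition smooth_step (x : R) : R := flat 0 x / (flat 0 x + flat 0 (1 - x)).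

Lemma smooth_step_den_gt0 x : 0 < flat 0 x + flat 0 (1 - x).
Proof.
have flat_gt0 y : 0 < y -> 0 < flat 0 y.
  by move=> y0; rewrite /flat y0 expr0 mul1r expR_gt0.
have [x0|x0] := ltP 0 x; first by rewrite ltr_wpDr ?flat_ge0// flat_gt0.
by rewrite ltr_wpDl ?flat_ge0// flat_gt0// subr_gt0 (le_lt_trans x0).
Qed.

Lemma smooth_step_ge0 x : 0 <= smooth_step x.
Proof. by rewrite divr_ge0 ?flat_ge0// ltW// smooth_step_den_gt0. Qed.

Lemma smooth_step_le1 x : smooth_step x <= 1.
Proof. by rewrite ler_pdivrMr ?smooth_step_den_gt0// mul1r lerDl flat_ge0. Qed.

Lemma smooth_step_le0 x : x <= 0 -> smooth_step x = 0.
Proof. by move=> x0; rewrite /smooth_step /flat ltNge x0/= mul0r. Qed.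

Lemma smooth_step_ge1 x : 1 <= x -> smooth_step x = 1.
Proof.
move=> x1.
have f0 : flat 0 (1 - x) = 0 by rewrite /flat subr_gt0 ltNge x1.
have := smooth_step_den_gt0 x; rewrite /smooth_step f0 addr0 => /gt_eqF h.
by rewrite divff ?h.
Qed.

Lemma smooth1_smooth_step : smooth1 smooth_step.
Proof.
move=> k; apply: diffnM; first exact: smooth1_flat.
apply: diffnV; first by move=> x; rewrite gt_eqF// smooth_step_den_gt0.
apply: diffnD; first exact: smooth1_flat.
apply: (@diffn_comp k (flat 0) (fun x => 1 - x)); first exact: smooth1_flat.
rewrite (_ : (fun _ => _) = (fun x : R => (-1) * x + 1)); first exact: smooth1_affine.
by apply/funext => x; rewrite mulN1r addrC.
Qed.

Definition bump (x : R) : R := smooth_step (2 - x) * smooth_step (2 + x).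

Lemma bump_ge0 x : 0 <= bump x.
Proof. by rewrite mulr_ge0 ?smooth_step_ge0. Qed.

Lemma bump_le1 x : bump x <= 1.
Proof. by rewrite mulr_ile1 ?smooth_step_ge0 ?smooth_step_le1. Qed.

Lemma bump1 x : `|x| <= 1 -> bump x = 1.
Proof.
rewrite ler_norml => /andP[x1 x2].
by rewrite /bump !smooth_step_ge1 ?mulr1//; lra.
Qed.

Lemma bump0 x : 2 <= `|x| -> bump x = 0.
Proof.
rewrite ler_normr /bump => /orP[] h.
  by rewrite smooth_step_le0 ?mul0r//; lra.
by rewrite (@smooth_step_le0 (2 + x)) ?mulr0//; lra.
Qed.

Lemma smooth1_bump : smooth1 bump.
Proof.
have -> : bump = (smooth_step \o (fun x => (-1) * x + 2)) \* (smooth_step \o (fun x => 1 * x + 2)).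
  by apply/funext => x; rewrite /bump /= mulN1r mul1r addrC [2 + x]addrC.
by apply: smooth1M; apply: smooth1_comp; (exact: smooth1_smooth_step || exact: smooth1_affine).
Qed.

Lemma derive1_flat_near f (c x : R) : (\forall y \near x, f y = c) -> derive1 f x = 0.
Proof.
move=> fc; rewrite derive1E.
have : is_derive x (1 : R) f 0.
  apply: (near_eq_is_derive (f := cst c)).
  by near=> y; rewrite [cst c y]/=; apply/esym; near: y.
by case.
Unshelve. all: by end_near. Qed.

Lemma derive1_cst_in f (c r x : R) : (forall y, `|y| < r -> f y = c) ->
  `|x| < r -> derive1 f x = 0.
Proof.
move=> fc xr; apply: (@derive1_flat_near _ c); near=> y; apply: fc; near: y.
by apply: (cvgr_lt `|x|) => //; exact: norm_continuous.
Unshelve. all: by end_near. Qed.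

Lemma derive1_cst_out f (c r x : R) : (forall y, r < `|y| -> f y = c) ->
  r < `|x| -> derive1 f x = 0.
Proof.
move=> fc xr; apply: (@derive1_flat_near _ c); near=> y; apply: fc; near: y.
by apply: (cvgr_gt `|x|) => //; exact: norm_continuous.
Unshelve. all: by end_near. Qed.

Lemma bounded_of_compact_supp f (r : R) : 0 <= r -> continuous f ->
  (forall x, r < `|x| -> f x = 0) -> exists M, forall x, `|f x| <= M.
Proof.
move=> r0 cf f0.
have [c _ hc] : exists2 c, c \in `[-r, r]%R &
    forall t, t \in `[-r, r]%R -> `|f t| <= `|f c|.
  apply: (@EVT_max _ (fun x => `|f x|)); first by rewrite (@le_trans _ _ 0)// oppr_le0.
  by apply: continuous_subspaceT => x; apply: continuous_comp; [exact: cf|exact: norm_continuous].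
exists `|f c| => x; have [xr|xr] := leP `|x| r; last by rewrite f0// normr0.
by apply: hc; rewrite in_itv/= -ler_norml.
Qed.

Lemma derive1_bump_bounded : exists M, forall x : R,
  `|derive1 bump x| <= M /\ `|derive1 (derive1 bump) x| <= M.
Proof.
have s1 := smooth1_derive smooth1_bump; have s2 := smooth1_derive s1.
have out1 (x : R) : 2 < `|x| -> derive1 bump x = 0.
  by apply: (@derive1_cst_out _ 0) => y /ltW; exact: bump0.
have out2 (x : R) : 2 < `|x| -> derive1 (derive1 bump) x = 0.
  by apply: (@derive1_cst_out _ 0) => y; exact: out1.
have [M1 h1] := bounded_of_compact_supp (ler0n _ 2) (smooth1_continuous s1) out1.
have [M2 h2] := bounded_of_compact_supp (ler0n _ 2) (smooth1_continuous s2) out2.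
exists (M1 + M2) => x; split.
  by apply: (le_trans (h1 x)); rewrite lerDl (le_trans _ (h2 0)).
by apply: (le_trans (h2 x)); rewrite lerDr (le_trans _ (h1 0)).
Qed.

End smooth1.

(** * Tensor products of smooth functions *)

Section tensor.
Context {R : realType} {n : nat}.
Implicit Types (f : 'I_n -> R -> R) (x : 'rV[R]_n).

Definition tensor f x : R := \prod_(i < n) f i (x ord0 i).

Definition dfactor (j : 'I_n) f : 'I_n -> R -> R :=
  fun i => if i == j then derive1 (f i) else f i.

Definition smooth_factors f := forall i, smooth1 (f i).

Lemma smooth_dfactor j f : smooth_factors f -> smooth_factors (dfactor j f).
Proof.
by move=> sf i; rewrite /dfactor; case: ifP => _; [exact: smooth1_derive|exact: sf].
Qed.

(** Moving the [j]-th coordinate changes one factor only, so the difference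
    quotient of the product is that of the factor, up to a constant. *)
Lemma is_derive_tensor f x j : smooth_factors f ->
  is_derive x (delta_mx ord0 j) (tensor f) (tensor (dfactor j f) x).
Proof.
move=> sf.
pose c : R := \prod_(i < n | i != j) f i (x ord0 i).
have dE : tensor (dfactor j f) x = c * 'D_1 (f j) (x ord0 j).
  rewrite /tensor (bigD1 j)//= mulrC /dfactor eqxx derive1E; congr (_ * _).
  by apply: eq_bigr => i /negbTE ->.
pose G := fun h : R => h^-1 *: ((tensor f \o shift x) (h *: delta_mx ord0 j) - tensor f x).
pose g := fun h : R => h^-1 *: ((f j \o shift (x ord0 j)) (h *: 1) - f j (x ord0 j)).
have E : G = (fun h => c * g h).
  apply/funext => h; rewrite /G /g /= /tensor (bigD1 j)//= [X in _ - X](bigD1 j)//=.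
  rewrite !mxE !eqxx [h *: 1]mulr1 [h * _]mulr1.
  rewrite (eq_bigr (fun i => f i (x ord0 i))) -/c => [|i /negbTE ij]; last first.
    by rewrite !mxE ij andbF mulr0 add0r.
  by rewrite /GRing.scale/=; ring.
have dfj : derivable (f j) (x ord0 j) 1 by exact: smooth1_derivable.
have cg : g h @[h --> 0^'] --> 'D_1 (f j) (x ord0 j) by exact: dfj.
have cG : G h @[h --> 0^'] --> tensor (dfactor j f) x.
  by rewrite E dE; apply: cvgM => //; exact: cvg_cst.
by apply: DeriveDef; [apply/cvg_ex; eexists; exact: cG|exact/cvg_lim/cG].
Qed.

Lemma partial_tensor f j : smooth_factors f -> partial j (tensor f) = tensor (dfactor j f).
Proof.
by move=> sf; apply/funext => x; rewrite /partial; have [_ ->] := is_derive_tensor x j sf.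
Qed.

Lemma continuous_tensor f : smooth_factors f -> continuous (tensor f).
Proof.
move=> sf; rewrite (_ : tensor f = \prod_(i < n) (fun x => f i (x ord0 i))); last first.
  by apply/funext => x; rewrite fct_prodE.
apply: (big_ind (fun g : 'rV[R]_n -> R => continuous g)).
- exact: (@cst_continuous _ _ (1 : R)).
- by move=> g h cg ch x; exact: (cvgM (cg x) (ch x)).
- move=> i _ x; apply: (@continuous_comp _ _ _ (fun x : 'rV[R]_n => x ord0 i) (f i)).
    exact: coord_continuous.
  exact: smooth1_continuous.
Qed.

Lemma foldr_partial_tensor f s : smooth_factors f ->
  exists2 g, smooth_factors g & foldr partial (tensor f) s = tensor g.
Proof.
move=> sf; elim: s => [|j s [g sg /= ->]]; first by exists f.
by exists (dfactor j g); [exact: smooth_dfactor|rewrite partial_tensor].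
Qed.

Lemma smooth_tensor f : smooth_factors f -> smooth (tensor f).
Proof.
move=> sf s; have [g sg ->] := foldr_partial_tensor s sf; split.
  exact: continuous_tensor.
by move=> i x; have [] := is_derive_tensor x i sg.
Qed.

Definition cube (r : R) : set 'rV[R]_n := [set x | forall i, `|x ord0 i| <= r].

Lemma cube_exhaust (x : 'rV[R]_n) : exists k : nat, forall i, `|x ord0 i| < k.+1%:R.
Proof.
exists (\max_(i < n) Num.trunc `|x ord0 i|)%N => i.
apply: (lt_le_trans (truncnS_gt _)).
rewrite ler_nat ltnS; exact: (leq_bigmax (F := fun i : 'I_n => Num.trunc `|x ord0 i|)).
Qed.

Lemma cube_compact r : compact (cube r).
Proof.
rewrite (_ : cube r = [set x | forall i, `[- r, r]%classic (x ord0 i)]).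
  exact: (@rV_compact _ n (fun=> `[- r, r]%classic) (fun=> @segment_compact _ _ _)).
by apply/seteqP; split=> x /= h i; have := h i; rewrite /= in_itv/= -ler_norml.
Qed.

Definition supported (r : R) f := forall i t, r < `|t| -> f i t = 0.

Lemma supported_tensor r f x : supported r f -> ~ cube r x -> tensor f x = 0.
Proof.
move=> sf /existsNP[i /negP]; rewrite -ltNge => ri.
by rewrite /tensor (bigD1 i)//= sf// mul0r.
Qed.

Lemma supported_dfactor r j f : supported r f -> supported r (dfactor j f).
Proof.
move=> sf i t rt; rewrite /dfactor; case: ifP => _; last exact: sf.
exact: (derive1_cst_out (sf i)).
Qed.

Lemma test_function_supp_cube (phi : 'rV[R]_n -> R) : test_function phi ->
  exists2 r, 0 <= r & forall x, ~ cube r x -> phi x = 0.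
Proof.
move=> [_ cphi].
have [M [_ hM]] := compact_bounded cphi.
exists `|M + 1|%R => [|x nx]; first exact: normr_ge0.
apply: contrapT => /eqP px; apply: nx => i.
have : `|x| <= M + 1.
  apply: (hM (M + 1)); first by rewrite ltrDl.
  exact: subset_closure.
move=> h; rewrite (le_trans _ (le_trans h (ler_norm _)))//.
rewrite /Num.norm/= mx_normrE; exact: (le_bigmax _ _ (ord0, i)).
Qed.

Lemma test_tensor r f : smooth_factors f -> supported r f -> test_function (tensor f).
Proof.
move=> sf rf; split; first exact: smooth_tensor.
apply: (@subclosed_compact _ _ (cube r)).
- exact: closed_closure.
- exact: cube_compact.
- have cc : closed (cube r) by apply: compact_closed; [exact: norm_hausdorff|exact: cube_compact].
  rewrite [X in _ `<=` X]((closure_id (cube r)).1 cc); apply: closureS => x /= fx.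
  by apply: contrapT => /(supported_tensor rf)/eqP; rewrite (negbTE fx).
Qed.

End tensor.

(** * Measure and integration on row vectors *)

Section measure_rV.
Context {R : realType}.
Local Notation lm := (@lebesgue_measure R).

(** The sigma-algebra is generated by the coordinates, not by the open sets.
    Rounding the argument to a grid of mesh [1 / k] makes the function countably
    valued on boxes, and these roundings converge pointwise by continuity. *)
Lemma continuous_measurable_rV n (f : 'rV[R]_n -> R) :
  continuous f -> measurable_fun setT f.
Proof.
move=> cf.
pose F (k : nat) (x : 'rV[R]_n) : 'rV[int]_n :=
  \row_i Num.floor (k.+1%:R * x ord0 i).
pose G (k : nat) (z : 'rV[int]_n) : 'rV[R]_n := \row_i ((z ord0 i)%:~R / k.+1%:R).
apply: (@measurable_fun_cvg _ _ _ _ (fun k x => f (G k (F k x)))) => [k|x _].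
  move=> _ Y mY; rewrite setTI.
  rewrite (_ : _ @^-1` Y =
      \bigcup_z (if f (G k z) \in Y then [set x | F k x = z] else set0)); last first.
    apply/seteqP; split=> x /=.
      by move=> Yx; exists (F k x) => //; rewrite mem_set.
    by move=> [z _]; case: ifPn => // /[!inE] Yz /= ->.
  apply: countable_bigcupT_measurable => // z.
  case: ifP => // _.
  rewrite (_ : mkset _ = [set x : 'rV[R]_n | forall i,
      [set t | (z ord0 i)%:~R <= k.+1%:R * t < (z ord0 i + 1)%:~R] (x ord0 i)]).
    apply: (measurable_box (A := fun i =>
      [set t | (z ord0 i)%:~R <= k.+1%:R * t < (z ord0 i + 1)%:~R])) => i.
    rewrite (_ : [set t | _] = `[(z ord0 i)%:~R / k.+1%:R, (z ord0 i + 1)%:~R / k.+1%:R[%classic); first exact: measurable_itv.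
    by apply/seteqP; split=> t /=; rewrite in_itv/= ler_pdivrMr// ltr_pdivlMr// mulrC.
  apply/seteqP; split=> x /=.
    by move=> <- i /=; rewrite mxE; exact: floor_itv.
  by move=> h; apply/rowP => i; rewrite mxE; apply: floor_def; exact: h.
apply: (@continuous_cvg _ _ _ \oo _ (fun k => G k (F k x)) f); first exact: cf.
apply/cvg_ballP => e e0.
have [N _ hN] := near_infty_natSinv_lt (PosNum e0).
near=> k; split => // i j; rewrite !ord1 !mxE /ball/=.
have k0 : 0 < k.+1%:R :> R by [].
have /andP[h1 h2] := floor_itv (k.+1%:R * x ord0 j).
have h3 : k.+1%:R^-1 < e by apply: hN; near: k; exact: nbhs_infty_ge.
rewrite (le_lt_trans _ h3)// ger0_norm.
  rewrite lerBlDl -[X in _ + X]mul1r -mulrDl ler_pdivlMr// mulrC ltW//.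
  by move: h2; rewrite intrD ord1.
by rewrite subr_ge0 ler_pdivrMr// [x _ _ * _]mulrC; move: h1; rewrite ord1.
Unshelve. all: by end_near. Qed.

Lemma measurable_cube n (r : R) : measurable (@cube R n r).
Proof.
rewrite (_ : cube r = [set x | forall i, `[- r, r]%classic (x ord0 i)]).
  by apply: (measurable_box (A := fun=> `[- r, r]%classic)) => i; exact: measurable_itv.
by apply/seteqP; split=> x /= h i; have := h i; rewrite /= in_itv/= -ler_norml.
Qed.

Lemma lebesgue_cube n (r : R) : 0 <= r -> lebesgue_rV R n (cube r) = ((2 * r) ^+ n)%:E.
Proof.
move=> r0; rewrite (_ : cube r = [set x | forall i, `[- r, r]%classic (x ord0 i)]).
  rewrite (lebesgue_rV_box (A := fun=> `[- r, r]%classic)) => [|i]; last exact: measurable_itv.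
  have -> : lm `[- r, r]%classic = (2 * r)%:E.
    rewrite lebesgue_measure_itv/= lte_fin; case: ifPn => [_|].
      by rewrite -EFinB opprK mulr_natl mulr2n.
    rewrite -leNgt => h; have -> : r = 0 by lra.
    by rewrite mulr0.
  by rewrite prodEFin prodr_const card_ord.
by apply/seteqP; split=> x /= h i; have := h i; rewrite /= in_itv/= -ler_norml.
Qed.

Lemma integrable_bounded_cube n (f : 'rV[R]_n -> R) (r M : R) : 0 <= r ->
  measurable_fun setT f -> (forall x, ~ cube r x -> f x = 0) ->
  (forall x, `|f x| <= M) -> (lebesgue_rV R n).-integrable setT (EFin \o f).
Proof.
move=> r0 mf f0 fM.
have : (lebesgue_rV R n).-integrable (cube r) (EFin \o f).
  apply: measurable_bounded_integrable.
  - exact: measurable_cube.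
  - by rewrite [ltLHS](lebesgue_cube n r0) ltry.
  - exact: measurable_funTS.
  - exists M; split; first by rewrite num_real.
    by move=> y My x _ /=; exact: (le_trans (fM x) (ltW My)).
move/(integrable_mkcond _ (measurable_cube r)).
apply: eq_integrable => // x _; rewrite patchE; case: ifPn => //.
by rewrite notin_setE => /f0 /= ->.
Qed.

(** Induction on the dimension: the first coordinate is split off, and the
    Fubini theorem integrates either along it or over the remaining ones, for
    which the slices satisfy the same hypotheses. *)
Lemma integral_line0 n (i : 'I_n) (f : 'rV[R]_n -> R) :
  (lebesgue_rV R n).-integrable setT (EFin \o f) ->
  (forall x, (\int[lm]_t (f (x + t *: delta_mx ord0 i))%:E = 0)%E) ->
  (\int[lebesgue_rV R n]_x (f x)%:E = 0)%E.
Proof.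
elim: n i f => [[]//|n IH] i f intf f0.
have mf : measurable_fun setT (EFin \o f) by exact: measurable_int intf.
have mc : measurable_fun [set: measurableTypeR R * 'rV[R]_n] (@cons_rV R n) :=
  @measurable_cons_rV R n.
pose fc : measurableTypeR R * 'rV[R]_n -> \bar R := (EFin \o f) \o @cons_rV R n.
have mfc : measurable_fun setT fc by exact: measurableT_comp.
have ifc : (lm \x lebesgue_rV R n)%E.-integrable setT fc.
  apply/integrableP; split => //.
  move/integrableP : intf => [_]; apply: le_lt_trans.
  have -> : (\int[lebesgue_rV R n.+1]_x `|(EFin \o f) x| =
      \int[lm \x lebesgue_rV R n]_z `|fc z|)%E; last by [].
  have mf' : measurable_fun [set: 'rV[R]_n.+1] (abse \o (EFin \o f)) by exact: measurableT_comp.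
  have E := ge0_integral_pushforward mc (lm \x lebesgue_rV R n)%E measurableT mf' (fun y _ => abse_ge0 _).
  exact: E.
have -> : (\int[lebesgue_rV R n.+1]_x (f x)%:E = \int[lm \x lebesgue_rV R n]_z fc z)%E.
  exact: (integral_pushforward mc mf ifc measurableT).
have consE (a t : R) y j : @cons_rV R n (a, y + t *: delta_mx ord0 j) =
    cons_rV (a, y) + t *: delta_mx ord0 (lift ord0 j).
  apply/rowP => k; rewrite !mxE /=; case: unliftP => [l|] -> /=.
    by rewrite !mxE (inj_eq lift_inj).
  by rewrite mulr0 addr0.
have cons0 (t : R) y : @cons_rV R n (t, y) = cons_rV (0, y) + t *: delta_mx ord0 ord0.
  apply/rowP => k; rewrite !mxE /=; case: unliftP => [l|] -> /=.
    by rewrite mulr0 addr0.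
  by rewrite mulr1 add0r.
case: (unliftP ord0 i) => [j|] ij; last first.
  rewrite -integral21_prod_meas1// integral0_eq// => y _.
  rewrite /fubini_G /fc -[RHS](f0 (cons_rV (0, y))) ij.
  apply: eq_integral => t _ /=; congr ((f _)%:E); exact: cons0.
rewrite -integral12_prod_meas1//.
rewrite (@ae_eq_integral _ _ _ _ _ (cst 0%E))//.
- by rewrite integral0.
- exact: measurable_fubini_F ifc.
have := ae_integrable1 ifc.
apply: filterS => x ix _ /=; apply: (IH j) => // y.
rewrite -[RHS](f0 (cons_rV (x, y))) ij.
by apply: eq_integral => t _; congr ((f _)%:E); exact: consE.
Qed.

End measure_rV.

(** * The fundamental lemma of the calculus of variations *)

Section fundamental_lemma.
Context {R : realType} {n : nat}.
Local Notation mu := (lebesgue_rV R n).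

(** Half-open, so that indicators of boxes are limits of smooth tensors. *)
Definition ocbox (a b : 'I_n -> R) : set 'rV[R]_n :=
  [set x | forall i, `]a i, b i]%classic (x ord0 i)].

Definition ocboxes : set (set 'rV[R]_n) := [set ocbox ab.1 ab.2 | ab in setT].

Lemma ocboxes_setI : setI_closed ocboxes.
Proof.
move=> _ _ [[a b] _ <-] [[c d] _ <-] /=.
exists (fun i => Num.max (a i) (c i), fun i => Num.min (b i) (d i)) => //=.
apply/seteqP; split=> x /=.
  move=> h; split=> i; have := h i; rewrite /= !in_itv/= gt_max le_min.
    by move=> /andP[/andP[-> _] /andP[-> _]].
  by move=> /andP[/andP[_ ->] /andP[_ ->]].
move=> [h1 h2] i; have := h1 i; have := h2 i; rewrite /= !in_itv/= gt_max le_min.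
by move=> /andP[-> ->] /andP[-> ->].
Qed.

Lemma measurable_ocbox a b : measurable (ocbox a b).
Proof. by apply: (measurable_box (A := fun i => `]a i, b i]%classic)) => i; exact: measurable_itv. Qed.

(** A slab in one coordinate is a countable union of boxes. *)
Lemma measurable_ocboxes : @measurable _ 'rV[R]_n = <<s ocboxes >>.
Proof.
apply/seteqP; split; last first.
  apply: smallest_sub; first exact: sigma_algebra_measurable.
  by move=> _ [ab _ <-]; exact: measurable_ocbox.
apply: smallest_sub; first exact: smallest_sigma_algebra.
have [sG0 sGD sGU] := smallest_sigma_algebra setT ocboxes.
move=> B; rewrite -bigcup_seq => -[i _ [C mC <-]]; rewrite setTI.
pose S : set (set R) := [set D | <<s ocboxes >> ((fun x : 'rV[R]_n => x ord0 i) @^-1` D)].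
have sS : sigma_algebra setT S.
  split.
  - by rewrite /S/= preimage_set0; exact: sG0.
  - move=> D SD; rewrite /S/= setTD preimage_setC -setTD; exact: sGD.
  - by move=> F SF; rewrite /S/= preimage_bigcup; exact: sGU.
suff : S C by [].
apply: (smallest_sub sS _ mC) => _ [[a b] _ <-] /=; rewrite /S/=.
rewrite (_ : _ @^-1` _ = \bigcup_(k : nat)
    ocbox (fun j => if j == i then a else - k%:R) (fun j => if j == i then b else k%:R)).
  apply: sGU => k; apply: sub_sigma_algebra.
  by exists ((fun j => if j == i then a else - k%:R), (fun j => if j == i then b else k%:R)).
apply/seteqP; split=> x /=; last by move=> [k _ /(_ i)/=]; rewrite eqxx.
move=> xab; have [k xk] := cube_exhaust x; exists k.+1 => // j /=.
case: eqP => [->//|_]; rewrite in_itv/=.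
by have := xk j; rewrite ltr_norml => /andP[-> /ltW ->].
Qed.

(** These factors converge pointwise to the indicator of the box
    precisely because the smooth step vanishes on the closed negative half-line. *)
Definition box_factors (a b : 'I_n -> R) (k : nat) : 'I_n -> R -> R :=
  fun i t => smooth_step (k.+1%:R * (t - a i)) * (1 - smooth_step (k.+1%:R * (t - b i))).

Lemma smooth_box_factors a b k : smooth_factors (box_factors a b k).
Proof.
move=> i; apply: smooth1M.
  apply: (@smooth1_comp _ smooth_step (fun t => k.+1%:R * (t - a i))); first exact: smooth1_smooth_step.
  rewrite (_ : (fun _ => _) = (fun t : R => k.+1%:R * t + - (k.+1%:R * a i))).
    exact: smooth1_affine.
  by apply/funext => t; rewrite mulrBr.
apply: (@smooth1_comp _ (fun t => 1 - t) (fun t => smooth_step (k.+1%:R * (t - b i)))).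
  rewrite (_ : (fun _ => _) = (fun t : R => (-1) * t + 1)); first exact: smooth1_affine.
  by apply/funext => t; rewrite mulN1r addrC.
apply: (@smooth1_comp _ smooth_step (fun t => k.+1%:R * (t - b i))); first exact: smooth1_smooth_step.
rewrite (_ : (fun _ => _) = (fun t : R => k.+1%:R * t + - (k.+1%:R * b i))).
  exact: smooth1_affine.
by apply/funext => t; rewrite mulrBr.
Qed.

Lemma tensor_ge0 (f : 'I_n -> R -> R) x : (forall i t, 0 <= f i t) -> 0 <= tensor f x.
Proof. by move=> f0; exact: prodr_ge0. Qed.

Lemma tensor_le1 (f : 'I_n -> R -> R) x : (forall i t, 0 <= f i t <= 1) -> tensor f x <= 1.
Proof. by move=> f0; apply: prodr_ile1 => i _; exact: f0. Qed.

Lemma tensorM (f g : 'I_n -> R -> R) x :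
  tensor (fun i t => f i t * g i t) x = tensor f x * tensor g x.
Proof. by rewrite /tensor big_split. Qed.

Lemma box_factors01 a b k i t : 0 <= box_factors a b k i t <= 1.
Proof.
have := smooth_step_ge0 (k.+1%:R * (t - b i)); have := smooth_step_le1 (k.+1%:R * (t - b i)).
move=> h1 h2; rewrite /box_factors mulr_ge0 ?smooth_step_ge0 ?subr_ge0//=.
by rewrite mulr_ile1 ?smooth_step_ge0 ?smooth_step_le1 ?subr_ge0// lerBlDr lerDl.
Qed.

Lemma cvg_smooth_step (c : R) : smooth_step (k.+1%:R * c) @[k --> \oo] --> ((0 < c)%R%:R : R).
Proof.
have [c0|c0] := ltP 0 c; last first.
  apply: cvg_near_cst; apply: nearW => k.
  by rewrite smooth_step_le0// mulr_ge0_le0.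
apply: cvg_near_cst; near=> k.
rewrite smooth_step_ge1// -ler_pdivrMr// div1r ltW//.
have h : c^-1 < k%:R by near: k; exact: nbhs_infty_gtr.
by rewrite (lt_trans h)// ltr_nat.
Unshelve. all: by end_near. Qed.

Lemma cvg_bigprod (I : Type) (r : seq I) (u : I -> nat -> R) (l : I -> R) :
  (forall i, u i k @[k --> \oo] --> l i) ->
  \prod_(i <- r) u i k @[k --> \oo] --> \prod_(i <- r) l i.
Proof.
move=> ul; elim: r => [|i r IH].
  by rewrite big_nil; under eq_fun do rewrite big_nil; exact: cvg_cst.
by rewrite big_cons; under eq_fun do rewrite big_cons; exact: (cvgM (ul i) IH).
Qed.

Lemma cvg_box_factors a b x :
  tensor (box_factors a b k) x @[k --> \oo] --> (\1_(ocbox a b) x : R).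
Proof.
have -> : (\1_(ocbox a b) x : R) =
    \prod_(i < n) ((0 < x ord0 i - a i)%R%:R * (1 - (0 < x ord0 i - b i)%R%:R) : R).
  rewrite indicE; case: (pselect (ocbox a b x)) => h.
    rewrite mem_set// big1// => i _.
    have := h i; rewrite /= in_itv/= => /andP[h1 h2].
    by rewrite subr_gt0 h1 subr_gt0 ltNge h2 subr0 mulr1.
  rewrite memNset//; move/existsNP : h => [i /negP]; rewrite in_itv/= => h.
  rewrite (bigD1 i)//= !subr_gt0; apply/esym.
  move: h; rewrite negb_and -ltNge => /orP[/negbTE ->|->].
    by rewrite !mul0r.
  by rewrite subrr mulr0 mul0r.
apply: cvg_bigprod => i; apply: cvgM; first exact: cvg_smooth_step.
by apply: cvgB; [exact: cvg_cst|exact: cvg_smooth_step].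
Qed.

Lemma measurable_tensor (f : 'I_n -> R -> R) : smooth_factors f -> measurable_fun setT (tensor f).
Proof. by move=> sf; apply: continuous_measurable_rV; exact: continuous_tensor. Qed.

Definition scaled_bump (k : nat) : 'I_n -> R -> R := fun i t => bump (k.+1%:R^-1 * t).

Lemma smooth_scaled_bump k : smooth_factors (scaled_bump k).
Proof.
by move=> i; apply: smooth1_scale; exact: smooth1_bump.
Qed.

Lemma supported_scaled_bump k : supported (2 * k.+1%:R) (scaled_bump k).
Proof.
move=> i t kt; rewrite /scaled_bump bump0// normrM gtr0_norm ?invr_gt0// mulrC.
by rewrite ler_pdivlMr// ltW.
Qed.

Lemma scaled_bump1 k x : cube k.+1%:R x -> tensor (scaled_bump k) x = 1.
Proof.
move=> kx; apply: big1 => i _; rewrite /scaled_bump bump1//.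
by rewrite normrM gtr0_norm ?invr_gt0// mulrC ler_pdivrMr// mul1r kx.
Qed.

Lemma supportedM r f g : supported r f -> @supported R n r (fun i t => f i t * g i t).
Proof. by move=> rf i t /rf ->; rewrite mul0r. Qed.

Lemma smooth_factorsM f g : smooth_factors f -> smooth_factors g ->
  @smooth_factors R n (fun i t => f i t * g i t).
Proof. by move=> sf sg i; exact: smooth1M. Qed.

(** Multiplied by a cutoff, [h] is integrable. Its integral over a box is the
    limit of its integrals against smooth tensors, hence zero, and the boxes
    form a pi-system of generators. Integrability is asked of the products with
    the cutoffs only, since [h] is typically just square integrable. *)
Lemma ae_eq0_tensor (h : 'rV[R]_n -> R) : measurable_fun setT h ->
  (forall k, mu.-integrable setT (EFin \o (fun x => h x * tensor (scaled_bump k) x))) ->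
  (forall r f, smooth_factors f -> supported r f ->
    (\int[mu]_x (h x * tensor f x)%:E = 0)%E) ->
  h = cst 0 %[ae mu].
Proof.
move=> mh ih h0.
pose g k x := h x * tensor (scaled_bump k) x.
have mg k : measurable_fun setT (g k).
  by apply: measurable_funM => //; apply: measurable_tensor; exact: smooth_scaled_bump.
have box0 k a b : (\int[mu]_(x in ocbox a b) (g k x)%:E = 0)%E.
  rewrite integral_mkcond.
  have /(_ _ _)[]// := @dominated_convergence _ _ _ mu setT measurableT
    (fun l x => (g k x * tensor (box_factors a b l) x)%:E)
    ((EFin \o g k) \_ (ocbox a b)) (fun x => `|g k x|%:E).
  - move=> l; apply/measurable_EFinP/measurable_funM => //.
    apply: measurable_tensor; exact: smooth_box_factors.
  - apply/(measurable_restrictT _ (measurable_ocbox a b)).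
    by apply/measurable_funTS/measurable_EFinP.
  - apply: aeW => x _; rewrite patchE.
    have -> : (if x \in ocbox a b then (EFin \o g k) x else 0%E) =
        (g k x * \1_(ocbox a b) x)%:E.
      by rewrite indicE; case: (x \in _); rewrite ?mulr1 ?mulr0.
    apply: cvg_EFin; first exact: nearW.
    by apply: cvgM; [exact: cvg_cst|exact: cvg_box_factors].
  - exact: integrable_norm (ih k).
  - apply: aeW => x l _; rewrite /= lee_fin normrM ler_piMr//.
    rewrite ger0_norm; first by apply: tensor_le1 => i t; exact: box_factors01.
    by apply: tensor_ge0 => i t; have /andP[] := box_factors01 a b l i t.
  move=> _ _ /cvg_lim <-//; apply/cvg_lim => //.
  apply: cvg_near_cst; apply: nearW => l /=.
  rewrite -[RHS](h0 (2 * k.+1%:R) (fun i t => scaled_bump k i t * box_factors a b l i t)).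
  - by apply: eq_integral => x _; rewrite tensorM mulrA.
  - by apply: smooth_factorsM; [exact: smooth_scaled_bump|exact: smooth_box_factors].
  - by apply: supportedM; exact: supported_scaled_bump.
have int0 k : (\int[mu]_x (g k x)%:E = 0)%E.
  by apply: (h0 (2 * k.+1%:R)); [exact: smooth_scaled_bump|exact: supported_scaled_bump].
have set0' k A : measurable A -> (\int[mu]_(x in A) (g k x)%:E = 0)%E.
  move=> mA.
  have := @dynkin_induction _ 'rV[R]_n ocboxes
    (fun A => \int[mu]_(x in A) (g k x)%:E = 0)%E measurable_ocboxes ocboxes_setI.
  apply => //.
  - by move=> _ [ab _ <-]; exact: box0.
  - move=> S mS S0; have := int0 k.
    rewrite -(setUv S) integral_setU_EFin//; last 3 first.
    + exact: measurableC.
    + by rewrite setUv.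
    + by apply/disj_setPCl.
    by rewrite S0 add0e.
  - move=> F mF tF F0; rewrite integral_bigcup//.
      by rewrite eseries0// => l _ _; exact: F0.
    apply: (integrableS measurableT) => //; last exact: ih.
    exact: bigcupT_measurable.
  - by move: mA; rewrite measurable_ocboxes.
have ae0 k : (EFin \o g k) = cst 0%E %[ae mu].
  apply: integral_ae_eq => //; first exact: ih.
  by move=> E _ mE; rewrite [LHS]set0'// integral0.
have := (@ae_foralln _ _ _ mu (fun k x => g k x = 0)).
have /[swap]/[apply] : forall k, \forall x \ae mu, g k x = 0.
  by move=> k; apply: filterS (ae0 k) => x /= /(_ I) [].
apply: filterS => x gx _ /=; have [k xk] := cube_exhaust x.
by have := gx k; rewrite /g scaled_bump1 ?mulr1// => j; exact: ltW.
Qed.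

End fundamental_lemma.

(** * Square-integrable functions and integration by parts *)

Section lebesgue_lemmas.
Context d (T : measurableType d) {R : realType} (mu : {measure set T -> \bar R}).

Lemma L2_measurable (f : T -> R) : f \in Lfun mu 2 -> measurable_fun setT f.
Proof. by rewrite inE => /andP[/[!inE]/= mf _]. Qed.

Lemma L2_mul_integrable (f g : T -> R) : f \in Lfun mu 2 -> g \in Lfun mu 2 ->
  mu.-integrable setT (EFin \o (fun x => f x * g x)).
Proof. by move=> f2 g2; apply/Lfun1_integrable; exact: Lfun2_mul_Lfun1. Qed.

Lemma measurable_sqr_norm (f : T -> R) : measurable_fun setT f ->
  measurable_fun setT (fun x => `|(EFin \o f) x| `^ 2)%E.
Proof.
move=> mf; apply/measurable_EFinP.
apply/(@measurableT_comp _ _ _ _ _ _ (fun x : R => x `^ 2)%R) => //.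
exact/measurableT_comp.
Qed.

Lemma L2_of_sqr (f : T -> R) : measurable_fun setT f ->
  mu.-integrable setT (EFin \o (fun x => f x ^+ 2)) -> f \in Lfun mu 2.
Proof.
move=> mf /integrableP[_ foo]; rewrite inE; apply/andP; split; rewrite inE//=.
rewrite /finite_norm unlock; apply: poweR_lty; apply: le_lt_trans foo.
rewrite ge0_le_integral//.
- by move=> t _; exact: poweR_ge0.
- exact: measurable_sqr_norm.
- by apply: measurableT_comp => //; apply/measurable_EFinP; exact: measurable_funX.
- by move=> t _ /=; rewrite lee_fin normrX powR_mulrn.
Qed.

Lemma Rintegral_ae (f g : T -> R) : measurable_fun setT f -> measurable_fun setT g ->
  f = g %[ae mu] -> \int[mu]_x f x = \int[mu]_x g x.
Proof.
move=> mf mg fg; congr fine; apply: ae_eq_integral => //; try exact/measurable_EFinP.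
by apply: filterS fg => x /= /[apply] ->.
Qed.

Lemma L2norm_ae (f g : T -> R) : measurable_fun setT f -> measurable_fun setT g ->
  f = g %[ae mu] -> ('N[mu]_2[EFin \o f] = 'N[mu]_2[EFin \o g])%E.
Proof.
move=> mf mg fg; rewrite unlock.
rewrite (@ge0_ae_eq_integral _ _ _ mu setT (fun x => `|(EFin \o f) x| `^ 2)%E
  (fun x => `|(EFin \o g) x| `^ 2)%E measurableT)//.
- exact: measurable_sqr_norm.
- exact: measurable_sqr_norm.
- by move=> x _; exact: poweR_ge0.
- by move=> x _; exact: poweR_ge0.
- by apply: filterS fg => x /= /[apply] ->.
Qed.

Lemma Lnorm2_fin (f : T -> R) : f \in Lfun mu 2 ->
  exists2 N : R, 0 <= N & ('N[mu]_2[EFin \o f] = N%:E)%E.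
Proof.
rewrite inE => /andP[_]; rewrite inE/= /finite_norm => foo.
have h : ('N[mu]_2[EFin \o f])%E \is a fin_num by rewrite ge0_fin_numE// Lnorm_ge0.
exists (fine ('N[mu]_2[EFin \o f])%E); last by rewrite fineK.
by rewrite fine_ge0// Lnorm_ge0.
Qed.

End lebesgue_lemmas.

Section integration_by_parts.
Context {R : realType}.
Local Notation lm := (@lebesgue_measure R).

Lemma integral_deriv0 (k g : R -> R) (r : R) : continuous g ->
  (forall t : R, is_derive t (1 : R) k (g t)) -> (forall t, r < `|t| -> k t = 0) ->
  (\int[lm]_t (g t)%:E = 0)%E.
Proof.
move=> cg dk k0.
have g0 t : r < `|t| -> g t = 0.
  by move=> rt; have [_ <-] := dk t; rewrite -derive1E; exact: (derive1_cst_out k0).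
pose w := `|r| + 1.
have w0 : 0 < w by rewrite ltr_wpDl.
have rw : r < w by rewrite /w (le_lt_trans (ler_norm r))// ltrDl.
have -> : (\int[lm]_t (g t)%:E = \int[lm]_(t in `[(- w)%R, w]) (g t)%:E)%E.
  rewrite [RHS]integral_mkcond; apply: eq_integral => t _; rewrite patchE.
  case: ifPn => //; rewrite notin_setE/= in_itv/= -ler_norml => /negP; rewrite -ltNge => h.
  by rewrite g0// (lt_trans rw).
have ck : continuous k.
  by move=> t; apply/differentiable_continuous/derivable1_diffP; have [] := dk t.
rewrite (@continuous_FTC2 _ g k).
- by rewrite !k0 ?subee// ?normrN gtr0_norm.
- by rewrite ltrNl (lt_trans _ w0)// oppr_lt0.
- exact: continuous_subspaceT.
- split.
  + by move=> t _; have [] := dk t.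
  + exact/cvg_at_right_filter/ck.
  + exact/cvg_at_left_filter/ck.
- by move=> t _; rewrite derive1E; have [_ ->] := dk t.
Qed.

Lemma is_derive_line n (F : 'rV[R]_n -> R) x (i : 'I_n) (t d : R) :
  is_derive (x + t *: delta_mx ord0 i) (delta_mx ord0 i) F d ->
  is_derive t (1 : R) (fun s => F (x + s *: delta_mx ord0 i)) d.
Proof.
set v := delta_mx ord0 i.
have E : (fun h : R => h^-1 *: ((F \o shift (x + t *: v)) (h *: v) - F (x + t *: v))) =
    (fun h : R => h^-1 *: (((fun s => F (x + s *: v)) \o shift t) (h *: 1) - F (x + t *: v))).
  apply/funext => h; congr (_ *: (F _ - _)).
  by rewrite /shift /= [h *: 1]mulr1 scalerDl addrCA.
move=> [dF dFE]; apply: DeriveDef.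
  by rewrite /derivable -E; exact: dF.
by rewrite /derive -E; exact: dFE.
Qed.

Lemma bounded_of_cube_supp n (g : 'rV[R]_n -> R) (r : R) : 0 <= r -> continuous g ->
  (forall x, ~ cube r x -> g x = 0) -> exists M, forall x, `|g x| <= M.
Proof.
move=> r0 cg g0.
have [c _ hc] : exists2 c : 'rV[R]_n, c \in cube r &
    forall t, t \in cube r -> `|g t| <= `|g c|.
  apply: (@EVT_max_rV R n (fun x => `|g x|)).
  - by exists 0 => i; rewrite mxE normr0.
  - exact: cube_compact.
  - by apply: continuous_subspaceT => x; apply: continuous_comp; [exact: cg|exact: norm_continuous].
exists `|g c| => x; have [xr|xr] := pselect (cube r x); last by rewrite g0// normr0.
by apply: hc; rewrite inE.
Qed.

(** On every line in the direction [i] the integral is the increment of a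
    function with compact support. *)
Lemma integral_partial0 n (i : 'I_n) (F G : 'rV[R]_n -> R) (r : R) : 0 <= r ->
  continuous G -> (forall x, is_derive x (delta_mx ord0 i) F (G x)) ->
  (forall x, ~ cube r x -> F x = 0) -> (forall x, ~ cube r x -> G x = 0) ->
  (\int[lebesgue_rV R n]_x (G x)%:E = 0)%E.
Proof.
move=> r0 cG dF F0 G0; apply: (@integral_line0 _ _ i).
  have [M GM] := bounded_of_cube_supp r0 cG G0.
  exact: (integrable_bounded_cube r0 (continuous_measurable_rV cG) G0 GM).
move=> x; apply: (@integral_deriv0 (fun t => F (x + t *: delta_mx ord0 i)) _ (r + `|x ord0 i|)).
- move=> t; apply: (@continuous_comp _ _ _ (fun t : R => x + t *: delta_mx ord0 i) G); last exact: cG.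
  by apply: cvgD; [exact: cvg_cst|apply: cvgZl; exact: cvg_id].
- by move=> t; exact: is_derive_line.
- move=> t rt; apply: F0 => /(_ i); apply/negP; rewrite -ltNge !mxE !eqxx mulr1.
  by rewrite addrC; apply: (lt_le_trans _ (lerB_normD _ _)); rewrite ltrBrDr.
Qed.

End integration_by_parts.

(** * Sobolev spaces tested by tensors *)

Section sobolev_tensor.
Context {R : realType} {n : nat}.
Local Notation mu := (lebesgue_rV R n).
Implicit Types (f : 'I_n -> R -> R) (g h psi : 'rV[R]_n -> R).

Lemma L2_cube g (r M : R) : 0 <= r -> measurable_fun setT g ->
  (forall x, ~ cube r x -> g x = 0) -> (forall x, `|g x| <= M) -> L2 R n g.
Proof.
move=> r0 mg g0 gM; apply: L2_of_sqr => //.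
apply: (@integrable_bounded_cube _ _ _ r (M ^+ 2)) => //.
- exact: measurable_funX.
- by move=> x /g0 ->; rewrite expr0n.
- by move=> x; rewrite normrX lerXn2r// nnegrE (le_trans _ (gM x)).
Qed.

Lemma tensor_bounded f (r : R) : 0 <= r -> smooth_factors f -> supported r f ->
  exists M, forall x, `|tensor f x| <= M.
Proof.
move=> r0 sf rf; apply: (bounded_of_cube_supp r0); first exact: continuous_tensor.
by move=> x; exact: supported_tensor.
Qed.

Lemma L2_tensor f (r : R) : 0 <= r -> smooth_factors f -> supported r f -> L2 R n (tensor f).
Proof.
move=> r0 sf rf; have [M fM] := tensor_bounded r0 sf rf.
apply: (L2_cube r0 _ _ fM); first exact: measurable_tensor.
by move=> x; exact: supported_tensor.
Qed.

Lemma weak_partial_tensor f (r : R) i : 0 <= r -> smooth_factors f -> supported r f ->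
  weak_partial i (tensor f) (tensor (dfactor i f)).
Proof.
move=> r0 sf rf psi tpsi; have [spsi _] := tpsi.
have [cpsi dpsi] := spsi [::]; have [cdpsi _] := spsi [:: i]; rewrite /= in cpsi dpsi cdpsi.
have sdf := smooth_dfactor i sf; have rdf := supported_dfactor i rf.
have c1 : continuous (fun x => tensor f x * partial i psi x).
  by move=> x; exact: (cvgM (continuous_tensor sf (x := x)) (cdpsi x)).
have c2 : continuous (fun x => tensor (dfactor i f) x * psi x).
  by move=> x; exact: (cvgM (continuous_tensor sdf (x := x)) (cpsi x)).
have z1 x : ~ cube r x -> tensor f x * partial i psi x = 0.
  by move=> nx; rewrite (supported_tensor rf nx) mul0r.
have z2 x : ~ cube r x -> tensor (dfactor i f) x * psi x = 0.
  by move=> nx; rewrite (supported_tensor rdf nx) mul0r.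
have i1 : mu.-integrable setT (EFin \o (fun x => tensor f x * partial i psi x)).
  have [M hM] := bounded_of_cube_supp r0 c1 z1.
  exact: (integrable_bounded_cube r0 (continuous_measurable_rV c1) z1 hM).
have i2 : mu.-integrable setT (EFin \o (fun x => tensor (dfactor i f) x * psi x)).
  have [M hM] := bounded_of_cube_supp r0 c2 z2.
  exact: (integrable_bounded_cube r0 (continuous_measurable_rV c2) z2 hM).
apply/eqP; rewrite -addr_eq0 -RintegralD//; apply/eqP.
suff E : (\int[mu]_x (tensor f x * partial i psi x + tensor (dfactor i f) x * psi x)%:E = 0)%E.
  by rewrite /Rintegral E.
apply: (@integral_partial0 _ _ i (fun x => tensor f x * psi x) _ r r0).
- by move=> x; exact: (cvgD (c1 x) (c2 x)).
- move=> x.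
  have dt := is_derive_tensor x i sf.
  have dp : is_derive x (delta_mx ord0 i) psi (partial i psi x) by apply: derivableP; exact: dpsi.
  refine (is_derive_eq (is_deriveM dt dp) _).
  by rewrite /GRing.scale/= [psi x * _]mulrC.
- by move=> x nx; rewrite (supported_tensor rf nx) mul0r.
- by move=> x nx; rewrite z1// z2// addr0.
Qed.

Lemma H1_tensor f (r : R) : 0 <= r -> smooth_factors f -> supported r f -> H1 R n (tensor f).
Proof.
move=> r0 sf rf; split; first exact: L2_tensor rf.
move=> i; exists (tensor (dfactor i f)); last exact: weak_partial_tensor rf.
by apply: (L2_tensor r0); [exact: smooth_dfactor|exact: supported_dfactor].
Qed.

(** The difference annihilates every tensor test function. *)
Lemma weak_partial_unique i psi (g h : 'rV[R]_n -> R) :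
  L2 R n g -> L2 R n h -> weak_partial i psi g -> weak_partial i psi h ->
  g = h %[ae mu].
Proof.
move=> g2 h2 wg wh.
have mg := L2_measurable g2; have mh := L2_measurable h2.
have int0 r f : smooth_factors f -> supported r f ->
    mu.-integrable setT (EFin \o (fun x => (g x - h x) * tensor f x)) /\
    (\int[mu]_x ((g x - h x) * tensor f x)%:E = 0)%E.
  move=> sf rf.
  have rf' : supported `|r| f by move=> j t rt; apply: rf; exact: le_lt_trans (ler_norm r) rt.
  have f2 := L2_tensor (normr_ge0 r) sf rf'.
  have ig := L2_mul_integrable g2 f2; have ih := L2_mul_integrable h2 f2.
  have i0 : mu.-integrable setT (EFin \o (fun x => (g x - h x) * tensor f x)).
    apply: eq_integrable (integrableB _ ig ih) => // x _ /=.
    by rewrite mulrBl EFinB.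
  split => //.
  have tf := test_tensor sf rf.
  have := wh _ tf; rewrite (wg _ tf) => /oppr_inj => gh.
  rewrite -[LHS]fineK; last exact: integrable_fin_num i0.
  have -> : fine (\int[mu]_x ((g x - h x) * tensor f x)%:E)%E =
     \int[mu]_x (g x * tensor f x - h x * tensor f x).
    by apply: eq_Rintegral => x _; rewrite mulrBl.
  by rewrite RintegralB// gh subrr.
have : (fun x => g x - h x) = cst 0 %[ae mu].
  apply: ae_eq0_tensor.
  - exact: measurable_funB.
  - by move=> k; have [] := int0 _ _ (@smooth_scaled_bump _ _ k) (@supported_scaled_bump _ _ k).
  - by move=> r f sf rf; have [] := int0 r f sf rf.
by apply: filterS => x /= /[apply] /eqP; rewrite subr_eq0 => /eqP.
Qed.

Lemma wpartialP i g : H1 R n g -> L2 R n (wpartial i g) /\ weak_partial i g (wpartial i g).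
Proof.
move=> [_ /(_ i)[h h2 wh]].
exact: (@xgetPex _ (0 : 'rV[R]_n -> R) [set g0 | g0 \in Lfun mu 2 /\ weak_partial i g g0] (ex_intro _ h (conj h2 wh))).
Qed.

Lemma wpartial_ae i g h : L2 R n h -> weak_partial i g h -> H1 R n g ->
  wpartial i g = h %[ae mu].
Proof.
by move=> h2 wh /(@wpartialP i)[w2 ww]; exact: (weak_partial_unique w2 h2 ww wh).
Qed.

(** One more integration by parts in the definition of the weak Laplacian: no
    derivative of [g] is left. *)
Lemma laplacian_tensor g f (r : R) : 0 <= r -> H1 R n g -> smooth_factors f -> supported r f ->
  laplacian g (tensor f) =
  \sum_(i < n) \int[mu]_x (g x * tensor (dfactor i (dfactor i f)) x).
Proof.
move=> r0 Hg sf rf; rewrite /laplacian -sumrN; apply: eq_bigr => i _.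
have [w2 ww] := wpartialP i Hg.
have sdf := smooth_dfactor i sf; have rdf := supported_dfactor i rf.
rewrite -partial_tensor// (ww _ (test_tensor sdf rdf)); congr (- _).
have Hf := H1_tensor r0 sf rf; have d2 := L2_tensor r0 sdf rdf.
have [wf2 _] := wpartialP i Hf.
apply: Rintegral_ae.
- exact: (measurable_funM (L2_measurable w2) (L2_measurable wf2)).
- exact: (measurable_funM (L2_measurable w2) (L2_measurable d2)).
have := wpartial_ae d2 (@weak_partial_tensor f r i r0 sf rf) Hf.
by apply: filterS => x /= /[apply] ->.
Qed.

Lemma L2Z (c : R) g : L2 R n g -> L2 R n (c *: g).
Proof. move=> g2; have [h0 h] := Lfun_submod_closed mu (lee1n 2).
by have := h c g 0 g2 h0; rewrite addr0. Qed.

Lemma weak_partialZ i (c : R) g h : L2 R n g -> L2 R n h ->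
  weak_partial i g h -> weak_partial i (c *: g) (c *: h).
Proof.
move=> g2 h2 wgh psi tpsi; have := wgh _ tpsi.
have [r r0 psi0] := test_function_supp_cube tpsi.
have [spsi _] := tpsi.
have [cpsi _] := spsi [::]; have [cdpsi _] := spsi [:: i]; rewrite /= in cpsi cdpsi.
have L2c k : continuous k -> (forall x, ~ cube r x -> k x = 0) -> L2 R n k.
  move=> ck k0; have [M kM] := bounded_of_cube_supp r0 ck k0.
  exact: L2_cube r0 (continuous_measurable_rV ck) k0 kM.
have dpsi0 x : ~ cube r x -> partial i psi x = 0.
  move=> /existsNP[j /negP]; rewrite -ltNge => rj.
  have [_ dpsi] := spsi [::].
  have dp : is_derive (x + (0 : R) *: delta_mx ord0 i) (delta_mx ord0 i) psi (partial i psi x).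
    by rewrite scale0r addr0; apply: derivableP; exact: dpsi.
  have [_ <-] := is_derive_line dp; rewrite -derive1E.
  apply: (@derive1_flat_near _ _ 0); near=> s; apply: psi0 => /(_ j); apply/negP; rewrite -ltNge !mxE eqxx/=.
  near: s; apply: (cvgr_gt `|x ord0 j|) => //.
  apply: cvg_norm; rewrite -[X in _ --> X]addr0; apply: cvgD; first exact: cvg_cst.
  by rewrite -[X in _ --> X](mul0r (j == i)%:R); apply: cvgMl; exact: cvg_id.
have p2 := L2c _ cpsi psi0; have dp2 := L2c _ cdpsi dpsi0.
move=> E; rewrite (_ : (fun x => _) = (fun x => c * (g x * partial i psi x))); last first.
  by apply/funext => x; rewrite mulrA.
rewrite RintegralZl//; last exact: L2_mul_integrable.
rewrite [in RHS](_ : (fun x => _) = (fun x => c * (h x * psi x))); last first.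
  by apply/funext => x; rewrite mulrA.
rewrite [in RHS]RintegralZl//; last exact: L2_mul_integrable.
by rewrite E mulrN.
Unshelve. all: by end_near. Qed.

Lemma H1Z (c : R) g : H1 R n g -> H1 R n (c *: g).
Proof.
move=> [g2 Hg]; split; first exact: L2Z.
move=> i; have [h h2 wh] := Hg i; exists (c *: h); first exact: L2Z.
exact: weak_partialZ.
Qed.

Lemma L2norm_fin g : L2 R n g -> exists2 N : R, 0 <= N & L2norm g = N%:E.
Proof. exact: Lnorm2_fin. Qed.

Lemma L2normZ (c : R) g : L2 R n g -> L2norm (c *: g) = (`|c|%:E * L2norm g)%E.
Proof.
by move=> g2; exact: (LnormZ (@Lfun_Sub _ _ _ mu _ (lee1n 2) g g2) c).
Qed.

(** The dual norm is a supremum over the unit ball of [H^1]; a small multiple of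
    any function of [H^1] lies in that ball. *)
Lemma H1norm_small g : H1 R n g -> exists2 c : R, 0 < c & (H1norm (c *: g) <= 1)%E.
Proof.
move=> Hg; have [g2 _] := Hg.
have [N N0 gN] := L2norm_fin g2.
have /choice[M hM] : forall i, exists M : R, 0 <= M /\ L2norm (wpartial i g) = M%:E.
  by move=> i; have [w2 _] := wpartialP i Hg; have [M M0 ME] := L2norm_fin w2; exists M.
pose S := N ^+ 2 + \sum_(i < n) M i ^+ 2.
have S0 : 0 <= S by rewrite addr_ge0 ?sqr_ge0// sumr_ge0// => i _; rewrite sqr_ge0.
pose c := (1 + S)^-1.
have c0 : 0 < c by rewrite invr_gt0 ltr_pwDl.
exists c => //.
have Hc := H1Z c Hg.
have E i : L2norm (wpartial i (c *: g)) = (c * M i)%:E.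
  have [w2 ww] := wpartialP i Hg; have [cw2 _] := wpartialP i Hc.
  have -> : L2norm (wpartial i (c *: g)) = L2norm (c *: wpartial i g).
    apply: L2norm_ae; first exact: L2_measurable cw2.
      exact: L2_measurable (L2Z c w2).
    by apply: wpartial_ae => //; [exact: L2Z|exact: weak_partialZ].
  by rewrite L2normZ// (hM i).2 gtr0_norm.
rewrite /H1norm L2normZ// gN gtr0_norm// -EFinM -EFin_expe.
under eq_bigr do rewrite E -EFin_expe.
rewrite sumEFin -EFinD poweR_EFin lee_fin.
rewrite (_ : _ + _ = c ^+ 2 * S); last first.
  rewrite /S mulrDr exprMn mulr_sumr; congr (_ + _).
  by apply: eq_bigr => i _; rewrite exprMn.
have h : c ^+ 2 * S <= 1.
  rewrite /c exprVn ler_pdivrMl ?exprn_gt0 ?ltr_pwDl// mulr1.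
  by rewrite expr2 mulrDl mul1r mulrDr; nra.
have h1 : 1 `^ 2^-1 = 1 :> R by rewrite powR1.
rewrite -[leRHS]h1; apply: ge0_ler_powR => //.
  by rewrite nnegrE mulr_ge0// sqr_ge0.
by rewrite nnegrE.
Qed.

Definition linear_on_H1 (L : ('rV[R]_n -> R) -> R) :=
  forall a g h, H1 R n g -> H1 R n h -> L (a *: g + h) = a * L g + L h.

Lemma Hm1norm_bound g : H1 R n g -> exists2 c : R, 0 < c &
  forall L, linear_on_H1 L -> (`|L g|%:E <= c%:E * Hm1norm L)%E.
Proof.
move=> Hg; have [c c0 gc] := H1norm_small Hg.
exists c^-1; first by rewrite invr_gt0.
move=> L Llin.
have L0 : L 0 = 0.
  have H0 : H1 R n 0 by have := H1Z 0 Hg; rewrite scale0r.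
  by have := Llin 1 0 0 H0 H0; rewrite scaler0 addr0 mul1r => /eqP; rewrite -subr_eq0 opprD addNKr oppr_eq0 => /eqP.
have Lc : L (c *: g) = c * L g.
  have H0 : H1 R n 0 by have := H1Z 0 Hg; rewrite scale0r.
  by have := Llin c g 0 Hg H0; rewrite addr0 L0 addr0.
have : (`|L (c *: g)|%:E <= Hm1norm L)%E.
  by apply: ereal_sup_ubound; exists (c *: g) => //; split => //; exact: H1Z.
rewrite Lc normrM gtr0_norm// EFinM => h.
have -> : (`|L g|%:E = c^-1%:E * (c%:E * `|L g|%:E))%E.
  by rewrite -!EFinM mulrA mulVf ?mul1r// gt_eqF.
by rewrite lee_wpmul2l// lee_fin invr_ge0 ltW.
Qed.

End sobolev_tensor.

(** * The equation tested against a fixed function *)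

Section pairing.
Context {R : realType} {n : nat}.
Local Notation mu := (lebesgue_rV R n).
Local Notation dual := (('rV[R]_n -> R) -> R).

Lemma nbhs_time_interval (T : \bar R) (t : R) : 0 < t -> (t%:E < T)%E ->
  \forall s \near t, time_interval T s.
Proof.
move=> t0 tT.
have hT : \forall s \near t, (s%:E < T)%E.
  case: T tT => [r| |]//.
    by rewrite lte_fin => tr; near=> s; rewrite lte_fin; near: s; exact: lt_nbhsl.
  by move=> _; near=> s; rewrite ltry.
near=> s; split; last by near: s.
by rewrite ltW//; near: s; exact: lt_nbhsr.
Unshelve. all: by end_near. Qed.

Lemma cvg_pairing0 {S : Type} (F : set_system S) {FF : Filter F} (D : S -> dual) g :
  H1 R n g -> (\forall s \near F, linear_on_H1 (D s)) ->
  Hm1norm (D s) @[s --> F] --> 0%E -> D s g @[s --> F] --> (0 : R).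
Proof.
move=> Hg lD /fine_cvgP[fD cD].
have [c c0 hc] := Hm1norm_bound Hg.
apply/cvgr0Pnorm_lt => e e0.
have : \forall s \near F, `|fine (Hm1norm (D s))| < c^-1 * e.
  by apply: (cvgr0_norm_lt _ cD); rewrite mulr_gt0 ?invr_gt0.
move=> h; near=> s.
have /hc : linear_on_H1 (D s) by near: s.
rewrite -[Hm1norm _]fineK; last by near: s.
rewrite -EFinM lee_fin => /le_lt_trans; apply.
rewrite -ltr_pdivlMl// (le_lt_trans (ler_norm _))//; near: s.
exact: h.
Unshelve. all: by end_near. Qed.

Lemma linear_on_H1B (L M : dual) : linear_on_H1 L -> linear_on_H1 M -> linear_on_H1 (L - M).
Proof. by move=> lL lM a g h Hg Hh; rewrite !fctE lL// lM//; ring. Qed.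

Lemma linear_on_H1Z (c : R) (L : dual) : linear_on_H1 L -> linear_on_H1 (c *: L).
Proof. by move=> lL a g h Hg Hh; rewrite !fctE lL// /GRing.scale/=; ring. Qed.

Lemma Hm1_linear L : Hm1 R n L -> linear_on_H1 L. Proof. by case. Qed.

Variables (T : \bar R) (g : 'rV[R]_n -> R).
Hypothesis Hg : H1 R n g.
Local Notation I := (time_interval T).

Lemma C0_pairing (D : R -> dual) t : C0_curve T (Hm1 R n) Hm1norm D -> I t ->
  D s g @[s --> within I (nbhs t)] --> D t g.
Proof.
move=> CD It; have [Dt cD] := CD _ It.
rewrite -[X in _ --> X](add0r (D t g)).
rewrite (_ : (fun s => D s g) = (fun s => (D s - D t) g + D t g)); last first.
  by apply/funext => s; rewrite !fctE subrK.
apply: cvgD; last exact: cvg_cst.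
apply: (cvg_pairing0 Hg _ cD); rewrite near_withinE; apply: nearW => s Is.
by apply: linear_on_H1B; apply: Hm1_linear; [have [] := CD _ Is|].
Qed.

Lemma C0_pairing_in (D : R -> dual) t : C0_curve T (Hm1 R n) Hm1norm D ->
  0 < t -> (t%:E < T)%E -> D s g @[s --> t] --> D t g.
Proof.
move=> CD t0 tT; have It : I t by split => //; exact: ltW.
apply: cvg_trans (C0_pairing CD It) => A; rewrite !nbhs_simpl /= => h.
have := nbhs_time_interval t0 tT.
by apply: filter_app; apply: filterS h => s /=.
Qed.

Lemma C0_pairing_0 (D : R -> dual) : C0_curve T (Hm1 R n) Hm1norm D -> (0 < T)%E ->
  D s g @[s --> 0^'+] --> D 0 g.
Proof.
move=> CD T0; have It : I 0 by split.
apply: cvg_trans (C0_pairing CD It) => A; rewrite !nbhs_simpl /= => h.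
have : \forall s \near 0^'+, (s%:E < T)%E.
  case: T T0 => [r| |]//=; rewrite ?lte_fin => r0.
    by near=> s; rewrite lte_fin; near: s; exact: nbhs_right_lt.
  by near=> s; rewrite ltry.
move=> hT; have h' : \forall s \near (0 : R)^'+, I s -> (D^~ g @^-1` A) s.
  by apply: cvg_within; exact: h.
near=> s.
have sI : I s.
  by split; [near: s; exact: nbhs_right_ge|near: s].
by move: sI; near: s.
Unshelve. all: by end_near. Qed.

(** The difference quotients converge in [H^-1], and [H^-1] convergence implies
    convergence of the pairings; inside the open interval the restriction to the
    interval disappears from the limit. *)
Lemma derivative_pairing (D D' : R -> dual) t :
  C0_curve T (Hm1 R n) Hm1norm D -> C0_curve T (Hm1 R n) Hm1norm D' ->
  derivative_curve T Hm1norm D D' -> 0 < t -> (t%:E < T)%E ->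
  is_derive t (1 : R) (fun s => D s g) (D' t g).
Proof.
move=> CD CD' DD t0 tT; have It : I t by split => //; exact: ltW.
have [lDt _] := CD _ It; have [lDt' _] := CD' _ It.
pose E (s : R) := (s - t)^-1 *: (D s - D t) - D' t.
have lE : \forall s \near within I t^', linear_on_H1 (E s).
  rewrite near_withinE; apply: nearW => s Is.
  apply: linear_on_H1B; last exact: Hm1_linear.
  apply/linear_on_H1Z/linear_on_H1B; apply: Hm1_linear => //.
  by have [] := CD _ Is.
have c0 : E s g @[s --> within I t^'] --> (0 : R) by exact: cvg_pairing0 Hg lE (DD _ It).
have c1 : (s - t)^-1 * (D s g - D t g) - D' t g @[s --> t^'] --> (0 : R).
  have {c0}c0 : (s - t)^-1 * (D s g - D t g) - D' t g @[s --> within I t^'] --> (0 : R) := c0.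
  apply: cvg_trans c0 => A; rewrite !nbhs_simpl /= => h.
  have /nbhs_dnbhs := nbhs_time_interval t0 tT.
  by apply: filter_app; apply: filterS h => s /=.
have c2 : h^-1 *: ((fun s => D s g) (h *: 1 + t) - D t g) @[h --> 0^'] --> D' t g.
  apply/cvgrPdist_lt => e e0.
  have /cvgr0Pnorm_lt/(_ _ e0) := c1.
  rewrite near_withinE => /nbhs_ballP[d d0 hd].
  rewrite near_withinE; apply/nbhs_ballP; exists d => // h hd0 hn0.
  have := hd (h *: 1 + t); rewrite /ball/= [h *: 1]mulr1 opprD addrA addrAC subrr.
  rewrite /ball/= sub0r in hd0; rewrite add0r addrK => /(_ hd0).
  rewrite distrC; apply.
  by rewrite -subr_eq0 addrK.
by apply: DeriveDef; [apply/cvg_ex; eexists; exact: c2|exact/cvg_lim/c2].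
Qed.

End pairing.

Section energy_ode.
Context {R : realType} {n : nat}.
Local Notation mu := (lebesgue_rV R n).

(** The time derivatives of an energy solution exist in [H^-1], so that pairing
    with one fixed test function commutes with them. Nothing better than
    one-sided limits is claimed at the initial time: [b] need not be continuous
    there. *)
Lemma energy_solution_ode (b : R -> R) (p : R) u0 u1 eps (T : \bar R) u
    (f : 'I_n -> R -> R) (r : R) : (0 < T)%E ->
  L2 R n u0 -> L2 R n u1 ->
  energy_solution b p u0 u1 eps T u -> 0 <= r -> smooth_factors f -> supported r f ->
  let U t := \int[mu]_x (u t x * tensor f x) in
  let F t := \int[mu]_x (`|u t x| `^ p * tensor f x) in
  let Lap t := \sum_(i < n) \int[mu]_x (u t x * tensor (dfactor i (dfactor i f)) x) in
  exists V : R -> R, let W t := F t - b t * V t + Lap t in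
  [/\ forall t, 0 < t -> (t%:E < T)%E -> is_derive t (1 : R) U (V t) /\ is_derive t (1 : R) V (W t),
      forall t, 0 < t -> (t%:E < T)%E -> {for t, continuous W} /\ {for t, continuous Lap},
      U t @[t --> 0^'+] --> eps * \int[mu]_x (u0 x * tensor f x) /\
      V t @[t --> 0^'+] --> eps * \int[mu]_x (u1 x * tensor f x) &
      forall t, 0 < t -> (t%:E < T)%E -> L2 R n (u t) /\
        mu.-integrable setT (fun x => (`|u t x| `^ p * tensor f x)%:E)].
Proof.
move=> T0 u02 u12 [v [w [Cu [CuL2 _ CvL2] [[Du DDu Dv] [Dv' DDv Dw]] [u0E v0E] eqn]]] r0 sf rf U F Lap.
have Hf := H1_tensor r0 sf rf; have f2 := L2_tensor r0 sf rf.
have uL2 t : time_interval T t -> L2 R n (u t) by move=> It; have [] := CuL2 _ It.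
have WE t : time_interval T t -> w t (tensor f) = F t - b t * to_dual (v t) (tensor f) + Lap t.
  move=> It; have [_] := eqn t It _ Hf.
  have [Hu _] := Cu _ It.
  rewrite (laplacian_tensor r0 Hu sf rf) -/(Lap t) => h.
  by rewrite /F -[\int[mu]_x _]/(to_dual (fun x => `|u t x| `^ p) (tensor f)) -h; ring.
have It t : 0 < t -> (t%:E < T)%E -> time_interval T t by move=> t0 tT; split => //; exact: ltW.
exists (fun t => to_dual (v t) (tensor f)); split.
- move=> t t0 tT; split; first exact: (derivative_pairing Hf Du Dv DDu).
  by rewrite -WE; [exact: (derivative_pairing Hf Dv Dw DDv)|exact: It].
- move=> t t0 tT; split.
    apply: cvg_trans (_ : (w s (tensor f)) @[s --> t] --> _).
      apply: near_eq_cvg; near=> s; rewrite WE//; near: s; exact: nbhs_time_interval.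
    rewrite -WE; last exact: It.
    exact: (C0_pairing_in Hf Dw).
  rewrite /continuous_at /Lap.
  apply: cvg_big => // [|i _]; first exact: add_continuous.
  have Hdf : H1 R n (tensor (dfactor i (dfactor i f))).
    apply: (H1_tensor r0); first by do 2 apply: smooth_dfactor.
    by do 2 apply: supported_dfactor.
  exact: (C0_pairing_in Hdf Du).
- have I0 : time_interval T 0 by split.
  have E (u' : 'rV[R]_n -> R) z : L2 R n u' -> L2 R n z -> u' = eps *: z %[ae mu] ->
      to_dual u' (tensor f) = eps * \int[mu]_x (z x * tensor f x).
    move=> u2 z2 uz; rewrite -RintegralZl//; last exact: L2_mul_integrable.
    apply: Rintegral_ae.
    + exact: (measurable_funM (L2_measurable u2) (L2_measurable f2)).
    + apply: measurable_funM => //.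
      exact: (measurable_funM (L2_measurable z2) (L2_measurable f2)).
    + by apply: filterS uz => x /= /[apply] ->; rewrite /= fctE mulrA.
  split.
    rewrite -(E (u 0))//; last exact: uL2.
    exact: (C0_pairing_0 Hf Du).
  rewrite -(E (v 0))//; last by have [] := CvL2 _ I0.
  exact: (C0_pairing_0 Hf Dv).
- move=> t t0 tT; split; first by apply: uL2; exact: It.
  by have [] := eqn t (It _ t0 tT) _ Hf.
Unshelve. all: by end_near. Qed.

End energy_ode.

(** * The weight that absorbs the damping *)

Section monotonicity.
Context {R : realType}.

Lemma nincr_is_derive (f df : R -> R) (x y : R) : x <= y ->
  (forall t, x <= t <= y -> is_derive t (1 : R) f (df t)) ->
  (forall t, x <= t <= y -> df t <= 0) -> f y <= f x.
Proof.
move=> xy Df df0; have D t : t \in `]x, y[%R -> x <= t <= y.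
  by rewrite in_itv/= => /andP[/ltW -> /ltW ->].
apply: (@ler0_derive1_nincr _ f x y) => //.
- by move=> t /D /Df[].
- by move=> t /D txy; rewrite derive1E; have [_ ->] := Df _ txy; exact: df0.
- apply: derivable_within_continuous => t; rewrite in_itv/= => txy.
  by have [] := Df _ txy.
Qed.

Lemma ndecr_is_derive (f df : R -> R) (x y : R) : x <= y ->
  (forall t, x <= t <= y -> is_derive t (1 : R) f (df t)) ->
  (forall t, x <= t <= y -> 0 <= df t) -> f x <= f y.
Proof.
move=> xy Df df0; rewrite -lerN2.
apply: (@nincr_is_derive (- f) (fun t => - df t)) => //.
- by move=> t /Df Dt; exact: is_deriveN.
- by move=> t /df0; rewrite oppr_le0.
Qed.

End monotonicity.

Section damping_weight.
Context {R : realType}.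
Local Notation lm := (@lebesgue_measure R).
Variables (beta : R) (b : R -> R).
Hypothesis beta_itv : -1 <= beta < 1.
Hypothesis b_gt0 : forall t, 0 <= t -> 0 < b t.
Hypothesis b1 : damping_B1 b.
Hypothesis b2 : damping_B2 beta b.

Definition rate (t : R) : R := (1 + t) `^ beta.

Lemma rate_gt0 t : 0 <= t -> 0 < rate t.
Proof. by move=> t0; rewrite powR_gt0// ltr_pwDl. Qed.

Lemma rate_le t : 0 <= t -> rate t <= 1 + t.
Proof.
have /andP[_ /ltW b1'] := beta_itv.
by move=> t0; rewrite ler1_powR// lerDl.
Qed.

Lemma is_derive_powR_shift (L t a : R) : 0 < L + t ->
  is_derive t (1 : R) (fun s => (L + s) `^ a) (a * (L + t) `^ (a - 1)).
Proof.
move=> Lt0.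
have d1 : is_derive t (1 : R) (fun s => L + s) (0 + 1).
  exact: (is_deriveD (is_derive_cst L t 1) (is_derive_id t 1)).
have d2 := @is_derive1_powR R a _ Lt0.
have := @is_derive1_comp R (@powR R ^~ a) (fun s => L + s) t _ _ d2 d1.
by rewrite add0r mulr1.
Qed.

Lemma continuous_b t : 0 < t -> {for t, continuous b}.
Proof.
by move=> /b1[db _ _]; apply/differentiable_continuous/derivable1_diffP.
Qed.

Lemma b_upper : exists2 c, 0 < c & forall t, 0 <= t -> b t * rate t <= c.
Proof.
have [[c c0 hc] _] := b2; exists c => // t t0.
rewrite -ler_pdivlMr ?rate_gt0//; have := hc t t0.
by rewrite powRN addrC.
Qed.

Lemma b_lower : exists2 c, 0 < c & forall t, 0 <= t -> c <= b t * rate t.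
Proof.
have [_ [c c0 hc]] := b2; exists c^-1; first by rewrite invr_gt0.
move=> t t0; have := hc t t0.
rewrite powRN addrC -/(rate t) -[X in X <= _ -> _]mul1r ler_pdivrMr ?rate_gt0// => h.
by rewrite -[leLHS]mulr1 ler_pdivrMl// mulrA.
Qed.

Lemma b_integrable u : lm.-integrable `[0, u] (EFin \o b).
Proof.
have [c c0 hc] := b_upper.
have mb : measurable_fun `[0, u] b.
  have [u0|u0] := ltP 0 u; last first.
    have [->|un0] := eqVneq u 0.
      by rewrite set_itv1; exact: measurable_fun_set1.
    rewrite set_itv_ge; first exact: measurable_fun_set0.
    by rewrite bnd_simp -ltNge lt_neqAle un0.
  have -> : `[0, u]%classic = [set 0] `|` (`]0, u + 1[%classic `&` `[0, u]%classic) :> set R.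
    apply/seteqP; split=> t /=; rewrite !in_itv/=.
      move=> /andP[t0 tu]; have [->|tn0] := eqVneq t 0; first by left.
      by right; rewrite t0 tu lt_neqAle eq_sym tn0 t0 (le_lt_trans tu)// ltrDl.
    by move=> [->|[_ ->//]]; rewrite lexx ltW.
  apply/measurable_funU => //; first exact: measurableI.
  split; first exact: measurable_fun_set1.
  apply: measurable_funS (@subIsetl _ _ _) _ => //.
  apply: open_continuous_measurable_fun; first exact: interval_open.
  by move=> t; rewrite inE/= in_itv/= => /andP[t0 _]; exact: continuous_b.
apply: measurable_bounded_integrable => //.
- by apply: compact_finite_measure; exact: segment_compact.
exists (c * (1 + u)); split; first by rewrite num_real.
move=> y cy t /=; rewrite in_itv/= => /andP[t0 tu].
apply/(le_trans _ (ltW cy)).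
rewrite gtr0_norm ?b_gt0//.
have h1 : b t <= c * (1 + t) `^ (- beta).
  by rewrite powRN -ler_pdivrMr ?invr_gt0 ?rate_gt0// invrK hc.
apply: (le_trans h1); rewrite ler_wpM2l//; first exact: ltW.
have /andP[hb _] := beta_itv.
apply: (@le_trans _ _ (1 + t)); last by rewrite lerD2l.
by rewrite ler1_powR// ?lerDl// lerNl.
Qed.

Definition int_b (t : R) : R := \int[lm]_(s in `[0, t]) b s.
Definition decay (t : R) : R := expR (- int_b t).
Definition int_decay (t : R) : R := \int[lm]_(s in `[0, t]) decay s.

Lemma is_derive_int_b (t : R) : 0 < t -> is_derive t (1 : R) int_b (b t).
Proof.
move=> t0; have tt : t < t + 1 by rewrite ltrDl.
have [d1 d2] := continuous_FTC1_closed tt (b_integrable (t + 1)) t0 (continuous_b t0).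
by apply: DeriveDef; [exact: d1|rewrite -derive1E; exact: d2].
Qed.

Lemma int_b_within u : 0 < u -> {within `[0, u], continuous int_b}.
Proof.
by move=> u0; exact: parameterized_integral_continuous (ltW u0) (b_integrable u).
Qed.

Lemma int_b0 : int_b 0 = 0.
Proof. by rewrite /int_b set_itv1 Rintegral_set1. Qed.

Lemma cvg_int_b0 : int_b t @[t --> 0^'+] --> 0.
Proof.
have [_ h _] := (continuous_within_itvP _ ltr01).1 (int_b_within ltr01).
by rewrite int_b0 in h.
Qed.

Lemma decay_gt0 t : 0 < decay t. Proof. exact: expR_gt0. Qed.

Lemma is_derive_decay (t : R) : 0 < t -> is_derive t (1 : R) decay (- b t * decay t).
Proof.
move=> t0; have dB := is_deriveN (is_derive_int_b t0).
have := @is_derive1_comp _ expR (fun s => - int_b s) t _ _ (is_derive_expR _) dB.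
by rewrite mulrC.
Qed.

Lemma continuous_decay t : 0 < t -> {for t, continuous decay}.
Proof.
by move=> /is_derive_decay[d _]; apply/differentiable_continuous/derivable1_diffP.
Qed.

Lemma decay_within u : 0 < u -> {within `[0, u], continuous decay}.
Proof.
move=> u0; apply/(continuous_within_itvP _ u0); split.
- by move=> t; rewrite in_itv/= => /andP[t0 _]; exact: continuous_decay.
- apply: (cvg_comp _ _ (_ : - int_b t @[t --> 0^'+] --> - int_b 0)); last exact: continuous_expR.
  by apply: cvgN; rewrite int_b0; exact: cvg_int_b0.
- apply: cvg_at_left_filter; exact: continuous_decay.
Qed.

Lemma decay_integrable u : lm.-integrable `[0, u] (EFin \o decay).
Proof.
have h v : 0 < v -> lm.-integrable `[0, v] (EFin \o decay).
  by move=> v0; apply: continuous_compact_integrable; [exact: segment_compact|exact: decay_within].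
have u1 : 0 < `|u| + 1 by rewrite ltr_wpDl.
apply: integrableS (h _ u1) => //.
by apply: subset_itvl; rewrite bnd_simp (le_trans (ler_norm u))// lerDl.
Qed.

Lemma is_derive_int_decay (t : R) : 0 < t -> is_derive t (1 : R) int_decay (decay t).
Proof.
move=> t0; have tt : t < t + 1 by rewrite ltrDl.
have [d1 d2] := continuous_FTC1_closed tt (decay_integrable (t + 1)) t0 (continuous_decay t0).
by apply: DeriveDef; [exact: d1|rewrite -derive1E; exact: d2].
Qed.

Lemma int_decay_within u : 0 < u -> {within `[0, u], continuous int_decay}.
Proof.
by move=> u0; exact: parameterized_integral_continuous (ltW u0) (decay_integrable u).
Qed.

Lemma int_decay0 : int_decay 0 = 0.
Proof. by rewrite /int_decay set_itv1 Rintegral_set1. Qed.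

Lemma cvg_int_decay0 : int_decay t @[t --> 0^'+] --> int_decay 0.
Proof. by have [_ ? _] := (continuous_within_itvP _ ltr01).1 (int_decay_within ltr01). Qed.

Lemma int_decay_ndecr : nondecreasing_fun int_decay.
Proof.
have J0 t : 0 <= int_decay t by apply: Rintegral_ge0 => s _; exact/ltW/decay_gt0.
have JN t : t < 0 -> int_decay t = 0.
  by move=> t0; rewrite /int_decay set_itv_ge ?Rintegral_set0// bnd_simp -ltNge.
move=> x y xy; have [x0|x0] := ltP x 0; first by rewrite JN.
have [y0|y0] := leP y 0; first by have -> : x = y by lra.
apply: (@ger0_derive1_ndecr _ int_decay 0 y) => //.
- by move=> t; rewrite in_itv/= => /andP[t0 _]; have [] := is_derive_int_decay t0.
- move=> t; rewrite in_itv/= => /andP[t0 _]; rewrite derive1E.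
  by have [_ ->] := is_derive_int_decay t0; exact/ltW/decay_gt0.
- exact: int_decay_within.
Qed.

(** [K (L + t)^beta] is a supersolution of [g' = b g - 1]. For [beta > 0] its
    derivative is positive; it is dominated by [b g] once the shift [L] makes
    [(L + t)^(beta - 1)] small. *)
Lemma barrier : exists K L M : R, [/\ 0 < K, 1 <= L, 0 < M,
  forall t, 0 < t -> K * (beta * (L + t) `^ (beta - 1)) - b t * (K * (L + t) `^ beta) <= -1 &
  forall t, 0 < t -> K * (L + t) `^ beta <= M * rate t].
Proof.
have [c c0 hc] := b_lower; have /andP[bN1 blt1] := beta_itv.
have [b0|b0] := leP beta 0.
  exists c^-1, 1, c^-1; split; rewrite ?invr_gt0// => t t0.
  have := hc _ (ltW t0); rewrite -/(rate t) => h.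
  have : 1 <= b t * (c^-1 * rate t).
    by rewrite mulrCA ler_pdivlMl// mulr1.
  have : beta * (1 + t) `^ (beta - 1) <= 0 by rewrite mulr_le0_ge0// powR_ge0.
  have ci : 0 < c^-1 by rewrite invr_gt0.
  by nra.
(* The shift for which [(L + t)^(beta - 1)] is at most [c / 2]. *)
pose L := Num.max 1 ((c / 2) `^ (beta - 1)^-1).
have L1 : 1 <= L by rewrite le_max lexx.
have L0 : 0 < L by rewrite (lt_le_trans ltr01).
have c20 : 0 < c / 2 by rewrite divr_gt0.
have hL t : 0 < t -> (L + t) `^ (beta - 1) <= c / 2.
  move=> t0; rewrite -opprB powRN -[leRHS]invrK lef_pV2 ?posrE ?invr_gt0 ?powR_gt0 ?addr_gt0//.
  have -> : (c / 2)^-1 = ((c / 2) `^ (beta - 1)^-1) `^ (1 - beta).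
    have e : (beta - 1)^-1 * (1 - beta) = -1.
      by field; rewrite subr_eq0 lt_eqF.
    by rewrite -powRrM e powR_inv1// ltW.
  apply: ge0_ler_powR; rewrite ?nnegrE ?subr_ge0 ?powR_ge0 ?addr_ge0 ?(ltW L0) ?(ltW t0) ?(ltW blt1)//.
  by rewrite (@le_trans _ _ L)// ?lerDl ?(ltW t0)// le_max lexx orbT.
have K0 : 0 < 2 / c by rewrite divr_gt0.
exists (2 / c), L, (2 / c * L `^ beta); split => //.
- by rewrite mulr_gt0// powR_gt0.
- move=> t t0; have h1 := hL t t0.
  have h2 : c <= b t * (L + t) `^ beta.
    apply: (le_trans (hc _ (ltW t0))); rewrite ler_wpM2l//; first exact/ltW/b_gt0/ltW.
    by rewrite ge0_ler_powR ?nnegrE ?addr_ge0 ?(ltW L0) ?(ltW t0) ?(ltW b0)// lerD2r.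
  have h3 : beta * (L + t) `^ (beta - 1) <= c / 2.
    by rewrite (le_trans _ h1)// ler_piMl ?powR_ge0// ltW.
  rewrite [b t * _]mulrCA -mulrBr.
  apply: (@le_trans _ _ (2 / c * (c / 2 - c))); first by rewrite ler_wpM2l ?(ltW K0)// lerB.
  rewrite le_eqVlt; apply/orP; left; apply/eqP; field.
  by rewrite gt_eqF.
- move=> t t0; rewrite -[leRHS]mulrA; apply: ler_wpM2l; first exact: ltW.
  rewrite /rate -powRM ?(ltW L0) ?addr_ge0 ?(ltW t0)//.
  rewrite ge0_ler_powR ?nnegrE ?(ltW b0) ?mulr_ge0 ?addr_ge0 ?(ltW L0) ?(ltW t0)//.
  by nra.
Qed.

(** [int_decay + decay * (K (L + t)^beta)] is nonincreasing for a supersolution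
    [K (L + t)^beta]: the tail of [int_decay] is controlled by the barrier. *)
Lemma int_decay_le K L t T : (forall s, 0 < s -> 0 < L + s) ->
  (forall s, 0 < s -> K * (beta * (L + s) `^ (beta - 1)) - b s * (K * (L + s) `^ beta) <= -1) ->
  0 <= K -> 0 < t -> int_decay T <= int_decay t + decay t * (K * (L + t) `^ beta).
Proof.
move=> L0 hK K0 t0.
have G0 s : 0 <= decay s * (K * (L + s) `^ beta).
  by rewrite mulr_ge0 ?(ltW (decay_gt0 s))// mulr_ge0// powR_ge0.
have [tT|/ltW Tt] := leP t T; last by rewrite (le_trans (int_decay_ndecr Tt))// lerDl.
apply: (@le_trans _ _ (int_decay T + decay T * (K * (L + T) `^ beta))); first by rewrite lerDl.
apply: (@nincr_is_derive _ (fun s => int_decay s + decay s * (K * (L + s) `^ beta))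
  (fun s => decay s * (1 + (K * (beta * (L + s) `^ (beta - 1)) - b s * (K * (L + s) `^ beta)))) t T) => //.
- move=> s /andP[ts _]; have s0 : 0 < s := lt_le_trans t0 ts.
  have dK : is_derive s (1 : R) (fun s => K * (L + s) `^ beta) (K * (beta * (L + s) `^ (beta - 1))) :=
    is_deriveZ K (is_derive_powR_shift beta (L0 s s0)).
  refine (is_derive_eq (is_deriveD (is_derive_int_decay s0) (is_deriveM (is_derive_decay s0) dK)) _).
  by rewrite /GRing.scale/=; ring.
- move=> s /andP[ts _]; have s0 : 0 < s := lt_le_trans t0 ts.
  rewrite pmulr_rle0 ?decay_gt0//; have := hK s s0; lra.
Qed.

(** [int_decay] is monotone and bounded by the barrier; the integral over the
    half-line is then the limit. *)
Lemma bstar_cvg : int_decay t @[t --> +oo] --> bstar b.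
Proof.
have [K [L [M [K0 L1 _ hK _]]]] := barrier.
have L0 s : 0 < s -> 0 < L + s by move=> s0; rewrite addr_gt0// (lt_le_trans ltr01).
have ub : has_ubound (range int_decay).
  exists (int_decay 1 + decay 1 * (K * (L + 1) `^ beta)) => _ [T _ <-].
  by apply: int_decay_le => //; exact: ltW.
have cJ := nondecreasing_cvgr int_decay_ndecr ub.
suff <- : sup (range int_decay) = bstar b by [].
rewrite /bstar (@Rintegral_ge0_continuous_FTC2y _ decay int_decay 0 (sup (range int_decay))).
- by rewrite int_decay0 subr0.
- by move=> t _; exact/ltW/decay_gt0.
- apply/continuous_within_itvcyP; split.
    by move=> t; rewrite in_itv/= andbT => t0; exact: continuous_decay.
  by have [_ ? _] := (continuous_within_itvP _ ltr01).1 (decay_within ltr01).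
- exact: cJ.
- by move=> t t0; have [] := is_derive_int_decay t0.
- exact: cvg_int_decay0.
- by move=> t; rewrite in_itv/= andbT => t0; rewrite derive1E; have [_ ->] := is_derive_int_decay t0.
Qed.

Lemma int_decay_le_bstar t : int_decay t <= bstar b.
Proof.
rewrite -(cvg_lim _ bstar_cvg)//; apply: limr_ge.
  by apply/cvg_ex; eexists; exact: bstar_cvg.
by near=> T; apply: int_decay_ndecr; near: T; apply: nbhs_pinfty_ge; exact: num_real.
Unshelve. all: by end_near. Qed.

(** The solution of [g' = b g - 1] that does not grow exponentially; its value
    at the origin is [bstar b]. Since
    [(g u_t + u)_t = g (u_tt + b u_t)], multiplication by [g] puts the damped
    wave equation in divergence form. *)
Definition weight (t : R) : R := (bstar b - int_decay t) / decay t.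

Lemma is_derive_weight (t : R) : 0 < t -> is_derive t (1 : R) weight (b t * weight t - 1).
Proof.
move=> t0; have e0 := decay_gt0 t; have en0 : decay t != 0 by rewrite gt_eqF.
have d1 : is_derive t (1 : R) (fun s => bstar b - int_decay s) (0 - decay t) :=
  is_deriveB (is_derive_cst (bstar b) t 1) (is_derive_int_decay t0).
have d2 := is_deriveV en0 (is_derive_decay t0).
refine (is_derive_eq (is_deriveM d1 d2) _).
rewrite /weight /GRing.scale/=; field.
by [].
Qed.

Lemma weight_ge0 t : 0 <= weight t.
Proof. by rewrite divr_ge0 ?(ltW (decay_gt0 t))// subr_ge0 int_decay_le_bstar. Qed.

Lemma cvg_weight0 : weight t @[t --> 0^'+] --> bstar b.
Proof.
have c1 : decay t @[t --> 0^'+] --> (1 : R).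
  have [_ h _] := (continuous_within_itvP _ ltr01).1 (decay_within ltr01).
  by rewrite /decay int_b0 oppr0 expR0 in h.
have -> : bstar b = (bstar b - int_decay 0) / 1 by rewrite int_decay0 subr0 divr1.
apply: cvgM; first by apply: cvgB; [exact: cvg_cst|exact: cvg_int_decay0].
by apply: cvgV => //; rewrite oner_eq0.
Qed.

Lemma weight_upper : exists2 M, 0 < M & forall t, 0 < t -> weight t <= M * rate t.
Proof.
have [K [L [M [K0 L1 M0 hK hM]]]] := barrier.
have L0 s : 0 < s -> 0 < L + s by move=> s0; rewrite addr_gt0// (lt_le_trans ltr01).
exists M => // t t0; apply: le_trans (hM t t0).
rewrite /weight ler_pdivrMr ?decay_gt0// lerBlDl mulrC.
rewrite -(cvg_lim _ bstar_cvg)//; apply: limr_le; first by apply/cvg_ex; eexists; exact: bstar_cvg.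
by apply: nearW => T; apply: int_decay_le => //; exact: ltW.
Qed.

(** Otherwise [D = g - m (1 + t)^beta], negative at some time, stays negative
    because [D' = b D + r] with [r <= - 1/2] for small [m]; it then decreases at
    a rate of at least [1 / 2], faster than [- m (1 + t)^beta], against [0 <= g]. *)
Lemma weight_lower : exists2 m, 0 < m & forall t, 0 < t -> m * rate t <= weight t.
Proof.
have arith (x1 x2 w y z t : R) : x1 < 0 -> 0 <= w -> y <= 1 / 4 * (1 + z) ->
    x2 = w - y -> z = 1 + 2 * t -> x2 + z / 2 <= x1 + t / 2 -> False by lra.
have [c c0 hc] := b_upper; have /andP[bN1 blt1] := beta_itv.
pose m := Num.min (1 / 4) (1 / (2 * (c + 1))).
have c1 : 0 < 2 * (c + 1) by rewrite mulr_gt0// addr_gt0.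
have m0 : 0 < m by rewrite lt_min !divr_gt0.
have m4 : m <= 1 / 4 by rewrite ge_min lexx.
have mc : m * (c + 1) <= 1 / 2.
  have : m <= 1 / (2 * (c + 1)) by rewrite ge_min lexx orbT.
  by rewrite ler_pdivlMr//; lra.
exists m => // t1 t10; rewrite leNgt; apply/negP => ht1.
pose D s := weight s - m * rate s.
pose dD s := b s * D s + (m * (b s * rate s) - 1 - m * (beta * (1 + s) `^ (beta - 1))).
have hdD (s : R) : 0 < s -> is_derive s (1 : R) D (dD s).
  move=> s0; have s1 : 0 < 1 + s by rewrite addr_gt0.
  have dm : is_derive s (1 : R) (fun s => m * rate s) (m * (beta * (1 + s) `^ (beta - 1))) :=
    is_deriveZ m (is_derive_powR_shift beta s1).
  refine (is_derive_eq (is_deriveB (is_derive_weight s0) dm) _).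
  by rewrite /dD /D /rate /GRing.scale/=; ring.
have rest s : 0 < s -> m * (b s * rate s) - 1 - m * (beta * (1 + s) `^ (beta - 1)) <= - (1 / 2).
  move=> s0; have h1 := hc s (ltW s0).
  have p0 := powR_ge0 (1 + s) (beta - 1).
  have p1 : (1 + s) `^ (beta - 1) <= 1.
    rewrite -[leRHS](powRr0 (1 + s)) ler_powR ?lerDl ?ltW//; lra.
  have h2 : -1 <= beta * (1 + s) `^ (beta - 1) by nra.
  by nra.
have Dneg s : t1 <= s -> D s < 0.
  move=> ts; have : decay s * D s <= decay t1 * D t1.
    apply: (@nincr_is_derive _ (fun s => decay s * D s) (fun s => decay s * (dD s - b s * D s)) t1 s) => //.
    - move=> y /andP[ty _]; have y0 := lt_le_trans t10 ty.
      refine (is_derive_eq (is_deriveM (is_derive_decay y0) (hdD y y0)) _).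
      by rewrite /GRing.scale/=; ring.
    - move=> y /andP[ty _]; have y0 := lt_le_trans t10 ty.
      rewrite pmulr_rle0 ?decay_gt0// /dD addrAC subrr add0r (le_trans (rest y y0))//; lra.
  have : decay t1 * D t1 < 0 by rewrite pmulr_rlt0 ?decay_gt0// subr_lt0.
  move=> h1 h2; have := le_lt_trans h2 h1; by rewrite pmulr_rlt0 ?decay_gt0.
(* Over [t1, t2] the linear decrease overtakes the size of [m (1 + t)^beta]. *)
pose t2 := 1 + 2 * t1.
have t12 : t1 <= t2 by rewrite /t2; lra.
have : D t2 + t2 / 2 <= D t1 + t1 / 2.
  apply: (@nincr_is_derive _ (fun s => D s + s / 2) (fun s => dD s + 1 / 2) t1 t2) => //.
  - move=> y /andP[ty _]; have y0 := lt_le_trans t10 ty.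
    refine (is_derive_eq (is_deriveD (hdD y y0) (is_deriveM (is_derive_id y 1) (is_derive_cst (2^-1 : R) y 1))) _).
    by rewrite /GRing.scale/=; ring.
  - move=> y /andP[ty _]; have y0 := lt_le_trans t10 ty.
    have := rest y y0; have := Dneg y ty; have := b_gt0 (ltW y0).
    rewrite /dD; nra.
have D1 : D t1 < 0 by exact: Dneg.
have g2 := weight_ge0 t2.
have t20 : 0 <= t2 by rewrite (le_trans (ltW t10)).
have q2 := rate_le t20; have q20 := rate_gt0 t20.
have hm : m * rate t2 <= 1 / 4 * (1 + t2).
  apply: (le_trans (ler_wpM2l (ltW m0) q2)); apply: ler_wpM2r => //.
  exact: addr_ge0.
have D2 : D t2 = weight t2 - m * rate t2 by [].
have t2E : t2 = 1 + 2 * t1 by [].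
exact: arith D1 g2 hm D2 t2E.
Qed.

(** By its equation, the derivative of the weight is [b g - 1]. *)
Lemma weight_derive_bounded : exists2 G, 0 < G & forall t, 0 < t -> `|b t * weight t - 1| <= G.
Proof.
have [c c0 hc] := b_upper; have [M M0 hM] := weight_upper.
exists (1 + c * M); first by rewrite addr_gt0// mulr_gt0.
move=> t t0; have b0 := b_gt0 (ltW t0); have q0 := rate_gt0 (ltW t0).
have h1 : b t * weight t <= c * M.
  apply: (@le_trans _ _ (b t * (M * rate t))); first by apply: ler_wpM2l; [exact: ltW|exact: hM].
  by rewrite mulrCA [c * _]mulrC; apply: ler_wpM2l; [exact: ltW|exact/hc/ltW].
have h2 : 0 <= b t * weight t by apply: mulr_ge0; [exact: ltW|exact: weight_ge0].
rewrite ler_norml; apply/andP; split; lra.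
Qed.

End damping_weight.

(** * Cutoffs and the Young inequality *)

Section cutoff.
Context {R : realType}.
Implicit Types (n k : nat) (s t : R).

Definition cutoff n s : R := bump s ^+ n.+2.

Lemma smooth1_cutoff n : smooth1 (cutoff n).
Proof. exact: smooth1X smooth1_bump. Qed.

Lemma cutoff_ge0 n s : 0 <= cutoff n s.
Proof. by rewrite exprn_ge0// bump_ge0. Qed.

Lemma cutoff_le_bumpX n s : cutoff n s <= bump s ^+ n.
Proof. by rewrite /cutoff -addn2 exprD ler_piMr ?exprn_ge0 ?bump_ge0// exprn_ile1 ?bump_ge0 ?bump_le1. Qed.

Lemma cutoff1 n s : `|s| <= 1 -> cutoff n s = 1.
Proof. by move=> s1; rewrite /cutoff bump1// expr1n. Qed.

Lemma cutoff0 n s : 2 <= `|s| -> cutoff n s = 0.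
Proof. by move=> s2; rewrite /cutoff bump0// expr0n. Qed.

Lemma derive1_cutoff_in n s : `|s| < 1 -> derive1 (cutoff n) s = 0.
Proof.
by apply: (@derive1_cst_in _ _ 1) => y /ltW; exact: cutoff1.
Qed.

Lemma derive2_cutoff_in n s : `|s| < 1 -> derive1 (derive1 (cutoff n)) s = 0.
Proof.
by apply: (@derive1_cst_in _ _ 0) => y; exact: derive1_cutoff_in.
Qed.

Lemma is_derive_bump s : is_derive s (1 : R) bump (derive1 bump s).
Proof. by rewrite derive1E; apply: derivableP; exact: smooth1_derivable smooth1_bump. Qed.

Lemma derive1_cutoff n : derive1 (cutoff n) = (fun s => n.+2%:R * bump s ^+ n.+1 * derive1 bump s).
Proof.
apply/funext => s; rewrite derive1E.
have := is_deriveX n.+2 (is_derive_bump s); rewrite exprfctE => -[_ h].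
by rewrite [LHS]h /GRing.scale/=.
Qed.

Lemma derive2_cutoff n : derive1 (derive1 (cutoff n)) = (fun s =>
  n.+2%:R * (n.+1%:R * bump s ^+ n * derive1 bump s ^+ 2 + bump s ^+ n.+1 * derive1 (derive1 bump) s)).
Proof.
apply/funext => s; rewrite derive1_cutoff derive1E.
have := is_deriveX n.+1 (is_derive_bump s); rewrite exprfctE => d1.
have d2 : is_derive s (1 : R) (derive1 bump) (derive1 (derive1 bump) s).
  by rewrite derive1E; apply: derivableP; apply: smooth1_derivable; exact: smooth1_derive smooth1_bump.
have d3 := is_deriveZ (n.+2%:R : R) (is_deriveM d1 d2).
have E : (fun s => n.+2%:R * bump s ^+ n.+1 * derive1 bump s) =
    (fun s => n.+2%:R * (bump s ^+ n.+1 * derive1 bump s)).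
  by apply/funext => y; rewrite mulrA.
rewrite E; have [_ h] := d3; rewrite [LHS]h /GRing.scale/=; ring.
Qed.

(** The exponent [n + 2] of the cutoff leaves [bump^n] after two
    differentiations, and [bump^n] raised to the Fujita exponent is the cutoff
    again: this is what lets the Young inequality close. *)
Lemma cutoff_derive_bounded n : exists2 C : R, 0 < C & forall s,
  `|derive1 (cutoff n) s| <= C * bump s ^+ n /\
  `|derive1 (derive1 (cutoff n)) s| <= C * bump s ^+ n.
Proof.
have [M hM] := @derive1_bump_bounded R.
have M0 : 0 <= M by have [h _] := hM 0; exact: le_trans h.
pose N := M + 1.
have N1 : 1 <= N by rewrite lerDr.
have hN s : `|derive1 bump s| <= N /\ `|derive1 (derive1 bump) s| <= N.
  by have [h1 h2] := hM s; split; [apply: (le_trans h1)|apply: (le_trans h2)]; rewrite lerDl.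
exists (n.+2%:R * (n.+1%:R + 1) * N ^+ 2).
  apply: mulr_gt0; last by rewrite exprn_gt0// (lt_le_trans ltr01).
  by apply: mulr_gt0 => //; apply: addr_gt0.
move=> s; have [h1 h2] := hN s.
have b0 : 0 <= bump s ^+ n by rewrite exprn_ge0 ?bump_ge0.
have b1 : 0 <= bump s ^+ n.+1 by rewrite exprn_ge0 ?bump_ge0.
have b01 : bump s ^+ n.+1 <= bump s ^+ n by rewrite exprS ler_piMl ?bump_le1.
have NN : N <= N ^+ 2 by rewrite expr2 ler_peMl// (le_trans ler01).
have c1 : 1 <= n.+1%:R + 1 :> R by rewrite lerDr.
have N20 : 0 <= N ^+ 2 by exact: sqr_ge0.
set X := bump s ^+ n in b0 b01 *.
have -> : n.+2%:R * (n.+1%:R + 1) * N ^+ 2 * X = n.+2%:R * ((n.+1%:R + 1) * (X * N ^+ 2)) by ring.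
rewrite derive2_cutoff derive1_cutoff; split.
  rewrite -mulrA normrM normr_nat; apply: ler_wpM2l => //.
  rewrite normrM (ger0_norm b1); apply: (@le_trans _ _ (X * N ^+ 2)).
    by apply: ler_pM => //; exact: le_trans NN.
  by rewrite ler_peMl// mulr_ge0.
rewrite normrM normr_nat; apply: ler_wpM2l => //.
rewrite [leRHS]mulrDl mul1r; apply: (le_trans (ler_normD _ _)); apply: lerD.
  have d2 : `|derive1 bump s ^+ 2| <= N ^+ 2.
    by rewrite normrX lerXn2r// nnegrE (le_trans _ N1).
  rewrite -/X normrM normrM normr_nat (ger0_norm b0) -mulrA; apply: ler_wpM2l => //.
  exact: ler_wpM2l.
rewrite normrM (ger0_norm b1); apply: ler_pM => //.
exact: le_trans NN.
Qed.

(** The bump is 1 on the unit interval, which contains the support of its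
    contraction. *)
Lemma bump_double s : bump (2 * s) <= bump s.
Proof.
have [s2|s2] := leP 2 `|2 * s|; first by rewrite bump0// bump_ge0.
by rewrite [leRHS]bump1 ?bump_le1//; move: s2; rewrite normrM ger0_norm//; lra.
Qed.

Lemma bump_quadruple s : bump (4 * s) <= bump s.
Proof.
have -> : 4 * s = 2 * (2 * s) by ring.
exact: le_trans (bump_double _) (bump_double _).
Qed.

End cutoff.

Section young.
Context {R : realType}.

Lemma young (p p' a c l : R) : 1 < p -> 1 < p' -> p^-1 + p'^-1 = 1 ->
  0 <= a -> 0 <= c -> 0 < l -> a * c <= l `^ p * a `^ p + l `^ (- p') * c `^ p'.
Proof.
move=> p1 p'1 pp a0 c0 l0.
have p0 := lt_trans ltr01 p1; have p'0 := lt_trans ltr01 p'1.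
have := @conjugate_powR R (l * a) (l^-1 * c) p p'.
have -> : l * a * (l^-1 * c) = a * c by field; rewrite gt_eqF.
rewrite !powRM ?(ltW l0) ?invr_ge0 ?(ltW l0)// => h.
apply: (le_trans (h _ _ _ _ _)) => //; rewrite ?mulr_ge0 ?invr_ge0 ?(ltW l0)//.
have -> : l^-1 `^ p' = l `^ (- p') by rewrite -powR_inv1 ?ltW// -powRrM mulN1r.
apply: lerD.
  by rewrite ler_pdivrMr// ler_peMr ?(ltW p1)// mulr_ge0 ?powR_ge0.
by rewrite ler_pdivrMr// ler_peMr ?(ltW p'1)// mulr_ge0 ?powR_ge0.
Qed.

End young.

(** * Dyadic cutoffs in space *)

Section space_cutoff.
Context {R : realType} {n : nat}.
Hypothesis n_gt0 : (0 < n)%N.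
Local Notation mu := (lebesgue_rV R n).
Implicit Types (x : 'rV[R]_n) (k : nat).

Definition space_factors k : 'I_n -> R -> R := fun=> fun t => cutoff n (2 ^- k * t).

(** The cutoff [phi k] without its exponent [n + 2]; see [phiE]. *)
Definition profile k x : R := \prod_(i < n) bump (2 ^- k * x ord0 i).

Definition phi k : 'rV[R]_n -> R := tensor (space_factors k).

Lemma is_derive_scale (f : R -> R) (c t : R) : smooth1 f ->
  is_derive t (1 : R) (fun t => f (c * t)) (c * derive1 f (c * t)).
Proof.
move=> sf.
have d1 : is_derive t (1 : R) (fun t => c * t) (c *: 1) := is_deriveZ c (is_derive_id t 1).
have d2 : is_derive (c * t) (1 : R) f (derive1 f (c * t)).
  by rewrite derive1E; apply: derivableP; exact: smooth1_derivable.
refine (is_derive_eq (@is_derive1_comp _ f (fun t => c * t) t _ _ d2 d1) _).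
by rewrite /GRing.scale/= mulr1 mulrC.
Qed.

Lemma derive1_scale (f : R -> R) (c : R) : smooth1 f ->
  derive1 (fun t => f (c * t)) = (fun t => c * derive1 f (c * t)).
Proof.
move=> sf; apply/funext => t; rewrite derive1E.
by have [_ ->] := is_derive_scale c t sf.
Qed.

Lemma smooth_space_factors k : smooth_factors (space_factors k).
Proof. by move=> i; apply: smooth1_scale; exact: smooth1_cutoff. Qed.

Lemma pow2_gt0 k : 0 < 2 ^+ k :> R. Proof. by rewrite exprn_gt0. Qed.

Lemma supported_space_factors k : supported (2 * 2 ^+ k) (space_factors k).
Proof.
move=> i t kt; rewrite /space_factors cutoff0// normrM ger0_norm ?invr_ge0 ?(ltW (pow2_gt0 k))//.
by rewrite ler_pdivlMl ?pow2_gt0// mulrC ltW.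
Qed.

Lemma radius_ge0 k : 0 <= 2 * 2 ^+ k :> R.
Proof. by rewrite mulr_ge0// ltW// pow2_gt0. Qed.

Lemma phiE k x : phi k x = profile k x ^+ n.+2.
Proof. by rewrite /phi /tensor /space_factors /cutoff prodrXl. Qed.

Lemma profile01 k x : 0 <= profile k x <= 1.
Proof.
rewrite /profile prodr_ge0 => [|i _]; last exact: bump_ge0.
by apply: prodr_ile1 => i _; rewrite bump_ge0 bump_le1.
Qed.

Lemma profile0 k x : ~ cube (2 * 2 ^+ k) x -> profile k x = 0.
Proof.
move=> /existsNP[i /negP]; rewrite -ltNge => ki.
rewrite /profile (bigD1 i)//= bump0 ?mul0r// normrM ger0_norm ?invr_ge0 ?(ltW (pow2_gt0 k))//.
by rewrite ler_pdivlMl ?pow2_gt0// mulrC ltW.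
Qed.

Lemma phi_ge0 k x : 0 <= phi k x.
Proof. by rewrite phiE exprn_ge0//; have /andP[] := profile01 k x. Qed.

Lemma phi_le1 k x : phi k x <= 1.
Proof. by have /andP[h1 h2] := profile01 k x; rewrite phiE exprn_ile1. Qed.

Lemma half_pow k (t : R) : 2 ^- k * t = 2 * (2 ^- k.+1 * t).
Proof. by rewrite exprS invfM mulrA mulrA divff ?mul1r. Qed.

Lemma phi_le_succ k x : phi k x <= phi k.+1 x.
Proof.
rewrite !phiE; have /andP[h1 _] := profile01 k x; have /andP[h2 _] := profile01 k.+1 x.
rewrite lerXn2r ?nnegrE//; apply: ler_prod => i _.
by rewrite bump_ge0/= half_pow bump_double.
Qed.

(** The support of [phi k] lies where the second derivatives of [phi k.+1]
    vanish, see [phi2_0]: this puts the errors on disjoint dyadic shells. *)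
Lemma phi0 k x i : 1 <= `|2 ^- k.+1 * x ord0 i| -> phi k x = 0.
Proof.
move=> h; rewrite phiE /profile (bigD1 i)//= bump0 ?mul0r ?expr0n//.
by rewrite half_pow normrM ger0_norm//; lra.
Qed.

Lemma phi1 k x : cube (2 ^+ k) x -> phi k x = 1.
Proof.
move=> kx; rewrite phiE /profile big1 ?expr1n// => i _; rewrite bump1//.
rewrite normrM ger0_norm ?invr_ge0 ?(ltW (pow2_gt0 k))//.
by rewrite ler_pdivrMl ?pow2_gt0// mulr1.
Qed.

(** The second derivative of [phi k] in the direction [i]. *)
Definition phi2 k i : 'rV[R]_n -> R := tensor (dfactor i (dfactor i (space_factors k))).

Lemma phi2E k i x : phi2 k i x =
  (2 ^- k) ^+ 2 * derive1 (derive1 (cutoff n)) (2 ^- k * x ord0 i) *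
  \prod_(j < n | j != i) cutoff n (2 ^- k * x ord0 j).
Proof.
rewrite /phi2 /tensor (bigD1 i)//= /dfactor eqxx; congr (_ * _).
  rewrite /space_factors derive1_scale; last exact: smooth1_cutoff.
  rewrite derive1E.
  have d := is_derive_scale (2 ^- k) (x ord0 i) (smooth1_derive (@smooth1_cutoff R n)).
  have [_ h] := is_deriveZ (2 ^- k : R) d.
  by rewrite [LHS]h /GRing.scale/= mulrA -expr2.
by apply: eq_bigr => j /negbTE ->.
Qed.

Lemma phi2_bound : exists2 C : R, 0 < C & forall k i x,
  `|phi2 k i x| <= C * (2 ^- k) ^+ 2 * profile k x ^+ n.
Proof.
have [C C0 hC] := @cutoff_derive_bounded R n; exists C => // k i x.
have [_ h] := hC (2 ^- k * x ord0 i).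
rewrite phi2E normrM normrM (ger0_norm (sqr_ge0 _)) /profile -prodrXl.
rewrite [X in _ <= _ * X](bigD1 i)//=.
rewrite -[leRHS]mulrA [leRHS]mulrCA -[leLHS]mulrA; apply: ler_wpM2l; first exact: sqr_ge0.
rewrite [leRHS]mulrA; apply: ler_pM => //.
rewrite normr_prod; apply: ler_prod => j _; rewrite normr_ge0/=.
by rewrite ger0_norm ?cutoff_ge0// cutoff_le_bumpX.
Qed.

Lemma phi2_0 k i x : `|2 ^- k * x ord0 i| < 1 -> phi2 k i x = 0.
Proof. by move=> h; rewrite phi2E derive2_cutoff_in// mulr0 mul0r. Qed.

Lemma L2_phi k : L2 R n (phi k).
Proof. exact: L2_tensor (radius_ge0 k) (smooth_space_factors k) (supported_space_factors (k:=k)). Qed.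

Lemma L2_phi2 k i : L2 R n (phi2 k i).
Proof.
apply: (L2_tensor (radius_ge0 k)); first by do 2 apply: smooth_dfactor; exact: smooth_space_factors.
by do 2 apply: supported_dfactor; exact: supported_space_factors.
Qed.

Let p : R := fujita n.
Let p' : R := n.+2%:R / 2.

Let nR_gt0 : 0 < n%:R :> R. Proof. by rewrite ltr0n. Qed.

Lemma fujita_gt1 : 1 < p.
Proof. by rewrite /p /fujita ltrDl divr_gt0. Qed.

Lemma conj_gt1 : 1 < p'.
Proof. by rewrite /p' ltr_pdivlMr// mul1r ltr_nat ltnS. Qed.

Lemma fujita_conj : p^-1 + p'^-1 = 1.
Proof.
rewrite /p /p' /fujita -[n.+2]addn2 natrD; field.
rewrite gt_eqF//= gt_eqF ?addr_gt0//.
Qed.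

Lemma powR_fujita (y : R) : 0 <= y -> (y ^+ n) `^ p = y ^+ n.+2.
Proof.
move=> y0; rewrite -!powR_mulrn// -powRrM; congr (_ `^ _).
rewrite /p /fujita mulrDr mulr1 mulrCA divff ?gt_eqF// mulr1 -natrD addn2//.
Qed.

(** The criticality of the exponent: the remainder of the Young inequality,
    integrated over the support of the cutoff, is a fixed multiple of the inverse of the
    time scale. *)
Lemma volume_balance k : (((2 ^- k) ^+ 2) `^ p') * (2 * (2 * 2 ^+ k)) ^+ n = 4 ^+ n * (2 ^- k) ^+ 2 :> R.
Proof.
have k0 := pow2_gt0 k; have ik0 : 0 <= 2 ^- k :> R by rewrite invr_ge0 ltW.
have -> : ((2 ^- k) ^+ 2) `^ p' = (2 ^- k) ^+ n.+2 :> R.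
  move: ik0; move: (2 ^- k) => y y0.
  rewrite -(powR_mulrn 2 y0) -(powR_mulrn n.+2 y0) -powRrM; congr (_ `^ _).
  by rewrite /p'; field.
have -> : 2 * (2 * 2 ^+ k) = 4 * 2 ^+ k :> R by ring.
rewrite -[n.+2]addn2 exprD exprMn mulrCA; congr (_ * _).
by rewrite mulrAC -exprMn mulVf ?expr1n ?mul1r// gt_eqF.
Qed.

End space_cutoff.

(** * The space estimate at the critical exponent *)

Section space_pairing_bound.
Context {R : realType} {n : nat}.
Hypothesis n_gt0 : (0 < n)%N.
Local Notation mu := (lebesgue_rV R n).
Local Notation p := (fujita n : R).
Local Notation p' := (n.+2%:R / 2 : R).

Definition nonlin (u : 'rV[R]_n -> R) k : R := \int[mu]_x (`|u x| `^ p * phi k x).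

(** The Young inequality with the factors [|u| (eta * profile)^n] and
    [2^(-2(k+1))]. At the Fujita exponent the first, to the power [p], is
    [|u|^p] times the full cutoff of index [k.+1]; the alternative on [z] allows
    the mass carried by the cutoff of index [k] to be subtracted. *)
Lemma space_pairing_bound (u z : 'rV[R]_n -> R) k (th0 eta kap l : R) :
  L2 R n u -> L2 R n z ->
  mu.-integrable setT (fun x => (`|u x| `^ p * phi k x)%:E) ->
  mu.-integrable setT (fun x => (`|u x| `^ p * phi k.+1 x)%:E) ->
  0 <= th0 -> 0 <= eta -> 0 <= kap -> 0 < l -> th0 <= eta ^+ n.+2 ->
  (forall x, `|z x| <= kap * (2 ^- k.+1) ^+ 2 * (eta * profile k.+1 x) ^+ n) ->
  (forall x, z x = 0 \/ th0 * phi k x = 0) ->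
  `|\int[mu]_x (u x * z x)| <=
  kap * (l `^ p * (eta ^+ n.+2 * nonlin u k.+1 - th0 * nonlin u k) +
         l `^ (- p') * (4 ^+ n * (2 ^- k.+1) ^+ 2)).
Proof.
move=> u2 z2 i0 i1 th00 eta0 kap0 l0 th01 hz dich.
set N := (2 ^- k.+1) ^+ 2; pose r : R := 2 * 2 ^+ k.+1.
have r0 : 0 <= r by exact: radius_ge0.
have N0 : 0 <= N by exact: sqr_ge0.
have mu2 := L2_measurable u2; have mz := L2_measurable z2.
pose G x := l `^ p * (eta ^+ n.+2 * (`|u x| `^ p * phi k.+1 x) - th0 * (`|u x| `^ p * phi k x)) +
   l `^ (- p') * N `^ p' * \1_(cube r) x.
have iuz : mu.-integrable setT (EFin \o (fun x => u x * z x)) by exact: L2_mul_integrable.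
have ia : mu.-integrable setT (EFin \o (fun x => eta ^+ n.+2 * (`|u x| `^ p * phi k.+1 x))).
  by apply: eq_integrable (integrableZl _ (eta ^+ n.+2) i1) => // x _; rewrite /= EFinM.
have ib : mu.-integrable setT (EFin \o (fun x => th0 * (`|u x| `^ p * phi k x))).
  by apply: eq_integrable (integrableZl _ th0 i0) => // x _; rewrite /= EFinM.
have iab : mu.-integrable setT (EFin \o (fun x => eta ^+ n.+2 * (`|u x| `^ p * phi k.+1 x) - th0 * (`|u x| `^ p * phi k x))).
  by apply: eq_integrable (integrableB _ ia ib) => // x _; rewrite /= EFinB.
have ic : mu.-integrable setT (EFin \o (\1_(cube r) : 'rV[R]_n -> R)).
  apply: (integrable_bounded_cube (M := 1) r0).
  - by apply: measurable_indic; exact: measurable_cube.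
  - by move=> x nx; rewrite indicE memNset.
  - by move=> x; rewrite indicE; case: (_ \in _); rewrite ?normr1 ?normr0.
have i1' : mu.-integrable setT (EFin \o (fun x => l `^ p * (eta ^+ n.+2 * (`|u x| `^ p * phi k.+1 x) - th0 * (`|u x| `^ p * phi k x)))).
  by apply: eq_integrable (integrableZl _ (l `^ p) iab) => // x _; rewrite /= EFinM.
have i2' : mu.-integrable setT (EFin \o (fun x => l `^ (- p') * N `^ p' * \1_(cube r) x)).
  by apply: eq_integrable (integrableZl _ (l `^ (- p') * N `^ p') ic) => // x _; rewrite /= EFinM.
have iG : mu.-integrable setT (EFin \o G).
  by apply: eq_integrable (integrableD _ i1' i2') => // x _; rewrite /= EFinD.
have ikG : mu.-integrable setT (EFin \o (fun x => kap * G x)).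
  by apply: eq_integrable (integrableZl _ kap iG) => // x _; rewrite /= EFinM.
have ptw x : `|u x * z x| <= kap * G x.
  rewrite normrM.
  have up0 := powR_ge0 `|u x| p.
  have f0 := phi_ge0 k x; have f1 := phi_ge0 k.+1 x.
  have mono : th0 * (`|u x| `^ p * phi k x) <= eta ^+ n.+2 * (`|u x| `^ p * phi k.+1 x).
    apply: ler_pM => //; first exact: mulr_ge0.
    by apply: ler_wpM2l => //; exact: phi_le_succ.
  have c0 : 0 <= l `^ (- p') * N `^ p' by rewrite mulr_ge0 ?powR_ge0.
  have [nx|nx] := pselect (cube r x); last first.
    have -> : z x = 0.
      apply/eqP; rewrite -normr_le0 (le_trans (hz x))// profile0// mulr0 expr0n.
      by rewrite gtn_eqF// mulr0.
    rewrite normr0 mulr0 mulr_ge0// addr_ge0//.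
      by rewrite mulr_ge0 ?powR_ge0// subr_ge0.
    by rewrite mulr_ge0.
  have [->|thz] := dich x.
    rewrite normr0 mulr0 mulr_ge0// addr_ge0//.
      by rewrite mulr_ge0 ?powR_ge0// subr_ge0.
    by rewrite mulr_ge0.
  apply: (@le_trans _ _ (kap * ((`|u x| * (eta * profile k.+1 x) ^+ n) * N))).
    rewrite [leRHS](_ : _ = `|u x| * (kap * N * (eta * profile k.+1 x) ^+ n)); last by ring.
    exact: ler_wpM2l.
  apply: ler_wpM2l => //; rewrite /G indicE mem_set// mulr1.
  have -> : th0 * (`|u x| `^ p * phi k x) = 0 by rewrite mulrCA thz mulr0.
  have e0 : 0 <= eta * profile k.+1 x.
    by rewrite mulr_ge0//; have /andP[] := profile01 k.+1 x.
  have a0 : 0 <= `|u x| * (eta * profile k.+1 x) ^+ n by rewrite mulr_ge0// exprn_ge0.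
  apply: (le_trans (young (fujita_gt1 n_gt0) (conj_gt1 n_gt0) (fujita_conj n_gt0) a0 N0 l0)).
  rewrite subr0 lerD2r; apply: ler_wpM2l; first exact: powR_ge0.
  rewrite powRM ?exprn_ge0// powR_fujita// exprMn -phiE.
  by rewrite mulrCA.
apply: (le_trans (le_normr_Rintegral measurableT iuz)).
apply: (@le_trans _ _ (\int[mu]_x (kap * G x))).
  by apply: le_Rintegral => //; exact: integrable_norm iuz.
rewrite RintegralZl//; apply: ler_wpM2l => //.
rewrite RintegralD// RintegralZl// RintegralB// !RintegralZl//.
rewrite le_eqVlt; apply/orP; left; apply/eqP; congr (_ + _).
rewrite -mulrA; congr (_ * _).
rewrite /Rintegral integral_indic ?setIT; [|exact: measurableT|exact: measurable_cube].
rewrite [X in fine X](lebesgue_cube n r0) /=.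
exact: volume_balance.
Qed.

End space_pairing_bound.

(** * The clock and the dyadic cutoffs in time *)

Section clock.
Context {R : realType}.
Variable beta : R.
Hypothesis beta_itv : -1 <= beta < 1.
Local Notation q := (rate beta).

(** An antiderivative of [(1 + t)^beta], to which the weight is comparable. In
    this variable the equation scales like the heat equation. *)
Definition clock (t : R) : R :=
  if beta == -1 then ln (1 + t) else ((1 + t) `^ (1 + beta) - 1) / (1 + beta).

Lemma clock0 : clock 0 = 0.
Proof. by rewrite /clock addr0 ln1 powR1 subrr mul0r; case: ifP. Qed.

Lemma is_derive_clock (t : R) : 0 <= t -> is_derive t (1 : R) clock (q t).
Proof.
move=> t0; have t1 : 0 < 1 + t by rewrite ltr_pwDl.
rewrite /clock /rate; case: (eqVneq beta (-1)) => [->|bn].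
  have d1 : is_derive t (1 : R) (fun s => 1 + s) (0 + 1).
    exact: (is_deriveD (is_derive_cst (1 : R) t 1) (is_derive_id t 1)).
  have := @is_derive1_comp _ (@ln R) (fun s => 1 + s) t _ _ (is_derive1_ln t1) d1.
  by rewrite add0r mulr1 powR_inv1// ltW.
have b1 : 1 + beta != 0 by rewrite addrC -[X in _ + X]opprK subr_eq0.
have d1 := is_deriveB (is_derive_powR_shift (1 + beta) t1) (is_derive_cst (1 : R) t 1).
have E : (fun s => ((1 + s) `^ (1 + beta) - 1) / (1 + beta)) =
    (fun s => (1 + beta)^-1 * ((1 + s) `^ (1 + beta) - 1)).
  by apply/funext => s; rewrite mulrC.
rewrite E.
refine (is_derive_eq (is_deriveZ ((1 + beta)^-1) d1) _).
by rewrite subr0 /GRing.scale/= mulrA mulVf// mul1r addrAC subrr add0r.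
Qed.

Lemma clock_ndecr s t : 0 <= s -> s <= t -> clock s <= clock t.
Proof.
move=> s0 st; apply: (@ndecr_is_derive _ _ q) => //.
- by move=> y /andP[sy _]; apply: is_derive_clock; exact: le_trans sy.
- by move=> y /andP[sy _]; apply/ltW/rate_gt0; exact: le_trans sy.
Qed.

Lemma clock_ge0 t : 0 <= t -> 0 <= clock t.
Proof. by move=> t0; rewrite -clock0; exact: clock_ndecr. Qed.

Definition drate (t : R) : R := beta * (1 + t) `^ (beta - 1).

Lemma is_derive_rate (t : R) : 0 <= t -> is_derive t (1 : R) q (drate t).
Proof. by move=> t0; apply: is_derive_powR_shift; rewrite ltr_pwDl. Qed.

Lemma drate_bound t : 0 <= t -> `|drate t| <= 1.
Proof.
move=> t0; have /andP[bN1 blt1] := beta_itv.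
have p0 := powR_ge0 (1 + t) (beta - 1).
have p1 : (1 + t) `^ (beta - 1) <= 1.
  by rewrite -[leRHS](powRr0 (1 + t)) ler_powR ?lerDl// subr_le0 ltW.
rewrite /drate normrM (ger0_norm p0) mulr_ile1// ler_norml bN1 ltW//.
Qed.

(** The derivative of the square of the rate is at most twice the rate, as
    [drate] is at most 1; this bounds the square of a first derivative of the
    time cutoff by what a second derivative allows. *)
Lemma rate_sqr_le t : 0 <= t -> q t ^+ 2 <= 1 + 2 * clock t.
Proof.
move=> t0; rewrite -lerBlDr.
have q0 : q 0 = 1 by rewrite /rate addr0 powR1.
have e : q 0 ^+ 2 - 2 * clock 0 = 1 by rewrite q0 clock0 expr1n mulr0 subr0.
rewrite -[leRHS]e.
apply: (@nincr_is_derive _ (fun s => q s ^+ 2 - 2 * clock s) (fun s => 2 * (q s * (drate s - 1)))) => //.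
- move=> s /andP[s0 _].
  have d2 := is_deriveX 2 (is_derive_rate s0); rewrite exprfctE in d2.
  have d3 : is_derive s (1 : R) (fun s => 2 * clock s) (2 * q s) := is_deriveZ 2 (is_derive_clock s0).
  refine (is_derive_eq (is_deriveB d2 d3) _).
  by rewrite /GRing.scale/=; ring.
- move=> s /andP[s0 _]; rewrite pmulr_rle0// pmulr_rle0 ?rate_gt0// subr_le0.
  exact: le_trans (ler_norm _) (drate_bound s0).
Qed.

Section time_cutoff.
Variable n : nat.
Hypothesis n_gt0 : (0 < n)%N.

(** Parabolic scaling: [4^k] units of the clock for [2^k] units of length. *)
Definition scale2 k : R := (2 ^- k) ^+ 2.

Lemma scale2_gt0 k : 0 < scale2 k.
Proof. by rewrite exprn_gt0// invr_gt0 exprn_gt0. Qed.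

Lemma scale2_le1 k : scale2 k <= 1.
Proof.
by rewrite exprn_ile1// ?invr_ge0 ?exprn_ge0// invf_le1 ?exprn_gt0// exprn_ege1// ler1n.
Qed.

Lemma scale2E k : scale2 k = (4 ^+ k)^-1.
Proof. by rewrite /scale2 exprVn -exprM mulnC exprM; congr (_ ^+ k)^-1; ring. Qed.

Lemma scale2S k : scale2 k = 4 * scale2 k.+1.
Proof.
have e : 2 ^- k.+1 = 2^-1 * 2 ^- k :> R by rewrite exprS invfM.
by rewrite /scale2 e; field.
Qed.

Definition tau k t : R := scale2 k * clock t.

(** The dyadic time cutoff and, in closed form, its first two derivatives. *)
Definition th k t : R := cutoff n (tau k t).
Definition dth k t : R := scale2 k * q t * derive1 (cutoff n) (tau k t).
Definition ddth k t : R := scale2 k * drate t * derive1 (cutoff n) (tau k t) +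
  (scale2 k * q t) ^+ 2 * derive1 (derive1 (cutoff n)) (tau k t).

Lemma tau_ge0 k t : 0 <= t -> 0 <= tau k t.
Proof. by move=> t0; rewrite mulr_ge0 ?clock_ge0// ltW// scale2_gt0. Qed.

Lemma is_derive_tau k (t : R) : 0 <= t -> is_derive t (1 : R) (tau k) (scale2 k * q t).
Proof. by move=> t0; exact: (is_deriveZ (scale2 k) (is_derive_clock t0)). Qed.

Lemma is_derive_th k (t : R) : 0 <= t -> is_derive t (1 : R) (th k) (dth k t).
Proof.
move=> t0; have d2 : is_derive (tau k t) (1 : R) (cutoff n) (derive1 (cutoff n) (tau k t)).
  by rewrite derive1E; apply: derivableP; apply: smooth1_derivable; exact: smooth1_cutoff.
have := @is_derive1_comp _ (cutoff n) (tau k) t _ _ d2 (is_derive_tau k t0).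
by rewrite mulrC.
Qed.

Lemma is_derive_dth k (t : R) : 0 <= t -> is_derive t (1 : R) (dth k) (ddth k t).
Proof.
move=> t0.
have d2 : is_derive (tau k t) (1 : R) (derive1 (cutoff n)) (derive1 (derive1 (cutoff n)) (tau k t)).
  rewrite [derive1 (derive1 _) _]derive1E; apply: derivableP; apply: smooth1_derivable.
  by apply: smooth1_derive; exact: smooth1_cutoff.
have d3 := @is_derive1_comp _ (derive1 (cutoff n)) (tau k) t _ _ d2 (is_derive_tau k t0).
have d4 : is_derive t (1 : R) (fun s => scale2 k * q s) (scale2 k * drate t) :=
  is_deriveZ (scale2 k) (is_derive_rate t0).
refine (is_derive_eq (is_deriveM d4 d3) _).
by rewrite /ddth /GRing.scale/=; ring.
Qed.

Lemma th_ge0 k t : 0 <= th k t. Proof. exact: cutoff_ge0. Qed.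

Lemma th_le_succ k t : th k t <= th k.+1 t.
Proof.
rewrite /th /cutoff lerXn2r ?nnegrE ?bump_ge0// /tau (scale2S k) -mulrA.
exact: bump_quadruple.
Qed.

(** As for [phi0]: the cutoff of index [k] is closed before the next one starts
    to decrease. *)
Lemma th_eq0 k t : 1 <= tau k.+1 t -> th k t = 0.
Proof.
rewrite /th /tau (scale2S k) -mulrA => h; rewrite cutoff0//.
by rewrite ger0_norm; move: h; move: (scale2 k.+1 * clock t) => y; lra.
Qed.

Lemma th_eq1 k t : 0 <= t -> tau k t < 1 -> [/\ th k t = 1, dth k t = 0 & ddth k t = 0].
Proof.
move=> t0 h; have h' : `|tau k t| < 1 by rewrite ger0_norm// tau_ge0.
by rewrite /th /dth /ddth cutoff1 ?ltW// derive1_cutoff_in// derive2_cutoff_in// !mulr0 addr0.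
Qed.

Lemma th_out k t : 2 <= tau k t -> th k t = 0 /\ dth k t = 0 /\ ddth k t = 0.
Proof.
move=> h; have h' : 2 <= `|tau k t| by rewrite (le_trans h)// ler_norm.
have [C C0 hC] := @cutoff_derive_bounded R n.
have [h1 h2] := hC (tau k t).
have bn : bump (tau k t) ^+ n = 0 by rewrite bump0// expr0n gtn_eqF.
rewrite bn mulr0 in h1 h2.
have e1 : derive1 (cutoff n) (tau k t) = 0 by apply/eqP; rewrite -normr_le0.
have e2 : derive1 (derive1 (cutoff n)) (tau k t) = 0 by apply/eqP; rewrite -normr_le0.
by rewrite /th cutoff0// /dth /ddth e1 e2 !mulr0 addr0.
Qed.

(** Both derivatives gain a factor [4^(-k)]. In the second one the square
    of the rate is compensated by the second factor [4^(-k)], since the clock is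
    at most [2 * 4^k] on the support. *)
Lemma dth_bound : exists2 C, 0 < C & forall k t, 0 <= t ->
  `|dth k t| <= C * q t * scale2 k * bump (tau k t) ^+ n /\
  `|ddth k t| <= C * scale2 k * bump (tau k t) ^+ n.
Proof.
have [C C0 hC] := @cutoff_derive_bounded R n.
exists (6 * C); first by rewrite mulr_gt0.
move=> k t t0; have [h1 h2] := hC (tau k t).
have s0 := scale2_gt0 k; have s1 := scale2_le1 k; have q0 := rate_gt0 beta t0.
have B0 : 0 <= C * bump (tau k t) ^+ n by rewrite mulr_ge0 ?(ltW C0)// exprn_ge0// bump_ge0.
split.
  rewrite /dth normrM (gtr0_norm (mulr_gt0 s0 q0)).
  have -> : 6 * C * q t * scale2 k * bump (tau k t) ^+ n = scale2 k * q t * (6 * (C * bump (tau k t) ^+ n)) by ring.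
  apply: ler_wpM2l; first exact/ltW/mulr_gt0.
  by apply: (le_trans h1); rewrite ler_peMl// ler1n.
have [t2|t2] := leP 2 (tau k t).
  have [_ [_ ->]] := th_out t2; rewrite normr0.
  have -> : 6 * C * scale2 k * bump (tau k t) ^+ n = scale2 k * (6 * (C * bump (tau k t) ^+ n)) by ring.
  by apply: mulr_ge0; [exact: ltW|exact: mulr_ge0].
have -> : 6 * C * scale2 k * bump (tau k t) ^+ n =
  scale2 k * (C * bump (tau k t) ^+ n) + 5 * (scale2 k * (C * bump (tau k t) ^+ n)) by ring.
rewrite /ddth (le_trans (ler_normD _ _))//; apply: lerD.
  rewrite normrM normrM (gtr0_norm s0) -[leLHS]mulrA; apply: ler_wpM2l; first exact: ltW.
  by rewrite -[leRHS]mul1r; apply: ler_pM => //; exact: drate_bound.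
rewrite normrM (ger0_norm (sqr_ge0 _)).
have hq : scale2 k * q t ^+ 2 <= 5.
  have := rate_sqr_le t0; move: t2; rewrite /tau => t2 hq.
  apply: (@le_trans _ _ (scale2 k * (1 + 2 * clock t))); first by apply: ler_wpM2l => //; exact: ltW.
  by move: t2 s1; move: (scale2 k) (clock t) => x y; lra.
have -> : (scale2 k * q t) ^+ 2 = (scale2 k * q t ^+ 2) * scale2 k by ring.
rewrite -[leLHS]mulrA; apply: ler_pM => //.
- by apply: mulr_ge0; [exact: ltW|exact: sqr_ge0].
- by apply: mulr_ge0; [exact: ltW|exact: normr_ge0].
- by apply: ler_wpM2l => //; exact: ltW.
Qed.

End time_cutoff.

End clock.

(** * The implicit recursion *)

Section iteration.
Context {R : realType}.
Local Notation lm := (@lebesgue_measure R).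

(** Continuity on both sides of the interval is assumed so that the derivative
    is two-sided at the end points. *)
Lemma antiderivative (f : R -> R) (s0 s1 : R) : 0 < s0 -> s0 <= s1 ->
  (exists2 u, s1 < u & forall t, 0 < t -> t <= u -> {for t, continuous f}) ->
  exists H : R -> R, forall t, s0 <= t <= s1 -> is_derive t (1 : R) H (f t).
Proof.
move=> s00 s01 [u s1u cf]; pose a := s0 / 2.
have a0 : 0 < a by rewrite divr_gt0.
have as0 : a < s0 by rewrite /a; lra.
have intf : lm.-integrable `[a, u] (EFin \o f).
  apply: continuous_compact_integrable; first exact: segment_compact.
  apply: continuous_in_subspaceT => t; rewrite inE/= in_itv/= => /andP[at_ tu].
  by apply: cf => //; exact: lt_le_trans at_.
exists (fun t => \int[lm]_(s in `[a, t]) f s) => t /andP[s0t ts1].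
have at_ : a < t by exact: lt_le_trans s0t.
have tu : t < u by exact: le_lt_trans s1u.
have [d1 d2] := continuous_FTC1_closed tu intf at_ (cf t (lt_trans a0 at_) (ltW tu)).
by apply: DeriveDef; [exact: d1|rewrite -derive1E; exact: d2].
Qed.

(** A tangent inequality for the convex function [s |-> s^(-(p-1))]. *)
Lemma powRN_drop (p x y : R) : 1 < p -> 0 < x -> x <= y ->
  (p - 1) * y `^ (- p) * (y - x) <= x `^ (- (p - 1)) - y `^ (- (p - 1)).
Proof.
move=> p1 x0 xy.
have : y `^ (- (p - 1)) + (p - 1) * y `^ (- p) * y <= x `^ (- (p - 1)) + (p - 1) * y `^ (- p) * x.
  apply: (@nincr_is_derive _ (fun s => s `^ (- (p - 1)) + (p - 1) * y `^ (- p) * s)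
    (fun s => - (p - 1) * s `^ (- (p - 1) - 1) + (p - 1) * y `^ (- p) * 1)) => //.
  - move=> t /andP[xt _]; have t0 := lt_le_trans x0 xt.
    exact: (is_deriveD (is_derive1_powR (- (p - 1)) t0) (is_deriveZ ((p - 1) * y `^ (- p)) (is_derive_id t 1))).
  - move=> t /andP[xt ty]; have t0 := lt_le_trans x0 xt.
    have -> : - (p - 1) - 1 = - p by ring.
    rewrite mulr1 mulNr addrC subr_le0; apply: ler_wpM2l; first by rewrite subr_ge0 ltW.
    rewrite !powRN lef_pV2 ?posrE ?powR_gt0//; last exact: lt_le_trans ty.
    by rewrite ge0_ler_powR ?nnegrE ?(ltW (lt_trans ltr01 p1)) ?(ltW t0) ?(ltW (lt_le_trans t0 ty)).
rewrite mulrBr; lra.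
Qed.

(** The discrete counterpart of the blow-up of [S' = S^p]: since the scheme is
    implicit it cannot be continued beyond a number of steps of order
    [delta^(1 - p)]. *)
Lemma implicit_scheme_lifespan (p p' C : R) : 1 < p -> 1 < p' -> p^-1 + p'^-1 = 1 -> 0 < C ->
  exists2 C2, 0 < C2 & forall (delta : R) (A : nat -> R) (N : nat), 0 < delta ->
    (forall k, (k <= N)%N -> 0 <= A k) ->
    (forall k l, (k < N)%N -> 0 < l ->
      delta + A k.+1 <= C * (l `^ p * (A k.+1 - A k) + l `^ (- p'))) ->
    N%:R <= C2 * delta `^ (- (p - 1)).
Proof.
move=> p1 p'1 pp C0.
have p0 := lt_trans ltr01 p1; have p'0 := lt_trans ltr01 p'1.
have D0 : 0 < 2 * C by rewrite mulr_gt0.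
pose c := (2 * C) `^ (- p).
have c0 : 0 < c by rewrite powR_gt0.
have pc0 : 0 < (p - 1) * c by rewrite mulr_gt0// subr_gt0.
exists ((p - 1) * c)^-1; first by rewrite invr_gt0.
move=> delta A N d0 A0 hA.
pose S k := delta + A k.
have S0 k : (k <= N)%N -> 0 < S k by move=> kN; rewrite ltr_wpDr// A0.
have step k : (k < N)%N -> c * S k.+1 `^ p <= S k.+1 - S k.
  move=> kN; have s0 := S0 k.+1 kN.
  (* The parameter for which the term in [l^(-p')] is half of the left side. *)
  pose l := (S k.+1 / (2 * C)) `^ (- p'^-1).
  have y0 : 0 < S k.+1 / (2 * C) by rewrite divr_gt0.
  have l0 : 0 < l by rewrite powR_gt0.
  have l1 : l `^ (- p') = S k.+1 / (2 * C).
    by rewrite /l -powRrM mulNr mulrN opprK mulVf ?gt_eqF// powRr1// ltW.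
  have l2 : l `^ p = (S k.+1 / (2 * C)) `^ (- (p - 1)).
    rewrite /l -powRrM; congr (_ `^ _).
    have -> : p'^-1 = 1 - p^-1 by rewrite -pp addrAC subrr add0r.
    by field; rewrite gt_eqF.
  have := hA k l kN l0; rewrite l1 l2 -/(S k.+1).
  have -> : A k.+1 - A k = S k.+1 - S k by rewrite /S opprD addrACA subrr add0r.
  have -> : C * ((S k.+1 / (2 * C)) `^ (- (p - 1)) * (S k.+1 - S k) + S k.+1 / (2 * C)) =
    C * ((S k.+1 / (2 * C)) `^ (- (p - 1)) * (S k.+1 - S k)) + S k.+1 / 2.
    by field; rewrite gt_eqF.
  rewrite powRN => h.
  have {}h : S k.+1 / (2 * C) <= ((S k.+1 / (2 * C)) `^ (p - 1))^-1 * (S k.+1 - S k).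
    rewrite ler_pdivrMr// mulrC -mulrA.
    by move: h; move: (_^-1 * _) => z; lra.
  rewrite ler_pdivlMl ?powR_gt0// mulrC mulr_powRB1 ?(ltW y0)// in h.
  apply: le_trans h; rewrite powRM ?invr_ge0 ?(ltW D0) ?(ltW s0)// mulrC /c.
  by rewrite -powR_inv1 ?(ltW D0)// -powRrM mulN1r.
have sub k : (k <= N)%N -> k%:R * ((p - 1) * c) <= S 0%N `^ (- (p - 1)) - S k `^ (- (p - 1)).
  elim: k => [|k IH] kN; first by rewrite mul0r subrr.
  have s0 := S0 k (ltnW kN); have s1 := S0 k.+1 kN.
  have st := step k kN.
  have sS : S k <= S k.+1.
    by rewrite -subr_ge0; apply: le_trans st; rewrite mulr_ge0 ?powR_ge0 ?(ltW c0).
  have h1 := powRN_drop p1 s0 sS.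
  have h2 : (p - 1) * c <= (p - 1) * S k.+1 `^ (- p) * (S k.+1 - S k).
    rewrite -mulrA; apply: ler_wpM2l; first by rewrite subr_ge0 ltW.
    by rewrite powRN mulrC ler_pdivlMr ?powR_gt0.
  have h3 := IH (ltnW kN).
  rewrite -[k.+1%:R]natr1 [(k%:R + 1) * _]mulrDl mul1r.
  apply: le_trans (lerD h3 (le_trans h2 h1)) _.
  by rewrite addrA subrK.
have h := sub N (leqnn N).
rewrite mulrC ler_pdivlMr//; apply: (le_trans h).
apply: (@le_trans _ _ (S 0%N `^ (- (p - 1)))); first by rewrite lerBlDr lerDl powR_ge0.
rewrite !powRN lef_pV2 ?posrE ?powR_gt0 ?S0//.
by rewrite ge0_ler_powR ?nnegrE ?subr_ge0 ?(ltW p1) ?(ltW d0) ?(ltW (S0 0%N (leq0n _)))// lerDl A0.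
Qed.

End iteration.

(** * The weighted energy *)

Section energy_estimate.
Context {R : realType} {n : nat}.
Hypothesis n_gt0 : (0 < n)%N.
Local Notation mu := (lebesgue_rV R n).
Local Notation p := (fujita n : R).
Local Notation p' := (n.+2%:R / 2 : R).
Variables (beta : R) (b : R -> R).
Hypothesis beta_itv : -1 <= beta < 1.
Hypothesis b_gt0 : forall t, 0 <= t -> 0 < b t.
Hypothesis b1 : damping_B1 b.
Hypothesis b2 : damping_B2 beta b.
Local Notation g := (weight b).
Local Notation q := (rate beta).
Local Notation th := (th beta n).
Local Notation dth := (dth beta n).
Local Notation ddth := (ddth beta n).
Local Notation tau := (tau beta).

Definition mean (u : 'rV[R]_n -> R) k : R := \int[mu]_x (u x * phi k x).
Definition lap_mean (u : 'rV[R]_n -> R) k : R := \sum_(i < n) \int[mu]_x (u x * phi2 k i x).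

Lemma nonlin_ge0 (u : 'rV[R]_n -> R) k : 0 <= nonlin u k.
Proof. by apply: Rintegral_ge0 => x _; rewrite mulr_ge0 ?powR_ge0 ?phi_ge0. Qed.

Lemma nonlin_le_succ (u : 'rV[R]_n -> R) k :
  mu.-integrable setT (fun x => (`|u x| `^ p * phi k x)%:E) ->
  mu.-integrable setT (fun x => (`|u x| `^ p * phi k.+1 x)%:E) ->
  nonlin u k <= nonlin u k.+1.
Proof.
move=> i0 i1; apply: le_Rintegral => // x _.
by apply: ler_wpM2l; [exact: powR_ge0|exact: phi_le_succ].
Qed.

(** What the cutoffs leave of the derivative of the energy beyond the
    nonlinearity; see [is_derive_energy]. *)
Definition remainder (u : 'rV[R]_n -> R) k t : R :=
  (dth k t - (b t * g t - 1) * dth k t - g t * ddth k t) * mean u k + th k t * g t * lap_mean u k.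

(** Each term of the remainder is a pairing to which [space_pairing_bound]
    applies: the time derivatives through the dyadic shells in time, the
    Laplacian through those in space. *)
Lemma remainder_bound : exists2 C : R, 0 < C & forall (u : 'rV[R]_n -> R) k t l,
  L2 R n u ->
  mu.-integrable setT (fun x => (`|u x| `^ p * phi k x)%:E) ->
  mu.-integrable setT (fun x => (`|u x| `^ p * phi k.+1 x)%:E) -> 0 < t -> 0 < l ->
  `|remainder u k.+1 t| <= C * q t *
   (l `^ p * (th k.+1 t * nonlin u k.+1 - th k t * nonlin u k) +
    l `^ (- p') * (4 ^+ n * scale2 k.+1)).
Proof.
have [C1 C10 hC1] := @dth_bound R beta beta_itv n n_gt0.
have [C2 C20 hC2] := @phi2_bound R n.
have [M M0 hM] := weight_upper beta_itv b_gt0 b1 b2.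
have [G G0 hG] := weight_derive_bounded beta_itv b_gt0 b1 b2.
pose c1 := C1 * (1 + G + M); pose c2 := M * C2.
have c10 : 0 < c1 by rewrite mulr_gt0// !addr_gt0.
have c20 : 0 < c2 by rewrite mulr_gt0.
exists (c1 + n%:R * c2); first by rewrite addr_gt0// mulr_gt0// ltr0n.
move=> u k t l u2 i0 i1 t0 l0; have t0' := ltW t0.
set X := l `^ p * _ + _.
have q0 := rate_gt0 beta t0'; have g0 := weight_ge0 beta_itv b_gt0 b1 b2 t.
have s0 := scale2_gt0 (R:=R) k.+1.
pose eta : R := bump (tau k.+1 t).
have eta0 : 0 <= eta by exact: bump_ge0.
have gM := hM t t0.
have th1 : th k.+1 t = eta ^+ n.+2 by [].
have B0 : 0 <= eta ^+ n by rewrite exprn_ge0.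
have H0 x : 0 <= profile k.+1 x :> R by have /andP[] := profile01 k.+1 x.
have dicho x : 1 <= tau k.+1 t -> th k t * phi k x = 0.
  by move=> h; rewrite (th_eq0 n h) mul0r.
set a1 := dth k.+1 t - (b t * g t - 1) * dth k.+1 t - g t * ddth k.+1 t.
have ha1 : `|a1| <= c1 * q t * scale2 k.+1 * eta ^+ n.
  have [h1 h2] := hC1 k.+1 t t0'; rewrite -/eta in h1 h2.
  have h3 : `|(b t * g t - 1) * dth k.+1 t| <= G * (C1 * q t * scale2 k.+1 * eta ^+ n).
    by rewrite normrM; apply: ler_pM => //; exact: hG.
  have h4 : `|g t * ddth k.+1 t| <= M * q t * (C1 * scale2 k.+1 * eta ^+ n).
    by rewrite normrM (ger0_norm g0); apply: ler_pM.
  rewrite /a1 (le_trans (ler_normB _ _))//.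
  apply: (le_trans (lerD (ler_normB _ _) h4)).
  apply: (le_trans (lerD (lerD h1 h3) (lexx _))).
  rewrite le_eqVlt; apply/orP; left; apply/eqP; rewrite /c1; ring.
have hU : `|a1 * mean u k.+1| <= c1 * q t * X.
  have -> : a1 * mean u k.+1 = \int[mu]_x (u x * (a1 * phi k.+1 x)).
    rewrite /mean -RintegralZl//; last exact: (L2_mul_integrable u2 (L2_phi k.+1)).
    by apply: eq_Rintegral => x _; rewrite mulrCA.
  apply: (@space_pairing_bound R n n_gt0 u (fun x => a1 * phi k.+1 x) k (th k t) eta) => //.
  - exact: (L2Z a1 (L2_phi k.+1)).
  - exact: th_ge0.
  - by rewrite mulr_ge0// ltW.
  - exact: th_le_succ.
  - move=> x; rewrite normrM (ger0_norm (phi_ge0 _ _)) exprMn mulrA; apply: ler_pM => //.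
      exact: phi_ge0.
    rewrite phiE -[n.+2]addn2 exprD ler_piMr ?exprn_ge0//.
    by rewrite exprn_ile1//; have /andP[] := profile01 k.+1 x.
  - move=> x; have [h|h] := ltP (tau k.+1 t) 1; last by right; exact: dicho.
    left; rewrite /a1; have [_ -> ->] := th_eq1 n t0' h.
    by rewrite !mulr0 !subr0 mul0r.
have hL i : `|th k.+1 t * g t * \int[mu]_x (u x * phi2 k.+1 i x)| <= c2 * q t * X.
  have -> : th k.+1 t * g t * \int[mu]_x (u x * phi2 k.+1 i x) =
      \int[mu]_x (u x * (th k.+1 t * g t * phi2 k.+1 i x)).
    rewrite -RintegralZl//; last exact: (L2_mul_integrable u2 (L2_phi2 k.+1 i)).
    by apply: eq_Rintegral => x _; rewrite mulrCA.
  apply: (@space_pairing_bound R n n_gt0 u (fun x => th k.+1 t * g t * phi2 k.+1 i x) k (th k t) eta) => //.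
  - exact: (L2Z (th k.+1 t * g t) (L2_phi2 k.+1 i)).
  - exact: th_ge0.
  - by rewrite mulr_ge0// ltW.
  - exact: th_le_succ.
  - move=> x; rewrite normrM normrM (ger0_norm (th_ge0 _ _ _ _)) (ger0_norm g0).
    have hth : th k.+1 t <= eta ^+ n by exact: cutoff_le_bumpX.
    have -> : c2 * q t * 2 ^- k.+1 ^+ 2 * (eta * profile k.+1 x) ^+ n =
      (eta ^+ n * (M * q t)) * (C2 * 2 ^- k.+1 ^+ 2 * profile k.+1 x ^+ n).
      by rewrite exprMn /c2; ring.
    apply: ler_pM => //; first by rewrite mulr_ge0// th_ge0.
    by apply: ler_pM => //; exact: th_ge0.
  - move=> x; have [h|h] := ltP `|2 ^- k.+1 * x ord0 i| 1.
      by left; rewrite phi2_0// mulr0.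
    by right; rewrite (phi0 h) mulr0.
rewrite /remainder -/a1 (le_trans (ler_normD _ _))//.
have -> : (c1 + n%:R * c2) * q t * X = c1 * q t * X + n%:R * (c2 * q t * X) by ring.
apply: lerD => //.
rewrite /lap_mean mulr_sumr (le_trans (ler_norm_sum _ _ _))//.
apply: (@le_trans _ _ (\sum_(i < n) c2 * q t * X)); first by apply: ler_sum => i _.
by rewrite sumr_const card_ord -[leLHS]mulr_natl.
Qed.

Variables (u0 u1 : 'rV[R]_n -> R) (eps : R) (T : \bar R) (u : R -> 'rV[R]_n -> R).
Hypothesis T_gt0 : (0 < T)%E.
Hypothesis u02 : L2 R n u0.
Hypothesis u12 : L2 R n u1.
Hypothesis sol : energy_solution b p u0 u1 eps T u.

(** The term with [dth] is there to integrate by parts in time once more: it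
    cancels the velocity in the derivative of the energy. *)
Definition energy (V : nat -> R -> R) k t : R :=
  th k t * (g t * V k t + mean (u t) k) - g t * dth k t * mean (u t) k.

(** The conclusion of [energy_solution_ode] for the cutoff [phi k]. *)
Definition velocity_of k (v : R -> R) :=
  let W t := nonlin (u t) k - b t * v t + lap_mean (u t) k in
  [/\ forall t, 0 < t -> (t%:E < T)%E -> is_derive t (1 : R) (fun s => mean (u s) k) (v t) /\
         is_derive t (1 : R) v (W t),
      forall t, 0 < t -> (t%:E < T)%E -> {for t, continuous W} /\
         {for t, continuous (fun s => lap_mean (u s) k)},
      mean (u t) k @[t --> 0^'+] --> eps * \int[mu]_x (u0 x * phi k x) /\
      v t @[t --> 0^'+] --> eps * \int[mu]_x (u1 x * phi k x) &
      forall t, 0 < t -> (t%:E < T)%E -> L2 R n (u t) /\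
        mu.-integrable setT (fun x => (`|u t x| `^ p * phi k x)%:E)].

Definition velocity_spec (V : nat -> R -> R) := forall k, velocity_of k (V k).

Lemma velocity_exists : exists V, velocity_spec V.
Proof.
suff /choice[V hV] : forall k, exists v, velocity_of k v by exists V.
move=> k; exact: (energy_solution_ode T_gt0 u02 u12 sol (radius_ge0 k) (smooth_space_factors k) (supported_space_factors (k:=k))).
Qed.

Lemma is_derive_energy V k (t : R) : velocity_spec V -> 0 < t -> (t%:E < T)%E ->
  is_derive t (1 : R) (energy V k) (g t * (th k t * nonlin (u t) k) + remainder (u t) k t).
Proof.
move=> hV t0 tT; have [/(_ t t0 tT)[dU dV] _ _ _] := hV k.
have dg := is_derive_weight beta_itv b_gt0 b1 b2 t0.
have dt := is_derive_th beta n k (ltW t0).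
have ddt := is_derive_dth beta n k (ltW t0).
refine (is_derive_eq (is_deriveB (is_deriveM dt (is_deriveD (is_deriveM dg dV) dU))
  (is_deriveM (is_deriveM dg ddt) dU)) _).
rewrite /remainder /GRing.scale/=.
transitivity (th k t *
  (g t * (nonlin (u t) k - b t * V k t + lap_mean (u t) k) +
   V k t * (b t * g t - 1) + V k t) +
  (g t * V k t + mean (u t) k) * dth k t -
  (g t * dth k t * V k t +
   mean (u t) k * (g t * ddth k t + dth k t * (b t * g t - 1)))); first by [].
ring.
Qed.

End energy_estimate.

(** * One dyadic step *)

Section energy_step.
Context {R : realType} {n : nat}.
Hypothesis n_gt0 : (0 < n)%N.
Local Notation mu := (lebesgue_rV R n).
Local Notation p := (fujita n : R).
Local Notation p' := (n.+2%:R / 2 : R).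
Variables (beta : R) (b : R -> R).
Hypothesis beta_itv : -1 <= beta < 1.
Hypothesis b_gt0 : forall t, 0 <= t -> 0 < b t.
Hypothesis b1 : damping_B1 b.
Hypothesis b2 : damping_B2 beta b.
Local Notation g := (weight b).
Local Notation q := (rate beta).
Local Notation th := (th beta n).
Local Notation dth := (dth beta n).
Local Notation ddth := (ddth beta n).
Local Notation tau := (tau beta).

Lemma interval_between (T : \bar R) (M : R) : (M%:E < T)%E ->
  exists2 v : R, M < v & (v%:E < T)%E.
Proof.
case: T => [r| |]//.
  by rewrite lte_fin => Mr; exists ((M + r) / 2); rewrite ?lte_fin; lra.
by move=> _; exists (M + 1); rewrite ?ltry// ltrDl.
Qed.

(** The derivative of the energy is integrated from [t0] to [M], where the cutoff
    has closed and the energy vanishes. The term in [l^p] telescopes to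
    [A k.+1 - A k]; the term in [l^(-p')] is the rate times [4^(-(k+1))], whose
    integral over the support of the time cutoff is bounded independently of [k]. *)
Lemma energy_step : exists2 C : R, 0 < C &
  forall (u0 u1 : 'rV[R]_n -> R) eps (T : \bar R) u V (t0 M : R),
  velocity_spec b u0 u1 eps T u V -> 0 < t0 -> t0 <= M -> (M%:E < T)%E ->
  exists A : nat -> R, (forall k, 0 <= A k) /\
    forall k l, 0 < l -> 2 <= tau k.+1 M ->
      energy beta b u V k.+1 t0 + A k.+1 <= C * (l `^ p * (A k.+1 - A k) + l `^ (- p')).
Proof.
have sqr9 (x : R) : 0 <= x -> x <= 2 -> (1 + x) ^+ 2 <= 9 by move=> *; nra.
have [C1 C10 hR] := remainder_bound n_gt0 beta_itv b_gt0 b1 b2.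
have [m m0 hm] := weight_lower beta_itv b_gt0 b1 b2.
pose c1 := C1 / m; pose c2 := 9 * C1 * 4 ^+ n.
have c10 : 0 < c1 by rewrite divr_gt0.
have c20 : 0 < c2 by rewrite mulr_gt0 ?exprn_gt0// mulr_gt0.
exists (c1 + c2); first exact: addr_gt0.
move=> u0 u1 eps T u V t0 M hV t00 t0M MT.
have [v Mv vT] := interval_between MT.
have inT t : t <= v -> (t%:E < T)%E by move=> tv; apply: le_lt_trans vT; rewrite lee_fin.
pose f k t := g t * (th k t * nonlin (u t) k).
have cont k t : 0 < t -> t <= v -> {for t, continuous (f k)}.
  move=> t0' tv; have tT := inT t tv.
  have [/(_ t t0' tT)[_ [dV _]] /(_ t t0' tT)[cW cL] _ _] := hV k.
  have dc (F : R -> R) d : is_derive t (1 : R) F d -> {for t, continuous F}.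
    by move=> [dF _]; apply/differentiable_continuous/derivable1_diffP.
  have cb := continuous_b b1 t0'.
  have cVk : {for t, continuous (V k)} by apply/differentiable_continuous/derivable1_diffP.
  have cN : {for t, continuous (fun s => nonlin (u s) k)}.
    have E : (fun s => nonlin (u s) k) =
       (fun s => (nonlin (u s) k - b s * V k s + lap_mean (u s) k) + b s * V k s - lap_mean (u s) k).
      by apply/funext => s; ring.
    rewrite E; apply: cvgB; last exact: cL.
    by apply: cvgD; [exact: cW|exact: (cvgM cb cVk)].
  apply: cvgM; first exact: dc (is_derive_weight beta_itv b_gt0 b1 b2 t0').
  apply: cvgM; first exact: dc (is_derive_th beta n k (ltW t0')).
  exact: cN.
have /choice[H hH] : forall k, exists H : R -> R, forall t, t0 <= t <= M -> is_derive t (1 : R) H (f k t).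
  by move=> k; apply: antiderivative => //; exists v => // t t0' tv; exact: cont.
have pos t : t0 <= t <= M -> 0 < t /\ (t%:E < T)%E.
  move=> /andP[h1 h2]; split; first exact: lt_le_trans h1.
  by apply: inT; exact: le_trans (ltW Mv).
exists (fun k => H k M - H k t0); split.
  move=> k; rewrite subr_ge0; apply: (@ndecr_is_derive _ (H k) (f k)) => //.
  move=> t /pos[t0' _]; apply: mulr_ge0; first exact: (weight_ge0 beta_itv b_gt0 b1 b2).
  by apply: mulr_ge0; [exact: th_ge0|exact: nonlin_ge0].
move=> k l l0 tM.
have lp := powR_gt0 p l0; have lp' := powR_gt0 (- p') l0.
(* A bounded function of the clock whose derivative dominates the scaled rate
   on the support of the cutoff: it absorbs the error in [l^(-p')]. *)
pose Z t : R := - (1 + tau k.+1 t)^-1.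
pose dZ t : R := (scale2 k.+1 * q t) / (1 + tau k.+1 t) ^+ 2.
have tau0 t : 0 <= t -> 0 <= tau k.+1 t by exact: tau_ge0.
have hZ (t : R) : 0 <= t -> is_derive t (1 : R) Z (dZ t).
  move=> t0'; have h1 : 1 + tau k.+1 t != 0 by rewrite gt_eqF// ltr_pwDl// tau0.
  have d1 : is_derive t (1 : R) (fun s => 1 + tau k.+1 s) (0 + scale2 k.+1 * q t) :=
    is_deriveD (is_derive_cst (1 : R) t 1) (is_derive_tau beta k.+1 t0').
  refine (is_derive_eq (is_deriveN (is_deriveV (f := fun s => 1 + tau k.+1 s) h1 d1)) _).
  by rewrite add0r /dZ /GRing.scale/= mulNr opprK mulrC.
pose C := c1 + c2.
pose Psi t := energy beta b u V k.+1 t - H k.+1 t +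
  (C * l `^ p * (H k.+1 t - H k t) + C * l `^ (- p') * Z t).
pose dPsi t := g t * (th k.+1 t * nonlin (u t) k.+1) + remainder beta b (u t) k.+1 t - f k.+1 t +
  (C * l `^ p * (f k.+1 t - f k t) + C * l `^ (- p') * dZ t).
have : Psi t0 <= Psi M.
  apply: (@ndecr_is_derive _ Psi dPsi); first exact: t0M.
  - move=> t htM; have [t0' tT] := pos t htM.
    have dE := is_derive_energy beta_itv b_gt0 b1 b2 k.+1 hV t0' tT.
    have d1 := is_deriveZ (C * l `^ p) (is_deriveB (hH k.+1 t htM) (hH k t htM)).
    have d2 := is_deriveZ (C * l `^ (- p')) (hZ t (ltW t0')).
    exact: (is_deriveD (is_deriveB dE (hH k.+1 t htM)) (is_deriveD d1 d2)).
  - move=> t htM; have [t0' tT] := pos t htM.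
    have [_ _ _ /(_ t t0' tT)[u2 i0]] := hV k; have [_ _ _ /(_ t t0' tT)[_ i1]] := hV k.+1.
    have hr := hR (u t) k t l u2 i0 i1 t0' l0.
    set r := remainder _ _ _ _ _ in hr *.
    pose D := th k.+1 t * nonlin (u t) k.+1 - th k t * nonlin (u t) k.
    have D0 : 0 <= D.
      rewrite subr_ge0; apply: ler_pM; [exact: th_ge0|exact: nonlin_ge0|exact: th_le_succ|exact: nonlin_le_succ].
    have q0 := rate_gt0 beta (ltW t0'); have s0 := scale2_gt0 (R:=R) k.+1.
    have qg : C1 * q t <= c1 * g t.
      by rewrite /c1 -mulrA; apply: ler_wpM2l; [exact: ltW|rewrite ler_pdivlMl ?hm].
    have g0 := weight_ge0 beta_itv b_gt0 b1 b2 t.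
    have dZ0 : 0 <= dZ t.
      by apply: divr_ge0; [apply: mulr_ge0; exact: ltW|exact: sqr_ge0].
    have gD0 : 0 <= g t * D by exact: mulr_ge0.
    have nn x y z : 0 < x -> 0 < y -> 0 <= z -> 0 <= x * y * z :> R.
      by move=> x0 y0 z0; apply: mulr_ge0 => //; exact/ltW/mulr_gt0.
    have key : `|r| <= c1 * l `^ p * (g t * D) + c2 * l `^ (- p') * dZ t.
      have [t2|t2] := leP (tau k.+1 t) 2; last first.
        have [h1 [h2 h3]] := th_out n_gt0 (ltW t2).
        rewrite /r /remainder h1 h2 h3 !mulr0 !subr0 !mul0r addr0 normr0.
        by apply: addr_ge0; exact: nn.
      have h9 : q t * scale2 k.+1 <= 9 * dZ t.
        rewrite /dZ mulrA ler_pdivlMr ?exprn_gt0 ?ltr_pwDl ?tau0 ?(ltW t0')//.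
        rewrite mulrC [q t * _]mulrC; apply: ler_wpM2r; first by rewrite mulr_ge0// ltW.
        by apply: sqr9 => //; exact/tau0/ltW.
      apply: (le_trans hr); rewrite mulrDr; apply: lerD.
        rewrite -/D [leLHS]mulrCA -[leRHS]mulrA [leRHS]mulrCA; apply: ler_wpM2l; first exact: ltW.
        by rewrite mulrA; apply: ler_wpM2r.
      have -> : C1 * q t * (l `^ (- p') * (4 ^+ n * scale2 k.+1)) =
         (C1 * 4 ^+ n * l `^ (- p')) * (q t * scale2 k.+1) by ring.
      have -> : c2 * l `^ (- p') * dZ t = (C1 * 4 ^+ n * l `^ (- p')) * (9 * dZ t) by rewrite /c2; ring.
      by apply: ler_wpM2l => //; apply: mulr_ge0; [apply: mulr_ge0; [exact: ltW|exact: exprn_ge0]|exact: ltW].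
    have gD : f k.+1 t - f k t = g t * D by rewrite /f /D mulrBr.
    have x1 : 0 <= c2 * l `^ p * (g t * D) by exact: nn.
    have x2 : 0 <= c1 * l `^ (- p') * dZ t by exact: nn.
    have x3 : - r <= c1 * l `^ p * (g t * D) + c2 * l `^ (- p') * dZ t.
      by apply: le_trans key; rewrite -normrN ler_norm.
    have -> : dPsi t = r + ((c1 * l `^ p * (g t * D) + c2 * l `^ (- p') * dZ t) +
        (c2 * l `^ p * (g t * D) + c1 * l `^ (- p') * dZ t)).
      by rewrite /dPsi gD /C /f -/r; ring.
    rewrite addrA; apply: addr_ge0; last exact: addr_ge0.
    by rewrite addrC -lerBlDr sub0r.
have [h1 [h2 _]] := th_out n_gt0 tM.
have EM : energy beta b u V k.+1 M = 0 by rewrite /energy h1 h2 mulr0 !mul0r subr0.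
have ZM : Z M <= 0 by rewrite oppr_le0 invr_ge0 addr_ge0// tau0// (le_trans (ltW t00)).
have Z0 : -1 <= Z t0.
  by rewrite lerN2 invf_le1 ?ltr_pwDl ?tau0 ?(ltW t00)// lerDl tau0// ltW.
have C0 : 0 <= C * l `^ (- p') by rewrite mulr_ge0 ?(ltW lp')// ltW// addr_gt0.
rewrite /Psi EM => hPsi.
have hz : C * l `^ (- p') * (Z M - Z t0) <= C * l `^ (- p').
  by rewrite -[leRHS]mulr1; apply: ler_wpM2l => //; lra.
have -> : C * (l `^ p * (H k.+1 M - H k.+1 t0 - (H k M - H k t0)) + l `^ (- p')) =
  C * l `^ p * (H k.+1 M - H k M) - C * l `^ p * (H k.+1 t0 - H k t0) + C * l `^ (- p') by ring.
move: hPsi hz; rewrite mulrBr.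
move: (C * l `^ (- p') * Z M) (C * l `^ (- p') * Z t0) (C * l `^ p * (H k.+1 M - H k M))
  (C * l `^ p * (H k.+1 t0 - H k t0)) (C * l `^ (- p')) (energy _ _ _ _ _ _) (H k.+1 M) (H k.+1 t0).
by clear; move=> *; lra.
Qed.

End energy_step.

(** * Initial data and the growth of the clock *)

Section blowup.
Context {R : realType} {n : nat}.
Hypothesis n_gt0 : (0 < n)%N.
Local Notation mu := (lebesgue_rV R n).

Lemma cvg_mean_phi (h : 'rV[R]_n -> R) : mu.-integrable setT (EFin \o h) ->
  \int[mu]_x (h x * phi k x) @[k --> \oo] --> \int[mu]_x h x.
Proof.
move=> ih; have mh : measurable_fun setT h by apply/measurable_EFinP; exact: measurable_int ih.
have mphi k : measurable_fun setT (fun x => h x * phi k x).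
  by apply: measurable_funM => //; apply: measurable_tensor; exact: smooth_space_factors.
have foo : (\int[mu]_x (h x)%:E)%E \is a fin_num by exact: integrable_fin_num ih.
have /fine_cvgP[_ cf] : (\int[mu]_x (h x * phi k x)%:E @[k --> \oo] --> (\int[mu]_x h x)%:E)%E.
  rewrite /Rintegral fineK//.
  apply: (@dominated_cvg _ _ _ mu setT measurableT (fun k x => (h x * phi k x)%:E)
    (EFin \o h) (fun x => `|h x|%:E)).
  - by move=> k; apply/measurable_EFinP.
  - move=> x _; apply: cvg_near_cst.
    have [N hN] : exists N, cube (2 ^+ N) x.
      have [N xN] := cube_exhaust x; exists N => j; apply: (le_trans (ltW (xN j))).
      by rewrite -natrX ler_nat ltn_expl.
    near=> k; rewrite phi1 ?mulr1// => j.
    apply: (le_trans (hN j)); rewrite ler_weXn2l ?ler1n//.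
    near: k; exact: nbhs_infty_ge.
  - by [].
  - exact: integrable_norm ih.
  - move=> k x _; rewrite /= lee_fin normrM ler_piMr// ger0_norm ?phi_ge0//.
    exact: phi_le1.
exact: cf.
Unshelve. all: by end_near. Qed.

Variables (beta : R) (b : R -> R).
Hypothesis beta_itv : -1 <= beta < 1.
Hypothesis b_gt0 : forall t, 0 <= t -> 0 < b t.
Hypothesis b1 : damping_B1 b.
Hypothesis b2 : damping_B2 beta b.
Variables (u0 u1 : 'rV[R]_n -> R).
Hypothesis u02 : L2 R n u0.
Hypothesis u12 : L2 R n u1.

(** The time cutoff equals 1 near the initial time, and there the weight tends
    to [bstar b]: this is where the mean of the data comes from. *)
Lemma cvg_energy0 eps (T : \bar R) u V k : velocity_spec b u0 u1 eps T u V ->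
  energy beta b u V k t @[t --> 0^'+] --> eps * \int[mu]_x ((u0 x + bstar b * u1 x) * phi k x).
Proof.
move=> hV; have [_ _ [cU cV] _] := hV k.
have cg := cvg_weight0 beta_itv b_gt0 b1 b2.
have -> : eps * \int[mu]_x ((u0 x + bstar b * u1 x) * phi k x) =
    bstar b * (eps * \int[mu]_x (u1 x * phi k x)) + eps * \int[mu]_x (u0 x * phi k x).
  have i0 := L2_mul_integrable u02 (L2_phi k); have i1 := L2_mul_integrable u12 (L2_phi k).
  have i1' : mu.-integrable setT (EFin \o (fun x => bstar b * (u1 x * phi k x))).
    by apply: eq_integrable (integrableZl _ (bstar b) i1) => // x _; rewrite /= EFinM.
  have -> : \int[mu]_x ((u0 x + bstar b * u1 x) * phi k x) =
     \int[mu]_x (u0 x * phi k x + bstar b * (u1 x * phi k x)).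
    by apply: eq_Rintegral => x _; rewrite mulrDl mulrA.
  by rewrite RintegralD// RintegralZl//; ring.
have c1 : weight b t * V k t + mean (u t) k @[t --> 0^'+] -->
   bstar b * (eps * \int[mu]_x (u1 x * phi k x)) + eps * \int[mu]_x (u0 x * phi k x).
  by apply: cvgD; [exact: (cvgM cg cV)|exact: cU].
apply: cvg_trans c1; apply: near_eq_cvg.
have ct : tau beta k t @[t --> 0^'+] --> tau beta k 0.
  apply: cvg_at_right_filter; apply/differentiable_continuous/derivable1_diffP.
  by have [] := is_derive_tau beta k (lexx (0 : R)).
have tau0 : tau beta k 0 = 0 by rewrite /tau clock0 mulr0.
near=> t.
have t0 : 0 <= t by near: t; exact: nbhs_right_ge.
have : tau beta k t < 1 by near: t; apply: (cvgr_lt _ ct); rewrite tau0.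
move=> /(th_eq1 n t0)[h1 h2 _].
by rewrite /energy h1 h2 mulr0 mul0r subr0 mul1r.
Unshelve. all: by end_near. Qed.

Lemma four_pow_le_exp (N : nat) : 2 * 4 ^+ N <= expR (1 + 2 * N%:R) :> R.
Proof.
have e2 : 2 <= expR 1 :> R by have := expR_ge1Dx (1 : R); lra.
rewrite expRD; apply: ler_pM => //.
have -> : expR (2 * N%:R) = (expR 1 ^+ 2) ^+ N :> R.
  by rewrite -exprM -expRM_natl natrM mulr1.
rewrite lerXn2r ?nnegrE ?exprn_ge0 ?expR_ge0//.
have -> : 4 = 2 ^+ 2 :> R by ring.
by rewrite lerXn2r ?nnegrE ?expR_ge0.
Qed.

(** The inverse of the clock: exponential for [beta = -1], a power otherwise.
    The exponent [D + 2] leaves room for the constants, since [1 <= X]. *)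
Lemma clock_lower (D : R) : 0 < D -> exists2 C, 0 < C & forall X, 1 <= X ->
  expR (D * X) <= clock beta (if beta == -1 then expR (expR (C * X)) else expR (C * X)).
Proof.
move=> D0; case: (eqVneq beta (-1)) => [bE|bn].
  exists D => // X X1; rewrite /clock bE eqxx.
  rewrite -[leLHS]expRK ler_ln ?posrE ?addr_gt0 ?expR_gt0//.
  by rewrite lerDr.
have /andP[bN1 blt1] := beta_itv.
have b10 : 0 < 1 + beta by rewrite -(opprK 1) addrC subr_gt0 lt_neqAle eq_sym bn.
exists ((D + 2) / (1 + beta)); first by rewrite divr_gt0// addr_gt0.
move=> X X1; rewrite /clock (negbTE bn).
set E := expR ((D + 2) / (1 + beta) * X).
have E0 : 0 < E by exact: expR_gt0.
have h1 : expR ((D + 2) * X) <= (1 + E) `^ (1 + beta).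
  have -> : expR ((D + 2) * X) = E `^ (1 + beta).
    rewrite /E -expRM; congr expR; field; rewrite gt_eqF//.
  by rewrite ge0_ler_powR ?nnegrE ?(ltW b10) ?(ltW E0) ?addr_ge0 ?(ltW E0)// lerDr.
rewrite ler_pdivlMr// lerBrDr; apply: le_trans h1.
have h2 : 1 <= expR (D * X) by rewrite -expR0 ler_expR mulr_ge0 ?(ltW D0)// (le_trans ler01).
have h3 : 3 <= expR (2 * X) by have := expR_ge1Dx (2 * X); lra.
rewrite mulrDl expRD.
by move: h2 h3 blt1; move: (expR _) (expR _) => x y; nra.
Qed.

End blowup.

(** * The lifespan estimate *)

Section lifespan_estimate.
Context {R : realType} {n : nat}.
Hypothesis n_gt0 : (0 < n)%N.
Local Notation mu := (lebesgue_rV R n).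
Local Notation p := (fujita n : R).
Variables (beta : R) (b : R -> R).
Hypothesis beta_itv : -1 <= beta < 1.
Hypothesis b_gt0 : forall t, 0 <= t -> 0 < b t.
Hypothesis b1 : damping_B1 b.
Hypothesis b2 : damping_B2 beta b.
Variables (u0 u1 : 'rV[R]_n -> R).
Hypothesis u02 : L2 R n u0.
Hypothesis u12 : L2 R n u1.
Hypothesis u01 : u0 \in Lfun mu 1.
Hypothesis u11 : u1 \in Lfun mu 1.
Hypothesis data_gt0 : 0 < \int[mu]_x (u0 x + bstar b * u1 x).

(** For [k] beyond [k0] the cutoff captures half of the mean of the data, and the
    [N] dyadic steps above [k0] obey [implicit_scheme_lifespan]. *)
Lemma lifespan_steps : exists k0 : nat, exists2 C : R, 0 < C &
  forall eps T u (N : nat) (M : R), 0 < eps -> (0 < T)%E -> energy_solution b p u0 u1 eps T u ->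
  0 < M -> (M%:E < T)%E -> 2 <= tau beta (k0 + N) M -> N%:R <= C * eps `^ (- (p - 1)).
Proof.
move: data_gt0; set I0 := \int[mu]_x _ => I00.
have [k0 hk0] : exists k0, forall k, (k0 <= k)%N ->
    I0 / 2 < \int[mu]_x ((u0 x + bstar b * u1 x) * phi k x).
  have ih : mu.-integrable setT (EFin \o (fun x => u0 x + bstar b * u1 x)).
    have /Lfun1_integrable i0 := u01; have /Lfun1_integrable i1 := u11.
    have i2 := integrableD measurableT i0 (integrableZl measurableT (bstar b) i1).
    by apply: eq_integrable i2.
  have h2 : I0 / 2 < I0 by move: I00; lra.
  by have [k0 _ hk] := cvgr_gt _ (cvg_mean_phi ih) _ h2; exists k0.
have [C C0 hC] := energy_step n_gt0 beta_itv b_gt0 b1 b2.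
have [C2 C20 hC2] := implicit_scheme_lifespan (fujita_gt1 n_gt0) (conj_gt1 n_gt0) (fujita_conj n_gt0) C0.
exists k0, (C2 * (I0 / 4) `^ (- (p - 1))).
  by rewrite mulr_gt0// powR_gt0// divr_gt0.
move=> eps T u N M eps0 T0 sol M0 MT tM.
have [V hV] := velocity_exists T0 u02 u12 sol.
have d0 : 0 < eps * (I0 / 4) by rewrite mulr_gt0// divr_gt0.
have [t0 [t00 t0M] hE] : exists2 t0, 0 < t0 /\ t0 <= M &
    forall k, (k < N)%N -> eps * (I0 / 4) <= energy beta b u V (k0 + k).+1 t0.
  have hE : \forall t \near 0^'+, forall j : 'I_N, eps * (I0 / 4) < energy beta b u V (k0 + j).+1 t.
    apply: filter_forall => j.
    have lt4 : eps * (I0 / 4) < eps * \int[mu]_x ((u0 x + bstar b * u1 x) * phi (k0 + j).+1 x).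
      rewrite ltr_pM2l//; apply: le_lt_trans (hk0 _ _); last by rewrite -addnS leq_addr.
      by move: I00; lra.
    exact: (cvgr_gt _ (cvg_energy0 beta_itv b_gt0 b1 b2 u02 u12 hV) _ lt4).
  near (0 : R)^'+ => t; exists t.
    by split; near: t; [exact: nbhs_right_gt|exact: nbhs_right_le].
  move=> k kN; apply/ltW; suff /(_ (Ordinal kN)) : forall j : 'I_N,
    eps * (I0 / 4) < energy beta b u V (k0 + j).+1 t by [].
  by near: t.
have [A [A0 hA]] := hC _ _ _ _ _ _ _ _ hV t00 t0M MT.
have -> : C2 * (I0 / 4) `^ (- (p - 1)) * eps `^ (- (p - 1)) =
    C2 * (eps * (I0 / 4)) `^ (- (p - 1)).
  by rewrite [(eps * _) `^ _]powRM ?(ltW eps0)//; [ring|rewrite divr_ge0// ltW].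
apply: (hC2 _ (fun k => A (k0 + k)%N) N d0 (fun k _ => A0 _)) => k l kN l0.
rewrite addnS; apply: le_trans (hA (k0 + k)%N l l0 _); first by rewrite lerD2r hE.
apply: (le_trans tM); apply: ler_wpM2r; first exact: (clock_ge0 beta (ltW M0)).
rewrite !scale2E lef_pV2 ?posrE ?exprn_gt0//.
by apply: ler_weXn2l; [rewrite ler1n|rewrite -addnS leq_add2l].
Unshelve. all: by end_near. Qed.

(** A solution living beyond the claimed time [M] would allow one more dyadic
    step than [lifespan_steps] does. *)
Lemma lifespan_bound : exists2 C : R, 0 < C & forall eps, 0 < eps < 1 ->
   (lifespan b p u0 u1 eps <=
       (if beta == -1 then expR (expR (C * eps `^ (- (p - 1))))
        else expR (C * eps `^ (- (p - 1))))%:E)%E.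
Proof.
have [k0 [C C0 hC]] := lifespan_steps.
(* [2 * 4^(k0 + N) <= exp (1 + 2 (k0 + N))], with [N <= C X + 1] and [1 <= X]. *)
pose D : R := 3 + 2 * k0%:R + 2 * C.
have D0 : 0 < D by rewrite ltr_wpDl ?mulr_gt0 ?addr_ge0 ?mulr_ge0.
have [K K0 hK] := clock_lower beta_itv D0.
exists K => // eps /andP[e0 e1].
set X := eps `^ _.
have X1 : 1 <= X.
  rewrite /X powRN invf_ge1 ?powR_gt0//.
  have h1 : 1 `^ (p - 1) = 1 by rewrite powR1.
  by rewrite -[leRHS]h1 ge0_ler_powR ?nnegrE ?subr_ge0 ?(ltW e0) ?(ltW e1)// ltW// fujita_gt1.
set M := (if _ then _ else _).
apply: ge_ereal_sup => T [T0 [u [sol _]]]; rewrite leNgt; apply/negP => MT.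
have M0 : 0 < M by rewrite /M; case: ifP => _; exact: expR_gt0.
pose N := (Num.trunc (C * X)).+1.
have NX : N%:R <= C * X + 1.
  by rewrite /N -natr1 lerD2r truncn_le mulr_ge0// ?(ltW C0)// (le_trans _ X1).
suff /(hC eps T u N M e0 T0 sol M0 MT) : 2 <= tau beta (k0 + N) M.
  by rewrite leNgt truncnS_gt.
rewrite /tau scale2E ler_pdivlMl ?exprn_gt0// [X in X <= _]mulrC.
apply: (le_trans (four_pow_le_exp _)); apply: le_trans (hK X X1).
rewrite ler_expR natrD /D; have k00 : 0 <= k0%:R :> R by [].
by move: NX X1 C0 k00; move: (_ %:R) (k0 %:R) => x y *; nra.
Qed.

End lifespan_estimate.

Unset Implicit Arguments.
Set Strict Implicit.

Theorem theorem1p1 (R : realType) (n : nat) (n_gt0 : (0 < n)%N)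
    (p : R) (p_def : p = fujita n)
    (beta : R) (beta_itv : -1 <= beta < 1) (beta_neq0 : beta != 0)
    (b : R -> R) (b_gt0 : forall t, 0 <= t -> 0 < b t)
    (b1 : damping_B1 b) (b2 : damping_B2 beta b)
    (b3 : damping_B3 beta b) (b4 : damping_B4 beta b)
    (u0 u1 : 'rV[R]_n -> R)
    (u0_H1 : H1 R n u0) (u0_L1 : u0 \in Lfun (lebesgue_rV R n) 1)
    (u1_L2 : L2 R n u1) (u1_L1 : u1 \in Lfun (lebesgue_rV R n) 1)
    (data_gt0 : 0 < \int[lebesgue_rV R n]_x (u0 x + bstar b * u1 x)) :
  exists C eps0 : R, 0 < C /\ 0 < eps0 /\
    forall eps : R, 0 < eps < eps0 ->
      (lifespan b p u0 u1 eps <=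
       (if beta == -1 then expR (expR (C * eps `^ (- (p - 1))))
        else expR (C * eps `^ (- (p - 1))))%:E)%E.
Proof.
rewrite p_def.
have [C C0 hC] := lifespan_bound n_gt0 beta_itv b_gt0 b1 b2 u0_H1.1 u1_L2 u0_L1 u1_L1 data_gt0.
by exists C, 1.
Qed.
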